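(* For $\mathrm{SU}(3)$-invariant steady Laplacian solitons (with principal orbit $\mathrm{SU}(3)/T^2$): (i) The only possible limit cone of an asymptotically conical (AC) end is the torsion-free cone. The asymptotic rate is $-1$, except for static solutions on torsion-free AC ends, which have rate $-4$. (ii) There exists a $3$-parameter family of such AC steady ends up to scale and time translation (and a $1$-parameter subfamily of static solutions). (iii) Any small perturbation of an initial condition that leads to an AC end still gives an AC end.
   Context: An $\mathrm{SU}(3)$-invariant steady Laplacian soliton on $I\times \mathrm{SU}(3)/T^2$ is (up to discrete symmetries) given by functions $f_1,f_2,f_3:I\to(0,\infty)$, $u:I\to\mathbb{R}$ satisfying $2(f_1f_2f_3)'=\sum_i f_i^2$, $\;(\tau_i-uf_i^2)'=0$ for $i=1,2,3$, and $\sum_i\tau_i=u\sum_i f_i^2$, where $\tau_i:=(f_i^2)'+\frac{f_i^2}{f_1f_2f_3}\bigl(2f_i^2-\sum_jf_j^2\bigr)$. It corresponds to a closed invariant $G_2$-structure $\varphi$ with metric $dt^2+\sum f_i^2g_i$ ($g_i$ the invariant metrics on the irreducible summands of the isotropy representation), torsion 2-form $\tau=\sum\tau_i\omega_i$ ($\omega_i$ the corresponding invariant 2-forms), and $X=u\,\partial_t$, with $\Delta_\varphi\varphi=\mathcal{L}_X\varphi$. Equivalently $(f,\tau)$ solves a nonsingular first-order ODE system on the phase space $\{(f,\tau)\in(0,\infty)^3\times\mathbb{R}^3:\sum_i\tau_if_i^{-2}=0\}$; ''initial condition'' means a point of this phase space. The system is invariant under the scaling $(t,f_i,u,\tau_i)\mapsto(\mu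 t,\mu f_i,\mu^{-1}u,\mu\tau_i)$, $\mu>0$. A solution is an AC end with limit cone $f_i=c_it$ ($c_i>0$) if it exists for all large $t$ and $f_i/t\to c_i$ as $t\to\infty$; it has rate $\nu<0$ if, after a translation in $t$, $f_i=c_it+O(t^{1+\nu})$ as $t\to\infty$ (with corresponding decay of derivatives), i.e. the metric approaches the cone metric at relative order $t^\nu$. The torsion-free cone is $f_1=f_2=f_3=\frac12t$ (the cone over the homogeneous nearly Kähler structure on $\mathrm{SU}(3)/T^2$). Static solutions are those with $\tau_1=\tau_2=\tau_3=0$ and $u=0$. *)

(* Defs.v *)
From Stdlib Require Import Reals.
From Coquelicot Require Import Coquelicot.
Open Scope R_scope.

(* Labels of the three irreducible isotropy summands of SU(3)/T^2. *)
Inductive idx : Set := i1 | i2 | i3.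

Definition sum3 (g : idx -> R) : R := g i1 + g i2 + g i3.
Definition prod3 (g : idx -> R) : R := g i1 * g i2 * g i3.

(* The coefficient tau_i of the torsion 2-form. *)
Definition torsion (f : idx -> R -> R) (i : idx) (t : R) : R :=
  Derive (fun s => f i s ^ 2) t
  + f i t ^ 2 / prod3 (fun j => f j t)
    * (2 * f i t ^ 2 - sum3 (fun j => f j t ^ 2)).

(* [I] is meant to be an open interval: all derivatives are two-sided.
   Only differentiability is required; the equations make tau_i - u f_i^2
   constant, and solutions are then automatically smooth. *)
Record steady_soliton (I : R -> Prop) (f : idx -> R -> R) (u : R -> R) : Prop := {
  soliton_pos : forall i t, I t -> 0 < f i t;
  soliton_diff : forall i t, I t -> ex_derive (f i) t;
  soliton_closed : forall t, I t ->
    2 * Derive (fun s => prod3 (fun i => f i s)) t = sum3 (fun i => f i t ^ 2);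
  soliton_conserved : forall i t, I t ->
    is_derive (fun s => torsion f i s - u s * f i s ^ 2) t 0;
  soliton_trace : forall t, I t ->
    sum3 (fun i => torsion f i t) = u t * sum3 (fun i => f i t ^ 2)
}.

Definition ray (a t : R) : Prop := a < t.

Definition static (I : R -> Prop) (f : idx -> R -> R) (u : R -> R) : Prop :=
  forall t, I t -> u t = 0 /\ forall i, torsion f i t = 0.

(* A solution on (a, oo) asymptotic to the cone f_i = c_i t. *)
Definition AC_end (a : R) (f : idx -> R -> R) (u : R -> R) (c : idx -> R) : Prop :=
  steady_soliton (ray a) f u /\
  forall i, 0 < c i /\ is_lim (fun t => f i t / t) p_infty (c i).

(* After a translation by s, f_i = c_i t + O(t^(1+nu)), and the n-th derivative
   of the error is O(t^(1+nu-n)). *)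
Definition has_rate (f : idx -> R -> R) (c : idx -> R) (nu : R) : Prop :=
  nu < 0 /\
  exists s : R, forall (i : idx) (n : nat), exists C : R,
    Rbar_locally p_infty (fun t =>
      ex_derive_n (fun r => f i (r + s) - c i * r) n t /\
      Rabs (Derive_n (fun r => f i (r + s) - c i * r) n t)
        <= C * Rpower t (1 + nu - INR n)).

(* [has_rate] is an upper bound on the error, hence inherited by every larger
   negative exponent; "the" rate is the one which cannot be improved. *)
Definition optimal_rate (f : idx -> R -> R) (c : idx -> R) (nu : R) : Prop :=
  has_rate f c nu /\ forall nu', nu' < nu -> ~ has_rate f c nu'.

(* The solution is a translate of the cone itself, whose rate is arbitrary. *)
Definition exact_cone (a : R) (f : idx -> R -> R) (c : idx -> R) : Prop :=
  exists s : R, forall i t, ray a t -> f i t = c i * (t + s).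

Definition state : Type := ((idx -> R) * (idx -> R))%type.

Definition phase_space (x : state) : Prop :=
  (forall i, 0 < fst x i) /\ sum3 (fun i => snd x i / fst x i ^ 2) = 0.

Definition state_at (f : idx -> R -> R) (t : R) : state :=
  (fun i => f i t, fun i => torsion f i t).

Definition leads_to_AC_end (x : state) : Prop :=
  exists (a t0 : R) (f : idx -> R -> R) (u : R -> R) (c : idx -> R),
    a < t0 /\ AC_end a f u c /\ state_at f t0 = x.

(* The ends f and g agree for large t up to scale and time translation; u and
   tau are determined by f, so they need not be compared. *)
Definition same_end (f g : idx -> R -> R) : Prop :=
  exists mu s : R, 0 < mu /\
    Rbar_locally p_infty (fun t => forall i, g i (mu * t + s) = mu * f i t).

(* Main.v *)
(* Put x_i = f_i^2 and F = f_1 f_2 f_3.  The equations say that tau_i = u x_i + k_i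
   with constants k_i of sum 0 and that u = -(1/3) sum_j k_j / x_j, so the system is
   an ODE for f depending on the parameter k.  The quantities A_i = F^2 / x_i obey
   A_i' = 2 F - F^2 (u / x_i + k_i / x_i^2).

   Hence A_i - l^2 A_j is strictly decreasing for every l > 1 once k is small against
   f.  This makes {f_j < (11/10) f_i, 100 |k_j| < f_i for all i, j} forward invariant,
   and there all ratios f_j / f_i tend to 1, so f_i' tends to 1/2: every solution
   entering this open set is an AC end, and by continuous dependence on initial data
   so are its perturbations.  For the family in (ii), the initial data lie on the
   hypersurface A_1 = (21/20)^2 A_2, which an orbit crosses only once.

   On any AC end, l = 1 gives (A_i - A_j)' ~ (k_j - k_i) t^2 / 4, so
   f_j - f_i -> (k_j - k_i) / 3, which is the rate -1 unless k = 0.  If k = 0 then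
   A_i - A_j is constant and f_j - f_i is of exact order t^(-3), the rate -4.  The mean
   of the f_i differs from t/2 + const by a quadratically smaller term. *)
Require Import Defs.
From Stdlib Require Import Reals Lra Lia FunctionalExtensionality Classical.
From Coquelicot Require Import Coquelicot.
Open Scope R_scope.

(** * The flow of a bounded Lipschitz vector field *)

(** The field is singular where some f_i vanishes, and the f_i grow without bound along every end,
    so no cutoff of f to a bounded set could contain a whole end. But f enters the equations only
    through the ratios f_i / f_j and the reciprocals 1 / f_j, and these stay bounded along an end.
    Cutting off just these quantities, together with k, gives a bounded and globally Lipschitz
    field, whose flow exists for all times and solves the true equations as long as no cutoff is
    active. Inside the trapping region none becomes active later, so one flow with one constant N
    serves for infinite time.

    The quantities A_i are suggested by the static case, where their differences are conserved. For
    l > 1 the difference A_i - l^2 A_j acquires the damping term -2 (l^2 - 1) F, which is cubic in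
    f, whereas the terms with k are only quadratic: this is why k only has to be small against f.
    The value 11/10 is small enough for crude numerical bounds on all ratios to suffice, and large
    enough for the damping at l = 21/20 and l = 11/10 to beat k under the bound 100 |k_j| < f_i. *)

Lemma is_derive_val (f : R -> R) (x l l' : R) : is_derive f x l -> l = l' -> is_derive f x l'.
Proof. intros H <-; exact H. Qed.

Lemma is_derive_const_R (c x : R) : is_derive (fun _ : R => c) x 0.
Proof. apply (is_derive_const (K := R_AbsRing) (V := R_NormedModule) c x). Qed.

Lemma is_derive_continuous (f : R -> R) (x l : R) : is_derive f x l -> continuous f x.
Proof. intros H; apply (ex_derive_continuous f x); exists l; exact H. Qed.

Lemma derive_nonneg_le (f df : R -> R) (a b : R) :
  a <= b ->
  (forall x, a <= x <= b -> is_derive f x (df x)) ->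
  (forall x, a <= x <= b -> 0 <= df x) -> f a <= f b.
Proof.
  intros Hab Hd Hn.
  destruct (MVT_gen f a b df) as [c [Hc E]]; rewrite ?Rmin_left, ?Rmax_right in * by lra.
  - intros x Hx; apply Hd; lra.
  - intros x Hx; apply continuity_pt_filterlim.
    apply (is_derive_continuous _ _ _ (Hd x Hx)).
  - assert (0 <= df c * (b - a)) by (apply Rmult_le_pos; [apply Hn|]; lra). lra.
Qed.

Lemma derive_neg_lt (f df : R -> R) (a b : R) :
  a < b ->
  (forall x, a <= x <= b -> is_derive f x (df x)) ->
  (forall x, a <= x <= b -> df x < 0) -> f b < f a.
Proof.
  intros Hab Hd Hn.
  destruct (MVT_gen f a b df) as [c [Hc E]]; rewrite ?Rmin_left, ?Rmax_right in * by lra.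
  - intros x Hx; apply Hd; lra.
  - intros x Hx; apply continuity_pt_filterlim.
    apply (is_derive_continuous _ _ _ (Hd x Hx)).
  - assert (0 < - df c * (b - a)) by (apply Rmult_lt_0_compat; [specialize (Hn c Hc)|]; lra). lra.
Qed.

(** Twice the hyperbolic cosine of K t, used as the weight of a Bielecki norm: integrating a
    function bounded by it gains a factor 1 / K, forwards and backwards in time alike, so Picard
    iteration converges on the whole line without a short-time step. *)
Definition cosh2 (K t : R) : R := exp (K * t) + exp (- (K * t)).

Lemma cosh2_ge2 (K t : R) : 2 <= cosh2 K t.
Proof.
  unfold cosh2; rewrite exp_Ropp.
  assert (H := exp_pos (K * t)).
  set (e := exp (K * t)) in *.
  assert (E : e + / e - 2 = (e - 1) ^ 2 * / e) by (field; lra).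
  assert (0 <= (e - 1) ^ 2 * / e).
  { apply Rmult_le_pos; [apply pow2_ge_0 | left; apply Rinv_0_lt_compat; exact H]. }
  lra.
Qed.

Lemma cosh2_primitive (K s t0 : R) : K <> 0 ->
  is_derive (fun t => (exp (K * (t - t0)) - exp (- (K * (t - t0)))) / K) s (cosh2 K (s - t0)).
Proof.
  intros HK; unfold cosh2; auto_derive; [exact I|].
  replace (s + - t0) with (s - t0) by ring. field; exact HK.
Qed.

(** The weight has the primitive 2 sinh (K (t - t0)) / K, which vanishes at t0 and is bounded in
    absolute value by the weight divided by K; [h] is compared with c times this primitive on either
    side of t0. *)
Lemma cosh2_comparison (h dh : R -> R) (K c t0 t : R) :
  0 < K -> 0 <= c -> h t0 = 0 ->
  (forall s, Rmin t0 t <= s <= Rmax t0 t ->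
     is_derive h s (dh s) /\ Rabs (dh s) <= c * cosh2 K (s - t0)) ->
  Rabs (h t) <= c / K * cosh2 K (t - t0).
Proof.
  intros HK Hc H0 Hd.
  set (p := fun t => (exp (K * (t - t0)) - exp (- (K * (t - t0)))) / K).
  assert (Hp : forall s, is_derive p s (cosh2 K (s - t0))) by (intros s; apply cosh2_primitive; lra).
  assert (P0 : p t0 = 0).
  { unfold p; replace (- (K * (t0 - t0))) with (K * (t0 - t0)) by ring. unfold Rdiv; ring. }
  assert (PB : Rabs (p t) <= cosh2 K (t - t0) / K).
  { unfold p, cosh2, Rdiv; rewrite Rabs_mult, (Rabs_pos_eq (/ K)) by (left; apply Rinv_0_lt_compat, HK).
    apply Rmult_le_compat_r; [left; apply Rinv_0_lt_compat, HK|].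
    assert (A := exp_pos (K * (t - t0))); assert (B := exp_pos (- (K * (t - t0)))).
    apply Rabs_le; lra. }
  assert (Hm : forall s, Rmin t0 t <= s <= Rmax t0 t ->
     is_derive (fun s => c * p s - h s) s (c * cosh2 K (s - t0) - dh s) /\
     0 <= c * cosh2 K (s - t0) - dh s).
  { intros s Hs; destruct (Hd s Hs) as [D B]; split.
    - apply (is_derive_minus (fun s => c * p s) h); [apply is_derive_scal, Hp | exact D].
    - apply Rabs_le_between in B; lra. }
  assert (Hq : forall s, Rmin t0 t <= s <= Rmax t0 t ->
     is_derive (fun s => c * p s + h s) s (c * cosh2 K (s - t0) + dh s) /\
     0 <= c * cosh2 K (s - t0) + dh s).
  { intros s Hs; destruct (Hd s Hs) as [D B]; split.
    - apply (is_derive_plus (fun s => c * p s) h); [apply is_derive_scal, Hp | exact D].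
    - apply Rabs_le_between in B; lra. }
  assert (Rabs (h t) <= c * Rabs (p t)).
  { destruct (Rle_dec t0 t) as [Ht|Ht].
    - rewrite Rmin_left, Rmax_right in * by lra.
      assert (A := derive_nonneg_le _ _ _ _ Ht (fun s Hs => proj1 (Hm s Hs)) (fun s Hs => proj2 (Hm s Hs))).
      assert (B := derive_nonneg_le _ _ _ _ Ht (fun s Hs => proj1 (Hq s Hs)) (fun s Hs => proj2 (Hq s Hs))).
      cbv beta in A, B; rewrite H0, P0 in *.
      assert (c * p t <= c * Rabs (p t)) by (apply Rmult_le_compat_l; [lra | apply Rle_abs]).
      apply Rabs_le; lra.
    - rewrite Rmin_right, Rmax_left in * by lra.
      assert (Ht' : t <= t0) by lra.
      assert (A := derive_nonneg_le _ _ _ _ Ht' (fun s Hs => proj1 (Hm s Hs)) (fun s Hs => proj2 (Hm s Hs))).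
      assert (B := derive_nonneg_le _ _ _ _ Ht' (fun s Hs => proj1 (Hq s Hs)) (fun s Hs => proj2 (Hq s Hs))).
      cbv beta in A, B; rewrite H0, P0 in *.
      assert (c * - p t <= c * Rabs (p t)).
      { apply Rmult_le_compat_l; [lra|]. rewrite <- Rabs_Ropp. apply Rle_abs. }
      apply Rabs_le; lra. }
  assert (c * Rabs (p t) <= c * (cosh2 K (t - t0) / K)) by (apply Rmult_le_compat_l; assumption).
  unfold Rdiv in *; nra.
Qed.

(** The sup norm appears only through an upper bound [d], so no supremum over the arbitrary index
    type [J] has to be formed. *)
Definition bounded_lipschitz {J : Type} (B L : R) (G : (J -> R) -> J -> R) : Prop :=
  0 <= B /\ 0 < L /\ (forall y j, Rabs (G y j) <= B) /\
  (forall y z d, (forall j, Rabs (y j - z j) <= d) -> forall j, Rabs (G y j - G z j) <= L * d).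

Fixpoint picard {J : Type} (G : (J -> R) -> J -> R) (y0 : J -> R) (n : nat) (t : R) (j : J) : R :=
  match n with
  | O => y0 j
  | S m => y0 j + RInt (fun s => G (picard G y0 m s) j) 0 t
  end.

(** [Lim_seq] and [real] are total and give a number for any [G]; that it is the limit of the
    iterates is [picard_lim]. *)
Definition flow {J : Type} (G : (J -> R) -> J -> R) (y0 : J -> R) (t : R) (j : J) : R :=
  real (Lim_seq (fun n => picard G y0 n t j)).

Lemma lipschitz_continuous (h : R -> R) (C : R) :
  (forall s t, Rabs (h s - h t) <= C * Rabs (s - t)) -> forall t, continuous h t.
Proof.
  intros H t; apply continuity_pt_filterlim.
  intros eps Heps.
  assert (HC : 0 <= C).
  { specialize (H 1 0); assert (A := Rabs_pos (h 1 - h 0)).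
    replace (Rabs (1 - 0)) with 1 in H by (rewrite Rabs_pos_eq; lra); lra. }
  exists (eps / (C + 1)); split; [apply Rdiv_lt_0_compat; lra|].
  intros x [_ Hx]; simpl in *; unfold R_dist in *.
  eapply Rle_lt_trans; [apply H|].
  apply Rle_lt_trans with ((C + 1) * Rabs (x - t)).
  - apply Rmult_le_compat_r; [apply Rabs_pos | lra].
  - apply (Rmult_lt_compat_l (C + 1)) in Hx; [|lra].
    replace ((C + 1) * (eps / (C + 1))) with eps in Hx by (field; lra). exact Hx.
Qed.

Lemma continuous_derive_RInt (h : R -> R) (y a t : R) : (forall s, continuous h s) ->
  is_derive (fun t => y + RInt h a t) t (h t).
Proof.
  intros H.
  apply is_derive_val with (0 + h t); [|ring].
  apply (is_derive_plus (fun _ => y) (fun t => RInt h a t)); [apply is_derive_const_R|].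
  apply (is_derive_RInt h (fun t => RInt h a t) a).
  - apply filter_forall; intros b; apply (RInt_correct h), ex_RInt_continuous; intros; apply H.
  - apply H.
Qed.

Lemma continuous_RInt_lipschitz (h : R -> R) (y a B : R) :
  (forall s, continuous h s) -> (forall s, Rabs (h s) <= B) ->
  forall s t, Rabs ((y + RInt h a s) - (y + RInt h a t)) <= B * Rabs (s - t).
Proof.
  intros H HB s t.
  destruct (MVT_gen (fun t => y + RInt h a t) t s h) as [c [Hc E]].
  - intros x _; apply continuous_derive_RInt, H.
  - intros x _; apply continuity_pt_filterlim.
    apply (is_derive_continuous (fun t => y + RInt h a t) _ (h x)), continuous_derive_RInt, H.
  - rewrite E, Rabs_mult; apply Rmult_le_compat_r; [apply Rabs_pos | apply HB].
Qed.

Section Picard.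
Context {J : Type} {B L : R} {G : (J -> R) -> J -> R} (HG : bounded_lipschitz B L G).

Lemma field_along_lipschitz (Y : R -> J -> R) :
  (forall s t j, Rabs (Y s j - Y t j) <= B * Rabs (s - t)) ->
  forall j t, continuous (fun s => G (Y s) j) t.
Proof.
  destruct HG as (HB & HL & Hb & Hl).
  intros H j; apply lipschitz_continuous with (L * B).
  intros s t; rewrite Rmult_assoc; apply Hl; intros; apply H.
Qed.

Lemma picard_lipschitz (y0 : J -> R) (n : nat) :
  forall s t j, Rabs (picard G y0 n s j - picard G y0 n t j) <= B * Rabs (s - t).
Proof.
  destruct HG as (HB & HL & Hb & Hl).
  induction n as [|n IH]; intros s t j; simpl.
  - rewrite Rminus_diag_eq, Rabs_R0 by reflexivity. apply Rmult_le_pos; [lra | apply Rabs_pos].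
  - apply continuous_RInt_lipschitz; [apply field_along_lipschitz, IH | intros; apply Hb].
Qed.

Lemma picard_derive (y0 : J -> R) (n : nat) (t : R) (j : J) :
  is_derive (fun t => picard G y0 (S n) t j) t (G (picard G y0 n t) j).
Proof. simpl; apply continuous_derive_RInt, field_along_lipschitz, picard_lipschitz. Qed.

Lemma picard_init (y0 : J -> R) (n : nat) (j : J) : picard G y0 n 0 j = y0 j.
Proof. destruct n; simpl; [reflexivity|]. rewrite RInt_point; unfold zero; simpl; ring. Qed.

(** With this exponent one Picard step contracts the weighted norm by L / K = 1/2; [D] bounds the
    first step, where only the bound [B] on the field is available. *)
Let K := 2 * L.
Let D := B / K.

Lemma picard_step (y0 : J -> R) (n : nat) : forall t j,
  Rabs (picard G y0 (S n) t j - picard G y0 n t j) <= D * (/ 2) ^ n * cosh2 K t.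
Proof.
  destruct HG as (HB & HL & Hb & Hl).
  assert (HK : 0 < K) by (unfold K; lra).
  assert (HD : 0 <= D) by (apply Rmult_le_pos; [lra | left; apply Rinv_0_lt_compat, HK]).
  induction n as [|n IH]; intros t j.
  - replace (D * (/ 2) ^ 0) with (B / K) by (unfold D; simpl; ring).
    replace t with (t - 0) at 3 by ring.
    apply cosh2_comparison with (h := fun t => picard G y0 1 t j - picard G y0 0 t j)
       (dh := fun s => G (picard G y0 0 s) j - 0); [exact HK | lra | |].
    + rewrite !picard_init; ring.
    + intros s _; split.
      * apply (is_derive_minus (fun t => picard G y0 1 t j)); [apply picard_derive | exact (is_derive_const_R (y0 j) s)].
      * rewrite Rminus_0_r.
        apply Rle_trans with B; [apply Hb|]. assert (A := cosh2_ge2 K (s - 0)). nra.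
  - replace (D * (/ 2) ^ S n) with ((L * D * (/ 2) ^ n) / K) by (unfold K; simpl; field; lra).
    replace t with (t - 0) at 3 by ring.
    apply cosh2_comparison with (h := fun t => picard G y0 (S (S n)) t j - picard G y0 (S n) t j)
       (dh := fun s => G (picard G y0 (S n) s) j - G (picard G y0 n s) j); [exact HK | | |].
    + apply Rmult_le_pos; [nra | apply pow_le; lra].
    + rewrite !picard_init; ring.
    + intros s _; split.
      * apply (is_derive_minus (fun t => picard G y0 (S (S n)) t j)); apply picard_derive.
      * rewrite !Rmult_assoc; apply Hl; intros j'. rewrite <- Rmult_assoc, Rminus_0_r; apply IH.
Qed.

(** Geometric series of the steps. The difference of powers, rather than its bound (1/2)^n, is what
    makes the induction on [p] close. *)
Lemma picard_cauchy (y0 : J -> R) (n p : nat) (t : R) (j : J) :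
  Rabs (picard G y0 (n + p) t j - picard G y0 n t j)
    <= 2 * D * cosh2 K t * ((/ 2) ^ n - (/ 2) ^ (n + p)).
Proof.
  induction p as [|p IH].
  - rewrite Nat.add_0_r, !Rminus_diag_eq, Rabs_R0 by reflexivity; lra.
  - rewrite Nat.add_succ_r.
    assert (H := picard_step y0 (n + p) t j).
    assert (E := Rabs_triang (picard G y0 (S (n + p)) t j - picard G y0 (n + p) t j)
                  (picard G y0 (n + p) t j - picard G y0 n t j)).
    match type of E with Rabs ?a <= _ => replace a with
      (picard G y0 (S (n + p)) t j - picard G y0 n t j) in E by ring end.
    eapply Rle_trans; [exact E|].
    eapply Rle_trans; [apply Rplus_le_compat; [exact H | exact IH]|].
    simpl ((/ 2) ^ S (n + p)); right; field.
Qed.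

Lemma picard_lim (y0 : J -> R) (t : R) (j : J) :
  is_lim_seq (fun n => picard G y0 n t j) (flow G y0 t j).
Proof.
  unfold flow; apply Lim_seq_correct', ex_lim_seq_cauchy_corr.
  destruct HG as (HB & HL & Hb & Hl).
  assert (HK : 0 < K) by (unfold K; lra).
  assert (HD : 0 <= D) by (apply Rmult_le_pos; [lra | left; apply Rinv_0_lt_compat, HK]).
  set (C := 2 * D * cosh2 K t).
  assert (HC : 0 <= C) by (unfold C; assert (A := cosh2_ge2 K t); nra).
  assert (HB' : forall n m, (n <= m)%nat ->
    Rabs (picard G y0 m t j - picard G y0 n t j) <= C * (/ 2) ^ n).
  { intros n m Hnm. replace m with (n + (m - n))%nat by lia.
    eapply Rle_trans; [apply picard_cauchy|]. fold C.
    assert (0 <= (/ 2) ^ (n + (m - n))) by (apply pow_le; lra). nra. }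
  intros eps.
  assert (Hl0 : is_lim_seq (fun n => C * (/ 2) ^ n) 0).
  { replace 0 with (C * 0) by ring.
    apply (is_lim_seq_scal_l _ C (Finite 0)), is_lim_seq_geom. rewrite Rabs_pos_eq; lra. }
  apply is_lim_seq_spec in Hl0. destruct (Hl0 eps) as [N HN].
  exists N; intros n m Hn Hm.
  assert (HNeps : forall n, (N <= n)%nat -> C * (/ 2) ^ n < eps).
  { intros q Hq; specialize (HN q Hq); rewrite Rminus_0_r in HN. apply Rabs_lt_between in HN; lra. }
  destruct (Nat.le_ge_cases n m) as [H|H].
  - rewrite Rabs_minus_sym; eapply Rle_lt_trans; [apply HB', H | apply HNeps, Hn].
  - eapply Rle_lt_trans; [apply HB', H | apply HNeps, Hm].
Qed.

Lemma lim_seq_abs_le (u : nat -> R) (l c b : R) :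
  is_lim_seq u l -> (forall n, Rabs (u n - c) <= b) -> Rabs (l - c) <= b.
Proof.
  intros Hu Hb.
  assert (H : is_lim_seq (fun n => Rabs (u n - c)) (Rabs (l - c))).
  { apply (is_lim_seq_abs _ (Finite (l - c))), is_lim_seq_minus'; [exact Hu | apply is_lim_seq_const]. }
  apply (is_lim_seq_le _ (fun _ => b) _ (Finite b) Hb H (is_lim_seq_const b)).
Qed.

Lemma flow_picard (y0 : J -> R) (n : nat) (t : R) (j : J) :
  Rabs (flow G y0 t j - picard G y0 n t j) <= 2 * D * (/ 2) ^ n * cosh2 K t.
Proof.
  destruct HG as (HB & HL & Hb & Hl).
  assert (HK : 0 < K) by (unfold K; lra).
  assert (HD : 0 <= D) by (apply Rmult_le_pos; [lra | left; apply Rinv_0_lt_compat, HK]).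
  apply lim_seq_abs_le with (fun p => picard G y0 (n + p) t j).
  - apply (is_lim_seq_ext (fun p => picard G y0 (p + n) t j)); [intros; f_equal; lia|].
    apply (is_lim_seq_incr_n (fun p => picard G y0 p t j)), picard_lim.
  - intros p; eapply Rle_trans; [apply picard_cauchy|].
    assert (0 <= (/ 2) ^ (n + p)) by (apply pow_le; lra). assert (A := cosh2_ge2 K t).
    assert (0 <= 2 * D * cosh2 K t) by nra. nra.
Qed.

Lemma flow_init (y0 : J -> R) (j : J) : flow G y0 0 j = y0 j.
Proof.
  assert (H := picard_lim y0 0 j).
  apply (is_lim_seq_ext _ (fun _ => y0 j)) in H; [|intros; apply picard_init].
  apply is_lim_seq_unique in H; rewrite Lim_seq_const in H; injection H; auto.
Qed.

Lemma flow_lipschitz (y0 : J -> R) :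
  forall s t j, Rabs (flow G y0 s j - flow G y0 t j) <= B * Rabs (s - t).
Proof.
  intros s t j.
  replace (flow G y0 s j - flow G y0 t j) with (flow G y0 s j - flow G y0 t j - 0) by ring.
  apply lim_seq_abs_le with (fun n => picard G y0 n s j - picard G y0 n t j).
  - apply is_lim_seq_minus'; apply picard_lim.
  - intros n; rewrite Rminus_0_r; apply picard_lipschitz.
Qed.

(** The flow satisfies the integral equation: the iterates also converge to y0 plus the integral of
    the field along the flow, since one more integration halves the weighted distance, and limits
    are unique. The integral is then differentiated. *)
Lemma flow_derive (y0 : J -> R) (t : R) (j : J) :
  is_derive (fun t => flow G y0 t j) t (G (flow G y0 t) j).
Proof.
  assert (HC : forall j t, continuous (fun s => G (flow G y0 s) j) t)
    by (apply field_along_lipschitz, flow_lipschitz).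
  apply is_derive_ext with (fun t => y0 j + RInt (fun s => G (flow G y0 s) j) 0 t);
    [|apply continuous_derive_RInt, HC].
  clear t; intros t.
  destruct HG as (HB & HL & Hb & Hl).
  assert (HK : 0 < K) by (unfold K; lra).
  assert (HD : 0 <= D) by (apply Rmult_le_pos; [lra | left; apply Rinv_0_lt_compat, HK]).
  set (z := y0 j + _).
  assert (Hz : forall n, Rabs (picard G y0 (S n) t j - z) <= D * cosh2 K t * (/ 2) ^ n).
  { intros n.
    replace (D * cosh2 K t * (/ 2) ^ n) with
      ((L * (2 * D * (/ 2) ^ n)) / K * cosh2 K (t - 0))
      by (rewrite Rminus_0_r; unfold K; field; lra).
    apply cosh2_comparison with
      (h := fun t => picard G y0 (S n) t j - (y0 j + RInt (fun s => G (flow G y0 s) j) 0 t))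
      (dh := fun s => G (picard G y0 n s) j - G (flow G y0 s) j); [exact HK | | |].
    - assert (0 <= (/ 2) ^ n) by (apply pow_le; lra).
      apply Rmult_le_pos; [lra|]; apply Rmult_le_pos; lra.
    - rewrite picard_init, RInt_point; unfold zero; simpl; ring.
    - intros s _; split.
      + apply (is_derive_minus (fun t => picard G y0 (S n) t j)); [apply picard_derive|].
        apply continuous_derive_RInt, HC.
      + rewrite Rmult_assoc; apply Hl; intros j'; rewrite Rabs_minus_sym, Rminus_0_r.
        apply flow_picard. }
  assert (H0 : is_lim_seq (fun n => picard G y0 (S n) t j - z) 0).
  { apply is_lim_seq_abs_0.
    apply is_lim_seq_le_le with (fun _ => 0) (fun n => D * cosh2 K t * (/ 2) ^ n).
    - intros n; split; [apply Rabs_pos | apply Hz].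
    - apply is_lim_seq_const.
    - replace 0 with (D * cosh2 K t * 0) by ring.
      apply (is_lim_seq_scal_l _ (D * cosh2 K t) (Finite 0)), is_lim_seq_geom. rewrite Rabs_pos_eq; lra. }
  assert (H1 : is_lim_seq (fun n => picard G y0 (S n) t j - z) (flow G y0 t j - z)).
  { apply is_lim_seq_minus'; [|apply is_lim_seq_const].
    apply (is_lim_seq_incr_1 (fun n => picard G y0 n t j)), picard_lim. }
  apply is_lim_seq_unique in H0; apply is_lim_seq_unique in H1.
  rewrite H0 in H1; injection H1; lra.
Qed.

(** The bound holds for every iterate. The initial values contribute at most d, which is half of the
    bound because the weight is at least 2; the integral contributes the factor L / K = 1/2 of the
    bound for the preceding iterate. *)
Lemma flow_dependence (y0 z0 : J -> R) (d : R) :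
  (forall j, Rabs (y0 j - z0 j) <= d) ->
  forall t j, Rabs (flow G y0 t j - flow G z0 t j) <= d * cosh2 K t.
Proof.
  intros Hd t j.
  destruct HG as (HB & HL & Hb & Hl).
  assert (HK : 0 < K) by (unfold K; lra).
  assert (Hd0 : 0 <= d) by (eapply Rle_trans; [apply Rabs_pos | apply (Hd j)]).
  assert (H : forall n t j, Rabs (picard G y0 n t j - picard G z0 n t j) <= d * cosh2 K t).
  { induction n as [|n IH]; clear t j; intros t j; assert (A := cosh2_ge2 K t).
    - simpl; specialize (Hd j); nra.
    - replace (picard G y0 (S n) t j - picard G z0 (S n) t j) with
        ((y0 j - z0 j) + ((picard G y0 (S n) t j - picard G z0 (S n) t j) - (y0 j - z0 j))) by ring.
      eapply Rle_trans; [apply Rabs_triang|].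
      assert (E : Rabs ((picard G y0 (S n) t j - picard G z0 (S n) t j) - (y0 j - z0 j))
        <= (L * d) / K * cosh2 K (t - 0)).
      { apply cosh2_comparison with
          (h := fun t => (picard G y0 (S n) t j - picard G z0 (S n) t j) - (y0 j - z0 j))
          (dh := fun s => (G (picard G y0 n s) j - G (picard G z0 n s) j) - 0);
          [exact HK | nra | |].
        - rewrite !picard_init; ring.
        - intros s _; split.
          + apply (is_derive_minus (fun t => picard G y0 (S n) t j - picard G z0 (S n) t j));
              [|apply is_derive_const_R].
            apply (is_derive_minus (fun t => picard G y0 (S n) t j)); apply picard_derive.
          + rewrite Rminus_0_r, Rmult_assoc; apply Hl; intros; rewrite Rminus_0_r; apply IH. }
      replace ((L * d) / K * cosh2 K (t - 0)) with (d * cosh2 K t / 2) in E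
        by (rewrite Rminus_0_r; unfold K; field; lra).
      specialize (Hd j); nra. }
  replace (flow G y0 t j - flow G z0 t j) with (flow G y0 t j - flow G z0 t j - 0) by ring.
  apply lim_seq_abs_le with (fun n => picard G y0 n t j - picard G z0 n t j).
  - apply is_lim_seq_minus'; apply picard_lim.
  - intros n; rewrite Rminus_0_r; apply H.
Qed.

(** The difference of two solutions starts with a bound from |G| <= B (the weight being at least 2
    absorbs 2 B), and each integration halves this bound, so it is zero. *)
Lemma ode_unique (U V : R -> J -> R) (t0 t1 : R) :
  (forall s j, Rmin t0 t1 <= s <= Rmax t0 t1 ->
     is_derive (fun t => U t j) s (G (U s) j) /\ is_derive (fun t => V t j) s (G (V s) j)) ->
  (forall j, U t0 j = V t0 j) -> forall j, U t1 j = V t1 j.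
Proof.
  intros Hd H0 j.
  destruct HG as (HB & HL & Hb & Hl).
  assert (HK : 0 < K) by (unfold K; lra).
  assert (HD : 0 <= D) by (apply Rmult_le_pos; [lra | left; apply Rinv_0_lt_compat, HK]).
  assert (H : forall n s, Rmin t0 t1 <= s <= Rmax t0 t1 -> forall j,
     Rabs (U s j - V s j) <= D * (/ 2) ^ n * cosh2 K (s - t0)).
  { induction n as [|n IH]; intros t Ht j'.
    - replace (D * (/ 2) ^ 0) with (B / K) by (unfold D; simpl; ring).
      apply cosh2_comparison with (h := fun t => U t j' - V t j')
       (dh := fun s => G (U s) j' - G (V s) j'); [exact HK | lra | rewrite H0; ring |].
      intros s Hs. destruct (Hd s j') as [DU DV].
      { unfold Rmin, Rmax in *; repeat destruct Rle_dec; lra. }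
      split; [apply (is_derive_minus (fun t => U t j')); assumption|].
      assert (A := cosh2_ge2 K (s - t0)).
      assert (A1 := Hb (U s) j'); assert (A2 := Hb (V s) j').
      apply Rabs_le_between in A1; apply Rabs_le_between in A2.
      apply Rabs_le; nra.
    - replace (D * (/ 2) ^ S n) with ((L * D * (/ 2) ^ n) / K) by (unfold K; simpl; field; lra).
      apply cosh2_comparison with (h := fun t => U t j' - V t j')
       (dh := fun s => G (U s) j' - G (V s) j'); [exact HK | | rewrite H0; ring |].
      + apply Rmult_le_pos; [nra | apply pow_le; lra].
      + intros s Hs.
        assert (Hs' : Rmin t0 t1 <= s <= Rmax t0 t1)
          by (unfold Rmin, Rmax in *; repeat destruct Rle_dec; lra).
        destruct (Hd s j' Hs') as [DU DV].
        split; [apply (is_derive_minus (fun t => U t j')); assumption|].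
        rewrite !Rmult_assoc; apply Hl; intros j2; rewrite <- Rmult_assoc; apply IH, Hs'. }
  assert (Hlim : is_lim_seq (fun n => D * (/ 2) ^ n * cosh2 K (t1 - t0)) 0).
  { apply (is_lim_seq_ext (fun n => D * cosh2 K (t1 - t0) * (/ 2) ^ n)); [intros; ring|].
    replace 0 with (D * cosh2 K (t1 - t0) * 0) by ring.
    apply (is_lim_seq_scal_l _ (D * cosh2 K (t1 - t0)) (Finite 0)), is_lim_seq_geom.
    rewrite Rabs_pos_eq; lra. }
  assert (Hle : Rabs (U t1 j - V t1 j) <= 0).
  { apply (is_lim_seq_le (fun _ => Rabs (U t1 j - V t1 j)) _ (Finite _) (Finite 0)) with (2 := is_lim_seq_const _) (3 := Hlim).
    intros n; apply H. unfold Rmin, Rmax; destruct Rle_dec; lra. }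
  assert (A := Rabs_pos (U t1 j - V t1 j)).
  apply Rminus_diag_uniq. apply Rabs_eq_0; lra.
Qed.
End Picard.

(** * The soliton equations as an ODE with parameters *)

Definition nx (i : idx) : idx := match i with i1 => i2 | i2 => i3 | i3 => i1 end.

(** The equation for f_i' after elimination of u. The first quotient is the static equation; the
    last term is u a / 2, with u replaced by its expression in k and f. *)
Definition rhs (a b c ka kb kc : R) : R :=
  (b ^ 2 + c ^ 2 - a ^ 2) / (2 * b * c) + ka / (2 * a)
  - a / 6 * (ka / a ^ 2 + kb / b ^ 2 + kc / c ^ 2).

Definition vf (f k : idx -> R) (i : idx) : R :=
  rhs (f i) (f (nx i)) (f (nx (nx i))) (k i) (k (nx i)) (k (nx (nx i))).

Definition sol (I : R -> Prop) (k : idx -> R) (f : idx -> R -> R) : Prop :=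
  forall t, I t -> forall i, 0 < f i t /\ is_derive (f i) t (vf (fun j => f j t) k i).

Definition drift (k : idx -> R) (f : idx -> R -> R) (t : R) : R :=
  - sum3 (fun j => k j / f j t ^ 2) / 3.

Lemma is_derive_sqr (h : R -> R) (t d : R) :
  is_derive h t d -> is_derive (fun s => h s ^ 2) t (2 * h t * d).
Proof.
  intros H; apply is_derive_val with (INR 2 * d * h t ^ 1); [apply is_derive_pow, H|].
  simpl; ring.
Qed.

Lemma is_derive_mult_R (g h : R -> R) (t dg dh : R) :
  is_derive g t dg -> is_derive h t dh ->
  is_derive (fun s => g s * h s) t (dg * h t + g t * dh).
Proof.
  intros Hg Hh; apply (is_derive_mult (K := R_AbsRing) g h t dg dh Hg Hh). intros; apply Rmult_comm.
Qed.

Lemma is_derive_prod3 (f : idx -> R -> R) (t : R) (d : idx -> R) :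
  (forall i, is_derive (f i) t (d i)) ->
  is_derive (fun s => prod3 (fun i => f i s)) t
    (d i1 * f i2 t * f i3 t + f i1 t * d i2 * f i3 t + f i1 t * f i2 t * d i3).
Proof.
  intros H; unfold prod3.
  eapply is_derive_val;
    [apply is_derive_mult_R; [apply is_derive_mult_R|]; apply H | cbv beta; ring].
Qed.

Lemma Derive_prod3 (f : idx -> R -> R) (t : R) (d : idx -> R) :
  (forall i, is_derive (f i) t (d i)) ->
  Derive (fun s : R => prod3 (fun i => f i s)) t =
    d i1 * f i2 t * f i3 t + f i1 t * d i2 * f i3 t + f i1 t * f i2 t * d i3.
Proof. intros H; apply is_derive_unique, is_derive_prod3, H. Qed.

Lemma torsion_of_derive (f : idx -> R -> R) (t d : R) (i : idx) :
  is_derive (f i) t d ->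
  torsion f i t = 2 * f i t * d + f i t ^ 2 / prod3 (fun j => f j t)
    * (2 * f i t ^ 2 - sum3 (fun j => f j t ^ 2)).
Proof.
  intros H; unfold torsion; f_equal. apply is_derive_unique, is_derive_sqr, H.
Qed.

Lemma locally_ray (a t : R) : a < t -> locally t (ray a).
Proof. intros H; exact (open_gt a t H). Qed.

Lemma ray_constant (a : R) (h : R -> R) :
  (forall t, a < t -> is_derive h t 0) -> forall s t, a < s -> a < t -> h s = h t.
Proof.
  intros H s t Hs Ht.
  destruct (MVT_gen h s t (fun _ => 0)) as [c [_ E]].
  - intros x Hx; apply H. unfold Rmin, Rmax in *; destruct Rle_dec; lra.
  - intros x Hx; apply continuity_pt_filterlim, (is_derive_continuous _ _ 0), H.
    unfold Rmin, Rmax in *; destruct Rle_dec; lra.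
  - lra.
Qed.

(** Once tau_i = u f_i^2 + k_i is known, the trace equation says exactly that the k_i sum to zero,
    and the closedness equation, with the f_i' substituted, determines u. *)
Lemma sol_of_soliton (a : R) (f : idx -> R -> R) (u : R -> R) :
  steady_soliton (ray a) f u ->
  exists k : idx -> R, sum3 k = 0 /\ sol (ray a) k f /\
    forall t, a < t -> u t = drift k f t /\ forall i, torsion f i t = u t * f i t ^ 2 + k i.
Proof.
  intros [Hpos Hdiff Hcl Hcon Htr].
  set (k := fun i => torsion f i (a + 1) - u (a + 1) * f i (a + 1) ^ 2).
  assert (Hk : forall i t, a < t -> torsion f i t = u t * f i t ^ 2 + k i).
  { intros i t Ht.
    assert (E := ray_constant a _ (Hcon i) t (a + 1) Ht ltac:(lra)). cbv beta in E. unfold k; lra. }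
  assert (Hk0 : sum3 k = 0).
  { assert (H1 : a < a + 1) by lra.
    assert (E := Htr _ H1). unfold sum3 in *. rewrite !Hk in E by exact H1. lra. }
  assert (Hu : forall t, a < t -> u t = drift k f t /\
    forall i, Derive (f i) t = vf (fun j => f j t) k i).
  { intros t Ht.
    assert (HD : forall i, is_derive (f i) t (Derive (f i) t))
      by (intros; apply Derive_correct, Hdiff, Ht).
    assert (E0 := Hcl t Ht).
    rewrite (Derive_prod3 f t _ HD) in E0.
    assert (E := fun i => Hk i t Ht).
    assert (T := fun i => torsion_of_derive f t _ i (HD i)).
    assert (E' : forall i, Derive (f i) t = (u t * f i t ^ 2 + k i - f i t ^ 2 / prod3 (fun j => f j t)
      * (2 * f i t ^ 2 - sum3 (fun j => f j t ^ 2))) / (2 * f i t)).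
    { intros i; specialize (E i); specialize (T i); rewrite E in T.
      assert (P := Hpos i t Ht). rewrite T. field.
      assert (P1 := Hpos i1 t Ht); assert (P2 := Hpos i2 t Ht); assert (P3 := Hpos i3 t Ht).
      unfold prod3; repeat split; try lra. apply Rgt_not_eq; repeat apply Rmult_lt_0_compat; assumption. }
    assert (P1 := Hpos i1 t Ht); assert (P2 := Hpos i2 t Ht); assert (P3 := Hpos i3 t Ht).
    assert (U : u t = drift k f t).
    { rewrite !E' in E0. unfold drift, sum3, prod3 in *.
      set (x := f i1 t) in *; set (y := f i2 t) in *; set (z := f i3 t) in *.
      apply (Rmult_eq_reg_l (3 * (x * y * z))); [|apply Rgt_not_eq; repeat apply Rmult_lt_0_compat; lra].
      match type of E0 with ?l = ?r => assert (E1 : 3 * (x * y * z) * u t =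
        l - r - x * y * z * (k i1 / x ^ 2 + k i2 / y ^ 2 + k i3 / z ^ 2)) by (field; lra) end.
      rewrite E1, E0. field; lra. }
    split; [exact U|].
    intros i; rewrite E', U. unfold drift, vf, rhs, sum3, prod3.
    destruct i; simpl nx; field; lra. }
  exists k; split; [exact Hk0 | split].
  - intros t Ht i; split; [apply Hpos, Ht|].
    apply is_derive_val with (Derive (f i) t); [apply Derive_correct, Hdiff, Ht | apply (Hu t Ht)].
  - intros t Ht; split; [apply (Hu t Ht) | intros i; apply Hk, Ht].
Qed.

Lemma sol_torsion (I : R -> Prop) (k : idx -> R) (f : idx -> R -> R) (t : R) :
  sol I k f -> I t -> forall i, torsion f i t = drift k f t * f i t ^ 2 + k i.
Proof.
  intros H Ht i.
  rewrite (torsion_of_derive f t _ i (proj2 (H t Ht i))).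
  destruct (H t Ht i1) as [P1 _], (H t Ht i2) as [P2 _], (H t Ht i3) as [P3 _].
  unfold drift, vf, rhs, sum3, prod3. destruct i; simpl nx; field; lra.
Qed.

Lemma soliton_of_sol (a : R) (k : idx -> R) (f : idx -> R -> R) :
  sum3 k = 0 -> sol (ray a) k f -> steady_soliton (ray a) f (drift k f).
Proof.
  intros Hk H; split.
  - intros i t Ht; apply H, Ht.
  - intros i t Ht; eexists; apply H, Ht.
  - intros t Ht.
    rewrite (Derive_prod3 f t _ (fun i => proj2 (H t Ht i))).
    destruct (H t Ht i1) as [P1 _], (H t Ht i2) as [P2 _], (H t Ht i3) as [P3 _].
    unfold vf, rhs, sum3; simpl nx; field; lra.
  - intros i t Ht. apply is_derive_ext_loc with (fun _ => k i); [|apply is_derive_const_R].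
    apply (filter_imp (ray a)); [|apply locally_ray, Ht].
    assert (A : forall s, ray a s -> k i = torsion f i s - drift k f s * f i s ^ 2)
      by (intros s Hs; rewrite (sol_torsion _ k f s H Hs); ring).
    exact A.
  - intros t Ht. assert (T := sol_torsion _ k f t H Ht).
    unfold sum3 in *; rewrite !T. lra.
Qed.

Lemma sol_shift (a s : R) (k : idx -> R) (f : idx -> R -> R) :
  sol (ray a) k f -> sol (ray (a - s)) k (fun i t => f i (t + s)).
Proof.
  intros H t Ht i. unfold ray in *.
  destruct (H (t + s) ltac:(unfold ray; lra) i) as [P D]; split; [exact P|].
  apply is_derive_val with (1 * vf (fun j => f j (t + s)) k i); [|ring].
  apply (is_derive_comp (f i) (fun t => t + s)); [exact D|].
  auto_derive; [exact I | ring].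
Qed.

Lemma sol_scale (a mu s : R) (k : idx -> R) (f : idx -> R -> R) : 0 < mu ->
  sol (ray a) k f ->
  sol (ray ((a - s) / mu)) (fun i => k i / mu) (fun i t => f i (mu * t + s) / mu).
Proof.
  intros Hmu H t Ht i. unfold ray in *.
  assert (Ht' : a < mu * t + s).
  { apply (Rmult_lt_compat_l mu) in Ht; [|exact Hmu].
    replace (mu * ((a - s) / mu)) with (a - s) in Ht by (field; lra). lra. }
  destruct (H _ Ht' i1) as [P1 _], (H _ Ht' i2) as [P2 _], (H _ Ht' i3) as [P3 _].
  destruct (H (mu * t + s) Ht' i) as [P D]; split; [apply Rdiv_lt_0_compat; assumption|].
  apply is_derive_val with (/ mu * (mu * vf (fun j => f j (mu * t + s)) k i)).
  - apply (is_derive_ext (fun t => / mu * f i (mu * t + s))); [intros; apply Rmult_comm|].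
    apply is_derive_scal.
    apply (is_derive_comp (f i) (fun t => mu * t + s)); [exact D|].
    auto_derive; [exact I | ring].
  - unfold vf, rhs; destruct i; simpl nx; field; lra.
Qed.

(** * Truncation to a bounded Lipschitz field *)

(** Boundedness is recorded along with the Lipschitz estimate because the product of two Lipschitz
    functions is Lipschitz only when both are bounded; the class is then an algebra containing all
    building blocks of the truncated field. *)
Definition blip {J : Type} (P : (J -> R) -> R) : Prop :=
  exists B L, 0 <= B /\ 0 <= L /\ (forall y, Rabs (P y) <= B) /\
    forall y z d, (forall j, Rabs (y j - z j) <= d) -> Rabs (P y - P z) <= L * d.

Lemma blip_const {J : Type} (c : R) : blip (fun _ : J -> R => c).
Proof.
  exists (Rabs c), 0; repeat split; try lra; [apply Rabs_pos | intros; lra |].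
  intros; rewrite Rminus_diag_eq, Rabs_R0 by reflexivity; lra.
Qed.

Lemma blip_plus {J : Type} (P Q : (J -> R) -> R) :
  blip P -> blip Q -> blip (fun y => P y + Q y).
Proof.
  intros (B1 & L1 & HB1 & HL1 & H1 & H1') (B2 & L2 & HB2 & HL2 & H2 & H2').
  exists (B1 + B2), (L1 + L2); repeat split; try lra.
  - intros y; eapply Rle_trans; [apply Rabs_triang|]. specialize (H1 y); specialize (H2 y); lra.
  - intros y z d Hd.
    replace (P y + Q y - (P z + Q z)) with ((P y - P z) + (Q y - Q z)) by ring.
    eapply Rle_trans; [apply Rabs_triang|].
    specialize (H1' y z d Hd); specialize (H2' y z d Hd); lra.
Qed.

Lemma blip_mult {J : Type} (P Q : (J -> R) -> R) :
  blip P -> blip Q -> blip (fun y => P y * Q y).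
Proof.
  intros (B1 & L1 & HB1 & HL1 & H1 & H1') (B2 & L2 & HB2 & HL2 & H2 & H2').
  exists (B1 * B2), (B1 * L2 + L1 * B2); repeat split; try nra.
  - intros y; rewrite Rabs_mult; apply Rmult_le_compat; try apply Rabs_pos; auto.
  - intros y z d Hd.
    replace (P y * Q y - P z * Q z) with (P y * (Q y - Q z) + (P y - P z) * Q z) by ring.
    eapply Rle_trans; [apply Rabs_triang|]. rewrite !Rabs_mult.
    replace ((B1 * L2 + L1 * B2) * d) with (B1 * (L2 * d) + (L1 * d) * B2) by ring.
    apply Rplus_le_compat; apply Rmult_le_compat; try apply Rabs_pos; auto.
Qed.

Lemma Rmax_lip (a b x y d : R) :
  Rabs (a - b) <= d -> Rabs (x - y) <= d -> Rabs (Rmax a x - Rmax b y) <= d.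
Proof.
  intros H1 H2; apply Rabs_le_between in H1; apply Rabs_le_between in H2.
  apply Rabs_le; unfold Rmax; repeat destruct Rle_dec; lra.
Qed.

Lemma Rmin_lip (a b x y d : R) :
  Rabs (a - b) <= d -> Rabs (x - y) <= d -> Rabs (Rmin a x - Rmin b y) <= d.
Proof.
  intros H1 H2; apply Rabs_le_between in H1; apply Rabs_le_between in H2.
  apply Rabs_le; unfold Rmin; repeat destruct Rle_dec; lra.
Qed.

Definition floor_at (N w : R) : R := Rmax w (/ N).

(** For N >= 1 this is v over the floored w, clamped to [1/N, N]. The numerator is clamped to
    multiples of the floored denominator, which bounds the quotient and makes it Lipschitz although
    neither v nor w is bounded above. *)
Definition trunc_ratio (N v w : R) : R :=
  Rmax (floor_at N w / N) (Rmin (N * floor_at N w) v) / floor_at N w.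

Definition trunc_abs (N v : R) : R := Rmax (- N) (Rmin N v).

Lemma floor_at_ge (N w : R) : / N <= floor_at N w.
Proof. apply Rmax_r. Qed.

Lemma blip_inv {J : Type} (N : R) (j : J) : 1 <= N -> blip (fun y : J -> R => / floor_at N (y j)).
Proof.
  intros HN; exists N, (N * N).
  assert (Hi : 0 < / N) by (apply Rinv_0_lt_compat; lra).
  assert (HB : forall w, 0 < / floor_at N w <= N).
  { intros w; assert (A := floor_at_ge N w). split; [apply Rinv_0_lt_compat; lra|].
    apply Rle_trans with (/ / N); [apply Rinv_le_contravar; assumption | rewrite Rinv_inv; lra]. }
  repeat split; try nra.
  - intros y; rewrite Rabs_pos_eq; apply Rlt_le in Hi; destruct (HB (y j)); lra.
  - intros y z d Hd.
    assert (A := floor_at_ge N (y j)); assert (A' := floor_at_ge N (z j)).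
    assert (E : Rabs (floor_at N (z j) - floor_at N (y j)) <= d).
    { apply Rmax_lip; [rewrite Rabs_minus_sym; apply Hd|].
      rewrite Rminus_diag_eq, Rabs_R0 by reflexivity.
      eapply Rle_trans; [apply Rabs_pos | apply (Hd j)]. }
    replace (/ floor_at N (y j) - / floor_at N (z j)) with
      (/ floor_at N (y j) * / floor_at N (z j) * (floor_at N (z j) - floor_at N (y j)))
      by (field; lra).
    destruct (HB (y j)), (HB (z j)).
    rewrite !Rabs_mult, !(Rabs_pos_eq (/ _)) by lra.
    apply Rmult_le_compat; try assumption; [|apply Rabs_pos|].
    + apply Rmult_le_pos; lra.
    + apply Rmult_le_compat; lra.
Qed.

Lemma blip_ratio {J : Type} (N : R) (i j : J) : 1 <= N ->
  blip (fun y : J -> R => trunc_ratio N (y i) (y j)).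
Proof.
  intros HN; exists N, (2 * N * N).
  assert (Hi : 0 < / N) by (apply Rinv_0_lt_compat; lra).
  assert (Hi1 : / N <= 1) by (rewrite <- Rinv_1; apply Rinv_le_contravar; lra).
  set (q := fun (y : J -> R) => Rmax (floor_at N (y j) / N) (Rmin (N * floor_at N (y j)) (y i))).
  assert (HB : forall y, 0 <= q y <= N * floor_at N (y j)).
  { intros y; assert (A := floor_at_ge N (y j)). unfold q.
    assert (0 < floor_at N (y j) / N) by (apply Rdiv_lt_0_compat; lra).
    assert (floor_at N (y j) / N <= N * floor_at N (y j)) by (unfold Rdiv; nra).
    split.
    - apply Rle_trans with (floor_at N (y j) / N); [lra | apply Rmax_l].
    - apply Rmax_lub; [assumption | apply Rmin_l]. }
  assert (HR : forall y, 0 <= q y / floor_at N (y j) <= N).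
  { intros y; assert (A := floor_at_ge N (y j)). destruct (HB y).
    split; [apply Rmult_le_pos; [lra | left; apply Rinv_0_lt_compat; lra]|].
    apply Rle_div_l; lra. }
  repeat split; try nra.
  - intros y; unfold trunc_ratio; fold (q y). rewrite Rabs_pos_eq; apply HR.
  - intros y z d Hd. unfold trunc_ratio; fold (q y) (q z).
    assert (Hd0 : 0 <= d) by (eapply Rle_trans; [apply Rabs_pos | apply (Hd j)]).
    assert (A := floor_at_ge N (y j)); assert (A' := floor_at_ge N (z j)).
    assert (E : Rabs (floor_at N (y j) - floor_at N (z j)) <= d).
    { apply Rmax_lip; [apply Hd|].
      rewrite Rminus_diag_eq, Rabs_R0 by reflexivity. exact Hd0. }
    assert (EQ : Rabs (q y - q z) <= N * d).
    { unfold q; apply Rmax_lip; [|apply Rmin_lip].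
      - replace (floor_at N (y j) / N - floor_at N (z j) / N) with
          (/ N * (floor_at N (y j) - floor_at N (z j))) by (unfold Rdiv; ring).
        rewrite Rabs_mult, (Rabs_pos_eq (/ N)) by lra.
        apply Rmult_le_compat; try apply Rabs_pos; lra.
      - rewrite <- Rmult_minus_distr_l, Rabs_mult, (Rabs_pos_eq N) by lra.
        apply Rmult_le_compat_l; lra.
      - specialize (Hd i); nra. }
    replace (q y / floor_at N (y j) - q z / floor_at N (z j)) with
      (/ floor_at N (y j) * ((q y - q z) - (q z / floor_at N (z j)) * (floor_at N (y j) - floor_at N (z j))))
      by (field; lra).
    assert (HI : 0 < / floor_at N (y j) <= N).
    { split; [apply Rinv_0_lt_compat; lra|].
      apply Rle_trans with (/ / N); [apply Rinv_le_contravar; assumption | rewrite Rinv_inv; lra]. }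
    rewrite Rabs_mult, (Rabs_pos_eq (/ _)) by lra.
    replace (2 * N * N * d) with (N * (N * d + N * d)) by ring.
    apply Rmult_le_compat; [lra | apply Rabs_pos | lra|].
    eapply Rle_trans; [apply Rabs_triang|]. apply Rplus_le_compat; [exact EQ|].
    rewrite Rabs_Ropp, Rabs_mult, (Rabs_pos_eq (q z / _)) by apply HR.
    apply Rmult_le_compat; try apply HR; [apply Rabs_pos | exact E].
Qed.

Lemma blip_abs {J : Type} (N : R) (j : J) : 1 <= N -> blip (fun y : J -> R => trunc_abs N (y j)).
Proof.
  intros HN; exists N, 1; repeat split; try lra.
  - intros y; unfold trunc_abs; apply Rabs_le; unfold Rmax, Rmin; repeat destruct Rle_dec; lra.
  - intros y z d Hd; rewrite Rmult_1_l.
    assert (Hd0 : 0 <= d) by (eapply Rle_trans; [apply Rabs_pos | apply (Hd j)]).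
    apply Rmax_lip; [|apply Rmin_lip; [|apply Hd]];
      rewrite Rminus_diag_eq, Rabs_R0 by reflexivity; exact Hd0.
Qed.

(* [vf] with the ratios f_i/f_j cut off to [1/N, N], the f_i in the remaining
   denominators to [1/N, oo) and the k_i to [-N, N]; the k_i are carried along as
   constant components, so that dependence on them is dependence on initial data. *)
Definition trunc_field (N : R) (y : idx + idx -> R) (j : idx + idx) : R :=
  match j with
  | inl i =>
    let a := y (inl i) in let b := y (inl (nx i)) in let c := y (inl (nx (nx i))) in
    let q j := trunc_abs N (y (inr j)) * / floor_at N (y (inl j)) in
    / 2 * (trunc_ratio N b c + trunc_ratio N c b
           + -1 * (trunc_ratio N a b * trunc_ratio N a c))
    + / 3 * q i
    + (- / 6) * (q (nx i) * trunc_ratio N a b + q (nx (nx i)) * trunc_ratio N a c)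
  | inr _ => 0
  end.

Lemma trunc_field_blip (N : R) (j : idx + idx) : 1 <= N -> blip (fun y => trunc_field N y j).
Proof.
  intros HN; destruct j as [i|i]; [|exact (blip_const 0)].
  unfold trunc_field; cbv zeta.
  repeat first [ apply (blip_plus (J := idx + idx)) | apply (blip_const (J := idx + idx))
               | apply (blip_ratio (J := idx + idx)); exact HN
               | apply (blip_inv (J := idx + idx)); exact HN
               | apply (blip_abs (J := idx + idx)); exact HN
               | apply (blip_mult (J := idx + idx)) ].
Qed.

Lemma trunc_field_lipschitz (N : R) : 1 <= N ->
  exists B L, bounded_lipschitz B L (trunc_field N).
Proof.
  intros HN.
  destruct (trunc_field_blip N (inl i1) HN) as (B1 & L1 & HB1 & HL1 & H1 & H1').
  destruct (trunc_field_blip N (inl i2) HN) as (B2 & L2 & HB2 & HL2 & H2 & H2').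
  destruct (trunc_field_blip N (inl i3) HN) as (B3 & L3 & HB3 & HL3 & H3 & H3').
  exists (B1 + B2 + B3), (1 + L1 + L2 + L3). repeat split; try lra.
  - intros y [[]|i]; [specialize (H1 y) | specialize (H2 y) | specialize (H3 y) |]; try lra.
    simpl; rewrite Rabs_R0; lra.
  - intros y z d Hd j.
    assert (Hd0 : 0 <= d) by (eapply Rle_trans; [apply Rabs_pos | apply (Hd j)]).
    assert (0 <= L1 * d /\ 0 <= L2 * d /\ 0 <= L3 * d) by (repeat split; apply Rmult_le_pos; assumption).
    specialize (H1' y z d Hd); specialize (H2' y z d Hd); specialize (H3' y z d Hd).
    destruct j as [[]|i]; try lra.
    simpl; rewrite Rminus_diag_eq, Rabs_R0 by reflexivity; lra.
Qed.

Definition join (f k : idx -> R) (j : idx + idx) : R :=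
  match j with inl i => f i | inr i => k i end.

Definition in_range (N : R) (f k : idx -> R) : Prop :=
  forall i, / N <= f i /\ Rabs (k i) <= N /\ forall j, f i <= N * f j.

Lemma trunc_field_eq (N : R) (f k : idx -> R) (i : idx) :
  1 <= N -> in_range N f k -> trunc_field N (join f k) (inl i) = vf f k i.
Proof.
  intros HN H.
  assert (Hi : 0 < / N) by (apply Rinv_0_lt_compat; lra).
  assert (HP : forall i, 0 < f i) by (intros j; destruct (H j); lra).
  assert (HF : forall j, floor_at N (f j) = f j) by (intros j; apply Rmax_left, H).
  assert (HA : forall j, trunc_abs N (k j) = k j).
  { intros j; destruct (H j) as (_ & A & _); apply Rabs_le_between in A.
    unfold trunc_abs; rewrite Rmin_right, Rmax_right; lra. }
  assert (HR : forall j l, trunc_ratio N (f j) (f l) = f j / f l).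
  { intros j l; unfold trunc_ratio; rewrite !HF; f_equal.
    assert (f j <= N * f l) by apply H. assert (f l <= N * f j) by apply H.
    assert (f l / N <= f j) by (apply Rle_div_l; lra).
    rewrite Rmin_right, Rmax_right; lra. }
  unfold trunc_field, join, vf, rhs. rewrite !HF, !HA, !HR.
  assert (P1 := HP i); assert (P2 := HP (nx i)); assert (P3 := HP (nx (nx i))).
  field; lra.
Qed.

Definition tflow (N : R) (k f0 : idx -> R) (i : idx) (t : R) : R :=
  flow (trunc_field N) (join f0 k) t (inl i).

Lemma tflow_init (N : R) (k f0 : idx -> R) (i : idx) : 1 <= N -> tflow N k f0 i 0 = f0 i.
Proof.
  intros HN; destruct (trunc_field_lipschitz N HN) as (B & L & HG).
  apply (flow_init HG (join f0 k) (inl i)).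
Qed.

Lemma flow_join (N : R) (k f0 : idx -> R) (t : R) : 1 <= N ->
  flow (trunc_field N) (join f0 k) t = join (fun i => tflow N k f0 i t) k.
Proof.
  intros HN; destruct (trunc_field_lipschitz N HN) as (B & L & HG).
  apply functional_extensionality; intros [i|i]; [reflexivity|]. simpl.
  rewrite <- (flow_init HG (join f0 k) (inr i) : _ = k i).
  apply (ray_constant (Rmin t 0 - 1) (fun t => flow (trunc_field N) (join f0 k) t (inr i))).
  - intros s _; apply (flow_derive HG (join f0 k) s (inr i)).
  - assert (A := Rmin_l t 0); lra.
  - assert (A := Rmin_r t 0); lra.
Qed.

Lemma tflow_trunc_derive (N : R) (k f0 : idx -> R) (i : idx) (t : R) : 1 <= N ->
  is_derive (tflow N k f0 i) t (trunc_field N (join (fun j => tflow N k f0 j t) k) (inl i)).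
Proof.
  intros HN; rewrite <- flow_join by exact HN.
  destruct (trunc_field_lipschitz N HN) as (B & L & HG).
  apply (flow_derive HG).
Qed.

Lemma tflow_continuous (N : R) (k f0 : idx -> R) (i : idx) (t : R) : 1 <= N ->
  continuous (tflow N k f0 i) t.
Proof. intros HN; eapply is_derive_continuous, tflow_trunc_derive, HN. Qed.

Lemma tflow_derive (N : R) (k f0 : idx -> R) (i : idx) (t : R) : 1 <= N ->
  in_range N (fun j => tflow N k f0 j t) k ->
  is_derive (tflow N k f0 i) t (vf (fun j => tflow N k f0 j t) k i).
Proof.
  intros HN H; rewrite <- (trunc_field_eq N) by assumption. apply tflow_trunc_derive, HN.
Qed.

Lemma tflow_dependence (N : R) : 1 <= N -> exists K, forall k k' f0 f0' d,
  (forall i, Rabs (f0 i - f0' i) <= d) -> (forall i, Rabs (k i - k' i) <= d) ->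
  forall t i, Rabs (tflow N k f0 i t - tflow N k' f0' i t) <= d * cosh2 K t.
Proof.
  intros HN; destruct (trunc_field_lipschitz N HN) as (B & L & HG).
  exists (2 * L); intros k k' f0 f0' d Hf Hk t i.
  apply (flow_dependence HG). intros [j|j]; simpl; auto.
Qed.

Lemma vf_unique (N : R) (k : idx -> R) (f g : idx -> R -> R) (t0 t1 : R) : 1 <= N ->
  (forall s i, Rmin t0 t1 <= s <= Rmax t0 t1 ->
     is_derive (f i) s (trunc_field N (join (fun j => f j s) k) (inl i)) /\
     is_derive (g i) s (trunc_field N (join (fun j => g j s) k) (inl i))) ->
  (forall i, f i t0 = g i t0) -> forall i, f i t1 = g i t1.
Proof.
  intros HN H H0 i; destruct (trunc_field_lipschitz N HN) as (B & L & HG).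
  apply (ode_unique HG (fun t => join (fun j => f j t) k) (fun t => join (fun j => g j t) k) t0 t1)
    with (j := inl i).
  - intros s [j|j] Hs; simpl join; [apply H, Hs|].
    split; apply is_derive_const_R.
  - intros [j|j]; simpl; auto.
Qed.

Lemma sol_bounds (a t0 t1 : R) (k : idx -> R) (f : idx -> R -> R) :
  a < t0 -> t0 <= t1 -> sol (ray a) k f ->
  exists m M, 0 < m /\ forall i s, t0 <= s <= t1 -> m <= f i s <= M.
Proof.
  intros Ha H01 H.
  assert (HC : forall i c, t0 <= c <= t1 -> continuity_pt (f i) c).
  { intros i c Hc; apply continuity_pt_filterlim.
    assert (Hac : a < c) by lra. apply (is_derive_continuous _ _ _ (proj2 (H c Hac i))). }
  assert (HB : forall i, exists m M, 0 < m /\ forall s, t0 <= s <= t1 -> m <= f i s <= M).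
  { intros i; destruct (continuity_ab_min (f i) t0 t1 H01 (HC i)) as [x [Hx Hx']].
    destruct (continuity_ab_maj (f i) t0 t1 H01 (HC i)) as [y [Hy Hy']].
    exists (f i x), (f i y); split.
    - assert (Hax : a < x) by lra. apply (H x Hax i).
    - intros s Hs; split; [apply Hx, Hs | apply Hy, Hs]. }
  destruct (HB i1) as (m1 & M1 & Hm1 & H1), (HB i2) as (m2 & M2 & Hm2 & H2), (HB i3) as (m3 & M3 & Hm3 & H3).
  exists (Rmin m1 (Rmin m2 m3)), (Rmax M1 (Rmax M2 M3)); split.
  - repeat apply Rmin_glb_lt; assumption.
  - assert (A1 := Rmin_l m1 (Rmin m2 m3)); assert (A2 := Rmin_r m1 (Rmin m2 m3)).
    assert (A3 := Rmin_l m2 m3); assert (A4 := Rmin_r m2 m3).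
    assert (B1 := Rmax_l M1 (Rmax M2 M3)); assert (B2 := Rmax_r M1 (Rmax M2 M3)).
    assert (B3 := Rmax_l M2 M3); assert (B4 := Rmax_r M2 M3).
    intros [] s Hs; [specialize (H1 s Hs) | specialize (H2 s Hs) | specialize (H3 s Hs)]; lra.
Qed.

Lemma idx_bound (k : idx -> R) (i : idx) : Rabs (k i) <= Rabs (k i1) + Rabs (k i2) + Rabs (k i3).
Proof.
  assert (H1 := Rabs_pos (k i1)); assert (H2 := Rabs_pos (k i2)); assert (H3 := Rabs_pos (k i3)).
  destruct i; lra.
Qed.

(* The bounds hold with a factor of 2 to spare, so they survive small perturbations. *)
Lemma sol_in_range (a t0 t1 : R) (k : idx -> R) (f : idx -> R -> R) :
  a < t0 -> t0 <= t1 -> sol (ray a) k f ->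
  exists N, 2 <= N /\ forall N', N <= N' -> forall i s, t0 <= s <= t1 ->
    2 / N' <= f i s /\ Rabs (k i) <= N' / 2 /\ forall j, f i s <= N' / 2 * f j s.
Proof.
  intros Ha H01 H.
  destruct (sol_bounds a t0 t1 k f Ha H01 H) as (m & M & Hm & HB).
  assert (HmM : m <= M) by (specialize (HB i1 t0); lra).
  (* One summand for each requirement: the lower bound on f, the ratios of f, and the size of k. *)
  set (N := 2 + 2 / m + 2 * M / m + 2 * (Rabs (k i1) + Rabs (k i2) + Rabs (k i3))).
  assert (Hm' : 0 < / m) by (apply Rinv_0_lt_compat, Hm).
  assert (0 <= 2 / m) by (unfold Rdiv; lra).
  assert (0 <= 2 * M / m) by (apply Rmult_le_pos; lra).
  assert (A1 := Rabs_pos (k i1)); assert (A2 := Rabs_pos (k i2)); assert (A3 := Rabs_pos (k i3)).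
  exists N; split; [unfold N; lra|].
  intros N' HN' i s Hs.
  assert (HN : 2 <= N') by (unfold N in HN'; lra).
  repeat split.
  - apply Rle_trans with m; [|apply HB, Hs]. apply Rle_div_l; [lra|].
    assert (E : 2 / m <= N') by (unfold N in HN'; lra). apply Rle_div_l in E; lra.
  - assert (A := idx_bound k i). unfold N in HN'; lra.
  - intros j. apply Rle_trans with M; [apply HB, Hs|].
    apply Rle_trans with (N' / 2 * m).
    + assert (E : 2 * M / m <= N') by (unfold N in HN'; lra). apply Rle_div_l in E; lra.
    + apply Rmult_le_compat_l; [lra | apply HB, Hs].
Qed.

Lemma in_range_of_margin (N : R) (f k : idx -> R) : 2 <= N ->
  (forall i, 2 / N <= f i /\ Rabs (k i) <= N / 2 /\ forall j, f i <= N / 2 * f j) -> in_range N f k.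
Proof.
  intros HN H i; destruct (H i) as (H1 & H2 & H3).
  assert (0 < / N) by (apply Rinv_0_lt_compat; lra).
  repeat split; [unfold Rdiv in H1; lra | lra |].
  - intros j. specialize (H3 j). destruct (H j) as (P & _).
    assert (0 < f j) by (unfold Rdiv in P; lra).
    assert (0 < N * f j) by (apply Rmult_lt_0_compat; lra). lra.
Qed.

(** On a compact interval both solutions stay in the range of a common N, where the truncated field
    is the true one and the uniqueness for Lipschitz fields applies. The direction is backwards:
    ends that agree late are compared at an earlier time. *)
Lemma sol_unique (a t0 t1 : R) (k : idx -> R) (f g : idx -> R -> R) :
  a < t0 -> t0 <= t1 -> sol (ray a) k f -> sol (ray a) k g ->
  (forall i, f i t1 = g i t1) -> forall i, f i t0 = g i t0.
Proof.
  intros Ha H01 Hf Hg H1.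
  destruct (sol_in_range a t0 t1 k f Ha H01 Hf) as (N1 & HN1 & R1).
  destruct (sol_in_range a t0 t1 k g Ha H01 Hg) as (N2 & HN2 & R2).
  set (N := Rmax N1 N2).
  assert (A1 := Rmax_l N1 N2); assert (A2 := Rmax_r N1 N2).
  apply (vf_unique N k f g t1 t0); [unfold N; lra | | exact H1].
  intros s i Hs; rewrite Rmin_right, Rmax_left in Hs by lra.
  assert (Has : a < s) by lra.
  rewrite !trunc_field_eq; [split; [apply Hf | apply Hg]; exact Has | unfold N; lra | |unfold N; lra|].
  - apply in_range_of_margin; [unfold N; lra|]. intros j; apply (R2 N A2 j s Hs).
  - apply in_range_of_margin; [unfold N; lra|]. intros j; apply (R1 N A1 j s Hs).
Qed.

Lemma sol_eq_tflow (N a t0 t1 : R) (k : idx -> R) (f : idx -> R -> R) :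
  1 <= N -> a < t0 -> t0 <= t1 -> sol (ray a) k f ->
  (forall s, t0 <= s <= t1 -> in_range N (fun j => f j s) k) ->
  forall i, f i t1 = tflow N k (fun j => f j t0) i (t1 - t0).
Proof.
  intros HN Ha H01 Hf HR.
  apply (vf_unique N k f (fun i t => tflow N k (fun j => f j t0) i (t - t0)) t0 t1); [exact HN | |].
  - intros s i Hs; rewrite Rmin_left, Rmax_right in Hs by lra.
    assert (Has : a < s) by lra. split.
    + rewrite trunc_field_eq by auto. apply Hf, Has.
    + eapply is_derive_val.
      * apply (is_derive_comp (tflow N k (fun j => f j t0) i) (fun t => t - t0)).
        -- apply tflow_trunc_derive, HN.
        -- apply (is_derive_minus (fun t => t) (fun _ => t0)); [apply is_derive_id | apply is_derive_const_R].
      * unfold scal, minus, plus, opp, one; simpl. unfold mult; simpl. ring.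
  - intros i; rewrite Rminus_diag_eq by reflexivity. symmetry; apply tflow_init, HN.
Qed.

(** * The decreasing quantity and the trapping region *)

Definition evt (P : R -> Prop) : Prop := Rbar_locally p_infty P.

Lemma evt_and (P Q : R -> Prop) : evt P -> evt Q -> evt (fun t => P t /\ Q t).
Proof. exact (@filter_and R (Rbar_locally p_infty) _ P Q). Qed.

Lemma evt_imp (P Q : R -> Prop) : (forall t, P t -> Q t) -> evt P -> evt Q.
Proof. exact (@filter_imp R (Rbar_locally p_infty) _ P Q). Qed.

Lemma evt_gt (a : R) : evt (fun t => a < t).
Proof. exists a; auto. Qed.

Lemma filter_idx {T : Type} {F : (T -> Prop) -> Prop} {FF : Filter F} (P : idx -> T -> Prop) :
  (forall i, F (P i)) -> F (fun t => forall i, P i t).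
Proof.
  intros H.
  apply filter_imp with (fun t => P i1 t /\ P i2 t /\ P i3 t).
  - intros t (H1 & H2 & H3) []; assumption.
  - repeat apply filter_and; apply H.
Qed.

(** Integrating |h' - l g'| <= (eps/2) g' from a fixed time leaves a constant C, which is absorbed
    as soon as g exceeds 2 C / eps. *)
Lemma lhopital_infty (h dh g dg : R -> R) (l : R) :
  evt (fun t => is_derive h t (dh t) /\ is_derive g t (dg t) /\ 0 < dg t) ->
  is_lim g p_infty p_infty ->
  is_lim (fun t => dh t / dg t) p_infty l ->
  is_lim (fun t => h t / g t) p_infty l.
Proof.
  intros Hd Hg Hl. apply is_lim_spec; intros eps.
  apply is_lim_spec in Hl. assert (He : 0 < eps / 2) by (assert (A := cond_pos eps); lra).
  specialize (Hl (mkposreal _ He)). simpl in Hl.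
  destruct (evt_and _ _ Hd Hl) as [T HT].
  set (T1 := T + 1). set (C := Rabs (h T1 - l * g T1) + eps / 2 * Rabs (g T1)).
  assert (HC : 0 <= C).
  { unfold C. assert (A := Rabs_pos (h T1 - l * g T1)); assert (B := Rabs_pos (g T1)). nra. }
  assert (HB : forall t, T1 <= t -> Rabs (h t - l * g t) <= C + eps / 2 * g t).
  { intros t Ht.
    assert (HD : forall s, T1 <= s <= t -> is_derive h s (dh s) /\ is_derive g s (dg s) /\
       Rabs (dh s - l * dg s) <= eps / 2 * dg s).
    { intros s Hs; destruct (HT s) as [(D1 & D2 & P) B]; [unfold T1 in Hs; lra|].
      split; [exact D1 | split; [exact D2|]].
      replace (dh s - l * dg s) with ((dh s / dg s - l) * dg s) by (field; lra).
      rewrite Rabs_mult, (Rabs_pos_eq (dg s)) by lra. apply Rmult_le_compat_r; lra. }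
    assert (A1 := derive_nonneg_le (fun s => eps / 2 * g s - (h s - l * g s))
      (fun s => eps / 2 * dg s - (dh s - l * dg s)) T1 t Ht).
    assert (A2 := derive_nonneg_le (fun s => eps / 2 * g s + (h s - l * g s))
      (fun s => eps / 2 * dg s + (dh s - l * dg s)) T1 t Ht).
    assert (E1 : eps / 2 * g T1 - (h T1 - l * g T1) <= eps / 2 * g t - (h t - l * g t)).
    { apply A1; intros s Hs; destruct (HD s Hs) as (D1 & D2 & B).
      - apply (is_derive_minus (fun s => eps / 2 * g s) (fun s => h s - l * g s));
          [apply is_derive_scal, D2 | apply (is_derive_minus h (fun s => l * g s)); [exact D1 | apply is_derive_scal, D2]].
      - apply Rabs_le_between in B; lra. }
    assert (E2 : eps / 2 * g T1 + (h T1 - l * g T1) <= eps / 2 * g t + (h t - l * g t)).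
    { apply A2; intros s Hs; destruct (HD s Hs) as (D1 & D2 & B).
      - apply (is_derive_plus (fun s => eps / 2 * g s) (fun s => h s - l * g s));
          [apply is_derive_scal, D2 | apply (is_derive_minus h (fun s => l * g s)); [exact D1 | apply is_derive_scal, D2]].
      - apply Rabs_le_between in B; lra. }
    assert (F1 := Rabs_maj2 (h T1 - l * g T1)); assert (F2 := Rle_abs (h T1 - l * g T1)).
    assert (F3 : eps / 2 * - g T1 <= eps / 2 * Rabs (g T1))
      by (apply Rmult_le_compat_l; [lra | apply Rabs_maj2]).
    unfold C; apply Rabs_le; lra. }
  apply is_lim_spec in Hg. specialize (Hg (Rmax 0 (2 * C / eps))).
  apply (evt_imp _ _) with (2 := evt_and _ _ (evt_gt T1) Hg).
  intros t [Ht Hgt].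
  assert (G0 : 0 < g t) by (eapply Rle_lt_trans; [apply Rmax_l | exact Hgt]).
  assert (G1 : 2 * C / eps < g t) by (eapply Rle_lt_trans; [apply Rmax_r | exact Hgt]).
  apply Rlt_div_l in G1; [|apply cond_pos].
  replace (h t / g t - l) with ((h t - l * g t) / g t) by (field; lra).
  unfold Rdiv; rewrite Rabs_mult, (Rabs_pos_eq (/ g t)) by (left; apply Rinv_0_lt_compat, G0).
  apply Rlt_div_l; [exact G0|].
  assert (A := HB t ltac:(lra)). lra.
Qed.

Lemma derive_lim_ratio (h dh : R -> R) (l : R) :
  evt (fun t => is_derive h t (dh t)) -> is_lim dh p_infty l ->
  is_lim (fun t => h t / t) p_infty l.
Proof.
  intros Hd Hl.
  apply (lhopital_infty h dh (fun t => t) (fun _ => 1)).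
  - apply (evt_imp _ _) with (2 := Hd); intros t H.
    split; [exact H | split; [exact (is_derive_id (K := R_AbsRing) t) | lra]].
  - apply is_lim_id.
  - apply (is_lim_ext dh); [intros; unfold Rdiv; rewrite Rinv_1, Rmult_1_r; reflexivity | exact Hl].
Qed.

(* [psi l a b c = A_a - l^2 A_b] with [A_a = b^2 c^2]; its sign compares [b] with [l a]. *)
Definition psi (l a b c : R) : R := c ^ 2 * (b ^ 2 - l ^ 2 * a ^ 2).

(** The derivative of [psi] along the flow. The first term is the damping, absent for l = 1. The
    rest is linear in k and is written as b c times functions of ratios, so that bounds on the
    ratios bound everything but the factor b c. *)
Definition dpsi (l a b c ka kb kc : R) : R :=
  - 2 * (l ^ 2 - 1) * (a * b * c)
  - b * c * ((b / a) * (c / a) *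
      (- / 3 * ((ka + kb * (a / b) ^ 2 + kc * (a / c) ^ 2) * (1 - l ^ 2 * (a / b) ^ 2))
       + ka - l ^ 2 * ((a / b) ^ 2 * (a / b) ^ 2) * kb)).

Lemma psi_derive (l ka kb kc t : R) (a b c : R -> R) :
  0 < a t -> 0 < b t -> 0 < c t ->
  is_derive a t (rhs (a t) (b t) (c t) ka kb kc) ->
  is_derive b t (rhs (b t) (c t) (a t) kb kc ka) ->
  is_derive c t (rhs (c t) (a t) (b t) kc ka kb) ->
  is_derive (fun s => psi l (a s) (b s) (c s)) t (dpsi l (a t) (b t) (c t) ka kb kc).
Proof.
  intros Pa Pb Pc Ha Hb Hc. unfold psi.
  eapply is_derive_val.
  - apply is_derive_mult_R; [apply is_derive_sqr, Hc|].
    apply (is_derive_minus (fun s => b s ^ 2) (fun s => l ^ 2 * a s ^ 2)); [apply is_derive_sqr, Hb|].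
    apply is_derive_scal, is_derive_sqr, Ha.
  - unfold minus, plus, opp, dpsi, rhs; simpl. field; lra.
Qed.

Lemma rhs_swap (a b c ka kb kc : R) : rhs a b c ka kb kc = rhs a c b ka kc kb.
Proof. unfold rhs. replace (2 * c * b) with (2 * b * c) by ring. unfold Rdiv; ring. Qed.

Lemma Rabs_mult_le (x y X Y : R) : Rabs x <= X -> Rabs y <= Y -> Rabs (x * y) <= X * Y.
Proof. intros; rewrite Rabs_mult; apply Rmult_le_compat; try apply Rabs_pos; assumption. Qed.

Lemma Rabs_plus_le (x y X Y : R) : Rabs x <= X -> Rabs y <= Y -> Rabs (x + y) <= X + Y.
Proof. intros; eapply Rle_trans; [apply Rabs_triang | lra]. Qed.

Lemma ratio_bounds (a b : R) : 0 < a -> 0 < b -> a <= 11 / 10 * b -> 0 < a / b <= 11 / 10.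
Proof. intros Pa Pb H; split; [apply Rdiv_lt_0_compat; assumption | apply Rle_div_l; lra]. Qed.

(** With the ratios at most 11/10, the factor of k in brackets is at most 3.31 K: the sum of (1/3)
    3.42 0.465 K, of K, and of 1.21^3 K. The prefactor (b/a)(c/a) is at most 1.21, and 5 K rounds up
    the product. *)
Lemma dpsi_le (l a b c ka kb kc K : R) :
  0 < a -> 0 < b -> 0 < c -> 1 <= l <= 11 / 10 ->
  a <= 11 / 10 * b -> b <= 11 / 10 * a -> a <= 11 / 10 * c -> c <= 11 / 10 * a ->
  Rabs ka <= K -> Rabs kb <= K -> Rabs kc <= K ->
  dpsi l a b c ka kb kc <= b * c * (5 * K - 2 * (l ^ 2 - 1) * a).
Proof.
  intros Pa Pb Pc Hl Hab Hba Hac Hca Ha Hb Hc.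
  assert (HK : 0 <= K) by (eapply Rle_trans; [apply Rabs_pos | exact Ha]).
  assert (R1 := ratio_bounds _ _ Pa Pb Hab); assert (R2 := ratio_bounds _ _ Pb Pa Hba).
  assert (R3 := ratio_bounds _ _ Pa Pc Hac); assert (R4 := ratio_bounds _ _ Pc Pa Hca).
  assert (R5 : a / b * (b / a) = 1) by (field; lra).
  unfold dpsi.
  set (p := (a / b) ^ 2). set (q := (a / c) ^ 2).
  assert (Hp : 8 / 10 <= p <= 121 / 100) by (unfold p; nra).
  assert (Hq : 0 <= q <= 121 / 100) by (unfold q; nra).
  assert (Hm : 1 <= l ^ 2 <= 121 / 100) by nra.
  set (E := _ + ka - _).
  assert (HE : Rabs E <= 331 / 100 * K).
  { assert (Bp : Rabs p <= 121 / 100) by (apply Rabs_le; lra).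
    assert (Bq : Rabs q <= 121 / 100) by (apply Rabs_le; lra).
    assert (Bm : Rabs (l ^ 2) <= 121 / 100) by (apply Rabs_le; lra).
    assert (B1 : Rabs (1 - l ^ 2 * p) <= 465 / 1000) by (apply Rabs_le; nra).
    assert (B3 : Rabs (- / 3) <= / 3) by (apply Rabs_le; lra).
    assert (B2 := Rabs_plus_le _ _ _ _ (Rabs_plus_le _ _ _ _ Ha (Rabs_mult_le _ _ _ _ Hb Bp))
                     (Rabs_mult_le _ _ _ _ Hc Bq)).
    assert (B4 := Rabs_mult_le _ _ _ _ B3 (Rabs_mult_le _ _ _ _ B2 B1)).
    assert (B5 := Rabs_mult_le _ _ _ _ (Rabs_mult_le _ _ _ _ Bm (Rabs_mult_le _ _ _ _ Bp Bp)) Hb).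
    rewrite <- Rabs_Ropp in B5.
    assert (B6 := Rabs_plus_le _ _ _ _ (Rabs_plus_le _ _ _ _ B4 Ha) B5).
    eapply Rle_trans; [exact B6 | lra]. }
  assert (Br : Rabs (b / a * (c / a)) <= 121 / 100) by (apply Rabs_le; nra).
  assert (BE := Rabs_mult_le _ _ _ _ Br HE).
  apply Rabs_le_between in BE.
  assert (0 < b * c) by (apply Rmult_lt_0_compat; assumption).
  replace (- 2 * (l ^ 2 - 1) * (a * b * c)) with (b * c * (- 2 * (l ^ 2 - 1) * a)) by ring.
  rewrite <- Rmult_minus_distr_l. apply Rmult_le_compat_l; lra.
Qed.

(** The static part is 1 + (b - c)^2 / (2 b c) - a^2 / (2 b c), at least 1 - 121/200, and the terms
    with k cost at most 2/100; this leaves more than 1/4. *)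
Lemma rhs_ge (a b c ka kb kc K : R) :
  0 < a -> 0 < b -> 0 < c ->
  a <= 11 / 10 * b -> a <= 11 / 10 * c ->
  Rabs ka <= K -> Rabs kb <= K -> Rabs kc <= K -> 100 * K <= a ->
  1 / 4 <= rhs a b c ka kb kc.
Proof.
  intros Pa Pb Pc Hab Hac Ha Hb Hc HK.
  assert (HK0 : 0 <= K) by (eapply Rle_trans; [apply Rabs_pos | exact Ha]).
  assert (R1 := ratio_bounds _ _ Pa Pb Hab); assert (R3 := ratio_bounds _ _ Pa Pc Hac).
  replace (rhs a b c ka kb kc) with (1 + (b - c) ^ 2 / (2 * b * c) - / 2 * (a / b * (a / c))
    + / a * (ka * / 2 + (- / 6) * (ka + kb * (a / b) ^ 2 + kc * (a / c) ^ 2)))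
    by (unfold rhs; field; lra).
  assert (0 <= (b - c) ^ 2 / (2 * b * c)).
  { apply Rmult_le_pos; [apply pow2_ge_0 | left; apply Rinv_0_lt_compat].
    repeat apply Rmult_lt_0_compat; lra. }
  assert (a / b * (a / c) <= 121 / 100) by nra.
  assert (Bp : Rabs ((a / b) ^ 2) <= 121 / 100) by (apply Rabs_le; nra).
  assert (Bq : Rabs ((a / c) ^ 2) <= 121 / 100) by (apply Rabs_le; nra).
  assert (B3 : Rabs (- / 6) <= / 6) by (apply Rabs_le; lra).
  assert (B4 : Rabs (/ 2) <= / 2) by (apply Rabs_le; lra).
  assert (B2 := Rabs_plus_le _ _ _ _ (Rabs_plus_le _ _ _ _ Ha (Rabs_mult_le _ _ _ _ Hb Bp))
                     (Rabs_mult_le _ _ _ _ Hc Bq)).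
  assert (B5 := Rabs_plus_le _ _ _ _ (Rabs_mult_le _ _ _ _ Ha B4) (Rabs_mult_le _ _ _ _ B3 B2)).
  set (E := ka * / 2 + _) in *.
  assert (BE : Rabs E <= 2 * K) by lra.
  apply Rabs_le_between in BE.
  assert (Hia : 0 < / a) by (apply Rinv_0_lt_compat, Pa).
  assert (- (2 / 100) <= / a * E).
  { apply Rle_trans with (/ a * - (2 / 100 * a)); [right; field; lra|].
    apply Rmult_le_compat_l; lra. }
  lra.
Qed.

(** The closed counterpart of [trap]. A limit of trapped states satisfies only weak inequalities,
    but these already suffice for the bounds on the derivatives, which in turn restore
    strictness. *)
Definition wtrap (f k : idx -> R) : Prop :=
  forall i, 0 < f i /\ (forall j, f j <= 11 / 10 * f i) /\ (forall j, 100 * Rabs (k j) <= f i).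

Definition trap (f k : idx -> R) : Prop :=
  forall i, 0 < f i /\ (forall j, f j < 11 / 10 * f i) /\ (forall j, 100 * Rabs (k j) < f i).

(** The last case covers the pair [i2], [i3] in both orders; on the diagonal its value is a mere
    default. *)
Definition third (i j : idx) : idx :=
  match i, j with
  | i1, i2 | i2, i1 => i3
  | i1, i3 | i3, i1 => i2
  | _, _ => i1
  end.

Lemma vf_ge (f k : idx -> R) (i : idx) : wtrap f k -> 1 / 4 <= vf f k i.
Proof.
  intros H. set (K := Rmax (Rabs (k i1)) (Rmax (Rabs (k i2)) (Rabs (k i3)))).
  assert (HK : forall j, Rabs (k j) <= K).
  { assert (A1 := Rmax_l (Rabs (k i1)) (Rmax (Rabs (k i2)) (Rabs (k i3)))).
    assert (A2 := Rmax_r (Rabs (k i1)) (Rmax (Rabs (k i2)) (Rabs (k i3)))).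
    assert (A3 := Rmax_l (Rabs (k i2)) (Rabs (k i3))).
    assert (A4 := Rmax_r (Rabs (k i2)) (Rabs (k i3))).
    intros []; unfold K; lra. }
  assert (HK' : 100 * K <= f i).
  { destruct (H i) as (_ & _ & A). unfold K, Rmax; repeat destruct Rle_dec; apply A. }
  apply (rhs_ge _ _ _ _ _ _ K); try apply H; try apply HK. exact HK'.
Qed.

Lemma psi_derive_idx (l t : R) (k : idx -> R) (f : idx -> R -> R) (i j : idx) : i <> j ->
  (forall i, 0 < f i t /\ is_derive (f i) t (vf (fun j => f j t) k i)) ->
  is_derive (fun s => psi l (f i s) (f j s) (f (third i j) s)) t
    (dpsi l (f i t) (f j t) (f (third i j) t) (k i) (k j) (k (third i j))).
Proof.
  intros Hij H.
  assert (H1 := H i1); assert (H2 := H i2); assert (H3 := H i3).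
  unfold vf in H1, H2, H3; simpl nx in *.
  destruct i, j; try congruence; simpl third; apply psi_derive; try tauto;
    rewrite rhs_swap; tauto.
Qed.

Lemma dpsi_le_idx (l K : R) (f k : idx -> R) (i j : idx) : wtrap f k -> 1 <= l <= 11 / 10 ->
  (forall i, Rabs (k i) <= K) ->
  dpsi l (f i) (f j) (f (third i j)) (k i) (k j) (k (third i j))
    <= f j * f (third i j) * (5 * K - 2 * (l ^ 2 - 1) * f i).
Proof. intros H Hl HK; apply dpsi_le; try apply H; try apply HK; assumption. Qed.

Lemma psi_neg (l a b c : R) : 0 < a -> 0 < b -> 0 < c -> 0 < l ->
  psi l a b c < 0 <-> b < l * a.
Proof.
  intros Pa Pb Pc Pl; unfold psi.
  replace (b ^ 2 - l ^ 2 * a ^ 2) with ((b - l * a) * (b + l * a)) by ring.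
  assert (0 < c ^ 2) by (apply pow_lt, Pc).
  assert (0 < b + l * a) by (assert (0 < l * a) by (apply Rmult_lt_0_compat; assumption); lra).
  assert (0 < c ^ 2 * (b + l * a)) by (apply Rmult_lt_0_compat; assumption).
  replace (c ^ 2 * ((b - l * a) * (b + l * a))) with (c ^ 2 * (b + l * a) * (b - l * a)) by ring.
  split; intros; nra.
Qed.

(** Take the supremum m of the points up to which [P] holds: closedness gives [P m], and openness
    goes past m. This serves forward invariance, where the equation at a time is known to be the
    true one only after all earlier times have been trapped. *)
Lemma real_induction (P : R -> Prop) (T : R) :
  P T ->
  (forall t, T <= t -> P t -> locally t P) ->
  (forall t, T < t -> (forall s, T <= s < t -> P s) -> P t) ->
  forall t, T <= t -> P t.
Proof.
  intros H0 Hopen Hclosed t Ht.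
  destruct (classic (P t)) as [Y|Nt]; [exact Y | exfalso].
  set (E := fun x => T <= x <= t /\ forall s, T <= s <= x -> P s).
  destruct (completeness E) as [m [Hub Hlub]].
  - exists t; intros x [Hx _]; lra.
  - exists T; split; [lra|]. intros s Hs; replace s with T by lra; exact H0.
  - assert (HTm : T <= m) by (apply Hub; split; [lra|]; intros s Hs; replace s with T by lra; exact H0).
    assert (Hmt : m <= t) by (apply Hlub; intros x [Hx _]; lra).
    assert (Hbelow : forall s, T <= s < m -> P s).
    { intros s Hs. destruct (classic (exists x, E x /\ s < x)) as [[x [[_ Hx] Hsx]]|Hn].
      - apply Hx; lra.
      - exfalso. assert (m <= s); [|lra]. apply Hlub; intros x Hx.
        destruct (Rle_lt_dec x s) as [L|L]; [exact L|]. exfalso; apply Hn; exists x; auto. }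
    assert (Hm : P m).
    { destruct (Req_dec m T) as [->|Hne]; [exact H0|]. apply Hclosed; [lra | exact Hbelow]. }
    destruct (Hopen m HTm Hm) as [e He].
    assert (Hmt' : m < t) by (destruct (Req_dec m t) as [E'|]; [subst; contradiction | lra]).
    set (x := Rmin t (m + e / 2)).
    assert (Hx1 : x <= t) by apply Rmin_l.
    assert (Hx2 : x <= m + e / 2) by apply Rmin_r.
    assert (He0 := cond_pos e).
    assert (Hx3 : m < x) by (apply Rmin_glb_lt; lra).
    assert (x <= m); [|lra]. apply Hub; split; [lra|].
    intros s Hs. destruct (Rlt_le_dec s m) as [L|L]; [apply Hbelow; lra|].
    apply He. apply Rabs_lt_between'; lra.
Qed.

Lemma continuous_pos_locally (g : R -> R) (t : R) :
  continuous g t -> 0 < g t -> locally t (fun s => 0 < g s).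
Proof. intros Hc Hp; apply (Hc (fun y => 0 < y)), (open_gt 0), Hp. Qed.

Lemma continuous_nonneg_left (g : R -> R) (T t : R) : T < t ->
  continuous g t -> (forall s, T <= s < t -> 0 < g s) -> 0 <= g t.
Proof.
  intros HT Hc Hp. apply Rnot_lt_le; intros Hn.
  destruct (continuous_pos_locally (fun s => - g s) t) as [e He].
  - apply (continuous_opp g), Hc.
  - lra.
  - assert (He0 := cond_pos e).
    set (s := Rmax T (t - e / 2)).
    assert (A1 : T <= s) by apply Rmax_l. assert (A2 : t - e / 2 <= s) by apply Rmax_r.
    assert (A3 : s < t) by (apply Rmax_lub_lt; lra).
    assert (B := He s). specialize (Hp s ltac:(lra)).
    assert (Bs : 0 < - g s) by (apply B, Rabs_lt_between'; lra). lra.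
Qed.

Lemma continuous_lincomb (g h : R -> R) (c d t : R) :
  continuous g t -> continuous h t -> continuous (fun s => c * g s + d * h s) t.
Proof.
  intros Hg Hh; apply (continuous_plus (fun s => c * g s) (fun s => d * h s)).
  - apply (continuous_mult (K := R_AbsRing) (fun _ => c) g); [apply continuous_const | exact Hg].
  - apply (continuous_mult (K := R_AbsRing) (fun _ => d) h); [apply continuous_const | exact Hh].
Qed.

Lemma trap_open (f : idx -> R -> R) (k : idx -> R) (t : R) :
  (forall i, continuous (f i) t) -> trap (fun i => f i t) k ->
  locally t (fun s => trap (fun i => f i s) k).
Proof.
  intros Hc H. unfold trap in *.
  apply (filter_idx (fun i s => 0 < f i s /\ (forall j, f j s < 11 / 10 * f i s) /\
    (forall j, 100 * Rabs (k j) < f i s))).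
  intros i; destruct (H i) as (H1 & H2 & H3).
  repeat apply filter_and.
  - apply continuous_pos_locally; auto.
  - apply (filter_idx (fun j s => f j s < 11 / 10 * f i s)); intros j.
    apply filter_imp with (fun s => 0 < 11 / 10 * f i s + -1 * f j s); [intros; lra|].
    apply (continuous_pos_locally (fun s => 11 / 10 * f i s + -1 * f j s)).
    + apply continuous_lincomb; auto.
    + specialize (H2 j); lra.
  - apply (filter_idx (fun j s => 100 * Rabs (k j) < f i s)); intros j.
    apply (Hc i (fun y => 100 * Rabs (k j) < y)), (open_gt (100 * Rabs (k j))), H3.
Qed.

Lemma trap_closed (f : idx -> R -> R) (k : idx -> R) (T t : R) : T < t ->
  (forall i, continuous (f i) t) -> (forall i, 0 < f i T) ->
  (forall i, f i T <= f i t) ->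
  (forall s, T <= s < t -> trap (fun i => f i s) k) -> wtrap (fun i => f i t) k.
Proof.
  intros HT Hc H0 Hmon H i.
  split; [specialize (H0 i); specialize (Hmon i); lra|]. split; intros j.
  - assert (0 <= 11 / 10 * f i t + -1 * f j t); [|lra].
    apply (continuous_nonneg_left (fun s => 11 / 10 * f i s + -1 * f j s) T); [exact HT | |].
    + apply continuous_lincomb; apply Hc.
    + intros s Hs; destruct (H s Hs i) as (_ & A & _). specialize (A j); lra.
  - destruct (H T ltac:(lra) i) as (_ & _ & A). specialize (A j); specialize (Hmon i); lra.
Qed.

Lemma trap_wtrap (f k : idx -> R) : trap f k -> wtrap f k.
Proof. intros H i; destruct (H i) as (A & B & C). repeat split; [exact A | |]; intros j; apply Rlt_le; auto. Qed.

(** Here l^2 - 1 >= 1/10, so the damping is at least f_i / 5, while K = f_i / 100 makes the other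
    term f_i / 20. The upper end l = 11/10 is the face of the trapping region, the lower end l =
    21/20 the slice carrying the family of ends. *)
Lemma wtrap_psi_neg (l : R) (f k : idx -> R) (i j : idx) : wtrap f k -> 21 / 20 <= l <= 11 / 10 ->
  dpsi l (f i) (f j) (f (third i j)) (k i) (k j) (k (third i j)) < 0.
Proof.
  intros H Hl.
  eapply Rle_lt_trans.
  - apply dpsi_le_idx with (K := f i / 100); [exact H | lra|].
    intros m; destruct (H i) as (_ & _ & A); specialize (A m); lra.
  - destruct (H i) as (P & _ & _), (H j) as (P1 & _ & _), (H (third i j)) as (P2 & _ & _).
    assert (0 < f j * f (third i j)) by (apply Rmult_lt_0_compat; assumption).
    assert (Hl2 : 11 / 10 <= l ^ 2) by nra.
    assert (Hs : 1 / 10 * f i <= (l ^ 2 - 1) * f i) by (apply Rmult_le_compat_r; lra).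
    assert (5 * (f i / 100) - 2 * (l ^ 2 - 1) * f i < 0) by lra. nra.
Qed.

Lemma idx_eq_dec (i j : idx) : {i = j} + {i <> j}.
Proof. decide equality. Qed.

(** No face of the region is reached: f_j = (11/10) f_i would mean [psi (11/10)] = 0, but this
    function starts negative and decreases; the inequalities with k persist because every f_i
    increases. *)
Lemma wtrap_trap (f : idx -> R -> R) (k : idx -> R) (T t : R) : T <= t ->
  (forall s, T <= s <= t -> wtrap (fun i => f i s) k /\
     forall i, is_derive (f i) s (vf (fun j => f j s) k i)) ->
  trap (fun i => f i T) k -> trap (fun i => f i t) k.
Proof.
  intros HT H H0.
  destruct (Rle_lt_or_eq_dec _ _ HT) as [HT'|<-]; [|exact H0].
  assert (Hmon : forall i, f i T <= f i t).
  { intros i; apply (derive_nonneg_le (f i) (fun s => vf (fun j => f j s) k i)); [exact HT | |].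
    - intros s Hs; apply (H s Hs).
    - intros s Hs; assert (A := vf_ge _ _ i (proj1 (H s Hs))). lra. }
  assert (HPt : forall i, 0 < f i t) by (intros i; apply (H t ltac:(lra))).
  assert (HPT : forall i, 0 < f i T) by (intros i; apply H0).
  intros i; split; [apply HPt | split].
  - intros j. destruct (idx_eq_dec i j) as [<-|Hij]; [specialize (HPt i); lra|].
    apply (psi_neg (11 / 10) (f i t) (f j t) (f (third i j) t)); try apply HPt; [lra|].
    apply Rlt_trans with (psi (11 / 10) (f i T) (f j T) (f (third i j) T)).
    + apply (derive_neg_lt (fun s => psi (11 / 10) (f i s) (f j s) (f (third i j) s))
        (fun s => dpsi (11 / 10) (f i s) (f j s) (f (third i j) s) (k i) (k j) (k (third i j)))); [exact HT' | |].
      * intros s Hs. apply psi_derive_idx; [exact Hij|].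
        intros m; split; [apply (H s Hs) | apply (H s Hs)].
      * intros s Hs. apply (wtrap_psi_neg (11 / 10) (fun i => f i s)); [apply (H s Hs) | lra].
    + apply psi_neg; try apply HPT; [lra|]. apply H0.
  - intros j. apply Rlt_le_trans with (f i T); [apply H0 | apply Hmon].
Qed.

Lemma wtrap_in_range (N : R) (f k : idx -> R) : 2 <= N ->
  (forall i, Rabs (k i) <= N) -> (forall i, / N <= f i) -> wtrap f k -> in_range N f k.
Proof.
  intros HN Hk Hf H i; repeat split; auto.
  intros j. destruct (H j) as (P & A & _). specialize (A i). nra.
Qed.

(** The condition / N < f is carried along in the induction: together with the trapping inequalities
    it keeps the cutoffs inactive, so that the truncated flow obeys the true equations and the
    estimates apply. *)
Lemma trap_forward (N T : R) (k f0 : idx -> R) : 2 <= N -> (forall i, Rabs (k i) <= N) ->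
  trap (fun i => tflow N k f0 i T) k -> (forall i, / N < tflow N k f0 i T) ->
  forall t, T <= t -> trap (fun i => tflow N k f0 i t) k /\ forall i, / N < tflow N k f0 i t.
Proof.
  intros HN Hk HT HT'. assert (HN1 : 1 <= N) by lra.
  apply real_induction; [split; assumption | |].
  - intros t Ht [H1 H2]. apply filter_and.
    + apply trap_open; [intros; apply tflow_continuous, HN1 | exact H1].
    + apply (filter_idx (fun i s => / N < tflow N k f0 i s)). intros i.
      apply (tflow_continuous N k f0 i t HN1 (fun y => / N < y)), (open_gt (/ N)), H2.
  - intros t Ht H.
    assert (HR : forall s, T <= s < t -> in_range N (fun i => tflow N k f0 i s) k).
    { intros s Hs; destruct (H s Hs) as [A B].
      apply wtrap_in_range; [exact HN | exact Hk | intros; left; apply B | apply trap_wtrap, A]. }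
    (* The true equation is available only before t, so a drop at t itself is excluded by
       continuity, moving to a slightly earlier s. *)
    assert (Hmon : forall i, tflow N k f0 i T <= tflow N k f0 i t).
    { intros i. apply Rnot_lt_le; intros Hlt.
      destruct (tflow_continuous N k f0 i t HN1 (fun y => y < tflow N k f0 i T)) as [e He].
      { apply (open_lt (tflow N k f0 i T)), Hlt. }
      assert (He0 := cond_pos e). set (s := Rmax T (t - e / 2)).
      assert (A1 : T <= s) by apply Rmax_l. assert (A2 : t - e / 2 <= s) by apply Rmax_r.
      assert (A3 : s < t) by (apply Rmax_lub_lt; lra).
      assert (B : tflow N k f0 i s < tflow N k f0 i T) by (apply He, Rabs_lt_between'; lra).
      assert (B' : tflow N k f0 i T <= tflow N k f0 i s); [|lra].
      apply (derive_nonneg_le _ (fun s => vf (fun j => tflow N k f0 j s) k i)); [exact A1 | |].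
      - intros x Hx; apply tflow_derive; [exact HN1 | apply HR; lra].
      - intros x Hx; assert (V := vf_ge _ _ i (trap_wtrap _ _ (proj1 (H x ltac:(lra))))). lra. }
    assert (HW : wtrap (fun i => tflow N k f0 i t) k).
    { apply trap_closed with (T := T) (f := tflow N k f0); try assumption.
      - intros; apply tflow_continuous, HN1.
      - intros i; apply HT.
      - intros s Hs; apply (H s Hs). }
    assert (HF : forall i, / N < tflow N k f0 i t) by (intros i; eapply Rlt_le_trans; [apply HT' | apply Hmon]).
    split; [|exact HF].
    apply (wtrap_trap (tflow N k f0) k T t); [lra | | exact HT].
    intros s Hs.
    destruct (Req_dec s t) as [->|Hne].
    + split; [exact HW|]. intros i; apply tflow_derive; [exact HN1|].
      apply wtrap_in_range; [exact HN | exact Hk | intros; left; apply HF | exact HW].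
    + assert (Hs' : T <= s < t) by lra.
      split; [apply trap_wtrap, (H s Hs')|]. intros i; apply tflow_derive; [exact HN1 | apply HR, Hs'].
Qed.

Lemma is_lim_sum (g h : R -> R) (l m : R) :
  is_lim g p_infty l -> is_lim h p_infty m -> is_lim (fun t => g t + h t) p_infty (l + m).
Proof. apply is_lim_plus'. Qed.

Lemma is_lim_prod (g h : R -> R) (l m : R) :
  is_lim g p_infty l -> is_lim h p_infty m -> is_lim (fun t => g t * h t) p_infty (l * m).
Proof. intros Hg Hh; apply (is_lim_mult g h p_infty l m Hg Hh I). Qed.

Lemma is_lim_cst (c : R) : is_lim (fun _ => c) p_infty c.
Proof. apply is_lim_const. Qed.

Lemma is_lim_val (g : R -> R) (l m : R) : is_lim g p_infty l -> l = m -> is_lim g p_infty m.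
Proof. intros H <-; exact H. Qed.

Lemma is_lim_inv_infty (g : R -> R) : is_lim g p_infty p_infty -> is_lim (fun t => / g t) p_infty 0.
Proof. intros H; apply (is_lim_inv g p_infty p_infty H); discriminate. Qed.

(** All terms with k carry a factor 1 / f and disappear; what remains is the static field evaluated
    on the limiting ratios. *)
Lemma vf_lim (k : idx -> R) (f : idx -> R -> R) (r : idx -> idx -> R) (i : idx) :
  evt (fun t => forall i, 0 < f i t) ->
  (forall i, is_lim (fun t => / f i t) p_infty 0) ->
  (forall i j, is_lim (fun t => f i t / f j t) p_infty (r i j)) ->
  is_lim (fun t => vf (fun j => f j t) k i) p_infty
    (/ 2 * (r (nx i) (nx (nx i)) + r (nx (nx i)) (nx i) + -1 * (r i (nx i) * r i (nx (nx i))))).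
Proof.
  intros Hp Hi Hr.
  set (b := nx i). set (c := nx b).
  apply is_lim_ext_loc with (fun t =>
    / 2 * (f b t / f c t + f c t / f b t + -1 * (f i t / f b t * (f i t / f c t)))
    + (/ 3 * (k i * / f i t) + - / 6 * (k b * / f b t * (f i t / f b t) + k c * / f c t * (f i t / f c t)))).
  - apply (evt_imp _ _) with (2 := Hp); intros t H.
    assert (P1 := H i); assert (P2 := H b); assert (P3 := H c).
    unfold vf, rhs; fold b; fold c. field; lra.
  - eapply is_lim_val.
    + apply is_lim_sum.
      * apply is_lim_prod; [apply is_lim_cst|]. repeat apply is_lim_sum; try apply Hr.
        apply is_lim_prod; [apply is_lim_cst|]. apply is_lim_prod; apply Hr.
      * apply is_lim_sum; (apply is_lim_prod; [apply is_lim_cst|]).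
        -- apply is_lim_prod; [apply is_lim_cst | apply Hi].
        -- apply is_lim_sum; (apply is_lim_prod; [apply is_lim_prod; [apply is_lim_cst | apply Hi] | apply Hr]).
    + ring.
Qed.

Lemma trap_AC (T : R) (k : idx -> R) (f : idx -> R -> R) :
  (forall t, T <= t -> wtrap (fun i => f i t) k /\
     forall i, is_derive (f i) t (vf (fun j => f j t) k i)) ->
  forall i, is_lim (fun t => f i t / t) p_infty (1 / 2).
Proof.
  intros H.
  assert (HP : forall i t, T <= t -> 0 < f i t) by (intros i t Ht; apply (H t Ht)).
  assert (Hgrow : forall i t, T <= t -> (t - T) / 4 <= f i t).
  { intros i t Ht.
    assert (A := derive_nonneg_le (fun s => f i s - (s - T) / 4)
      (fun s => vf (fun j => f j s) k i - / 4) T t Ht).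
    assert (P := HP i T (Rle_refl T)).
    assert (f i T - (T - T) / 4 <= f i t - (t - T) / 4); [|lra].
    apply A; intros s Hs.
    - apply (is_derive_minus (f i) (fun s => (s - T) / 4)); [apply H; lra|].
      auto_derive; [exact I | field].
    - assert (V := vf_ge _ _ i (proj1 (H s (proj1 Hs)))). lra. }
  assert (Hinf : forall i, is_lim (f i) p_infty p_infty).
  { intros i; apply is_lim_spec; intros M.
    exists (Rmax T (T + 4 * M)); intros t Ht.
    assert (A1 := Rmax_l T (T + 4 * M)); assert (A2 := Rmax_r T (T + 4 * M)).
    assert (A := Hgrow i t ltac:(lra)). lra. }
  set (K := Rabs (k i1) + Rabs (k i2) + Rabs (k i3)).
  assert (HKk : forall i, Rabs (k i) <= K) by (intros; apply idx_bound).
  assert (Hratio : forall l i j, 1 < l <= 11 / 10 -> evt (fun t => f j t < l * f i t)).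
  { intros l i j Hl.
    destruct (idx_eq_dec i j) as [<-|Hij].
    { exists T; intros t Ht. assert (P := HP i t ltac:(lra)). nra. }
    set (m := third i j).
    assert (Hl2 : 0 < l ^ 2 - 1) by nra.
    (* Once every f exceeds M, one has 2 (l^2 - 1) f_i >= 5 K + 1 and f_j f_m >= 1, hence [dpsi] <=
       -1 and [psi] turns negative after finite time. Growth at rate 1/4 reaches size M by the time
       T + 4 M. *)
    set (M := Rmax 1 ((5 * K + 1) / (2 * (l ^ 2 - 1)))).
    assert (HM1 := Rmax_l 1 ((5 * K + 1) / (2 * (l ^ 2 - 1)))).
    assert (HM2 := Rmax_r 1 ((5 * K + 1) / (2 * (l ^ 2 - 1)))). fold M in HM1, HM2.
    set (T1 := T + 4 * M).
    assert (Hbig : forall n t, T1 <= t -> M <= f n t).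
    { intros n t Ht; assert (A := Hgrow n t). unfold T1 in Ht. assert (T <= t) by lra. lra. }
    assert (Hdec : forall t, T1 <= t ->
      psi l (f i t) (f j t) (f m t) <= psi l (f i T1) (f j T1) (f m T1) - (t - T1)).
    { intros t Ht.
      assert (A := derive_nonneg_le (fun s => - (s - T1) - psi l (f i s) (f j s) (f m s))
        (fun s => - 1 - dpsi l (f i s) (f j s) (f m s) (k i) (k j) (k m)) T1 t Ht).
      assert (- (T1 - T1) - psi l (f i T1) (f j T1) (f m T1) <= - (t - T1) - psi l (f i t) (f j t) (f m t));
        [|lra].
      apply A; intros s Hs; assert (HTs : T <= s) by (unfold T1 in Hs; lra).
      - apply (is_derive_minus (fun s => - (s - T1)) (fun s => psi l (f i s) (f j s) (f m s))).
        + auto_derive; [exact I | ring].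
        + apply psi_derive_idx; [exact Hij|]. intros n; split; [apply HP, HTs | apply (H s HTs)].
      - assert (B := dpsi_le_idx l K (fun i => f i s) k i j (proj1 (H s HTs)) ltac:(lra) HKk).
        cbv beta in B. fold m in B.
        assert (B1 := Hbig i s (proj1 Hs)); assert (B2 := Hbig j s (proj1 Hs)); assert (B3 := Hbig m s (proj1 Hs)).
        assert (B4 : 5 * K + 1 <= f i s * (2 * (l ^ 2 - 1))) by (apply Rle_div_l; lra).
        assert (B5 : 1 <= f j s * f m s) by nra.
        assert (f j s * f m s * (5 * K - 2 * (l ^ 2 - 1) * f i s) <= - 1) by nra. lra. }
    exists (Rmax T1 (T1 + psi l (f i T1) (f j T1) (f m T1))); intros t Ht.
    assert (A1 := Rmax_l T1 (T1 + psi l (f i T1) (f j T1) (f m T1))).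
    assert (A2 := Rmax_r T1 (T1 + psi l (f i T1) (f j T1) (f m T1))).
    assert (HTt : T <= t) by (unfold T1 in *; lra).
    apply (psi_neg l (f i t) (f j t) (f m t)); try apply HP; try assumption; [lra|].
    assert (B := Hdec t ltac:(lra)). lra. }
  assert (Hr : forall i j, is_lim (fun t => f i t / f j t) p_infty 1).
  { intros i j; apply is_lim_spec; intros eps. assert (He := cond_pos eps).
    (* The two inequalities f_i < l f_j and f_j < l f_i put the ratio within (l - 1) l of 1, which
       is below eps for this l. *)
    set (l := 1 + Rmin (1 / 10) (eps / 2)).
    assert (Hl : 1 < l <= 11 / 10 /\ l <= 1 + eps / 2).
    { unfold l; assert (A1 := Rmin_l (1 / 10) (eps / 2)); assert (A2 := Rmin_r (1 / 10) (eps / 2)).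
      assert (0 < Rmin (1 / 10) (eps / 2)) by (apply Rmin_glb_lt; lra). lra. }
    destruct Hl as [Hl Hle].
    apply (evt_imp _ _) with (2 := evt_and _ _ (evt_gt T) (evt_and _ _ (Hratio l i j Hl) (Hratio l j i Hl))).
    intros t (Ht & R1 & R2).
    assert (P1 := HP i t ltac:(lra)); assert (P2 := HP j t ltac:(lra)).
    replace (f i t / f j t - 1) with ((f i t - f j t) / f j t) by (field; lra).
    unfold Rdiv; rewrite Rabs_mult, (Rabs_pos_eq (/ _)) by (left; apply Rinv_0_lt_compat, P2).
    apply Rlt_div_l; [exact P2|].
    assert (0 < eps * f j t) by (apply Rmult_lt_0_compat; assumption).
    apply Rabs_lt_between; split; [|nra].
    assert ((l - 1) * f i t < eps * f j t); [|nra].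
    apply Rlt_trans with ((l - 1) * (l * f j t)); [apply Rmult_lt_compat_l; lra|].
    assert ((l - 1) * l < eps) by nra. nra. }
  intros i.
  apply derive_lim_ratio with (fun t => vf (fun j => f j t) k i).
  - exists T; intros t Ht; apply (H t); lra.
  - eapply is_lim_val; [apply (vf_lim k f (fun _ _ => 1) i)|].
    + exists T; intros t Ht j; apply HP; lra.
    + intros j; apply is_lim_inv_infty, Hinf.
    + exact Hr.
    + field.
Qed.

(** * Symbol classes at infinity *)

Definition BigO (m : R) (h : R -> R) : Prop :=
  exists C, evt (fun t => Rabs (h t) <= C * Rpower t m).

Lemma Rpower_gt0 (t m : R) : 0 < Rpower t m.
Proof. apply exp_pos. Qed.

Lemma BigO_evt (m : R) (h : R -> R) : BigO m h ->
  exists C, 0 <= C /\ evt (fun t => 1 < t /\ Rabs (h t) <= C * Rpower t m).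
Proof.
  intros [C H]. exists (Rmax 0 C); split; [apply Rmax_l|].
  apply (evt_imp _ _) with (2 := evt_and _ _ (evt_gt 1) H).
  intros t [Ht B]; split; [exact Ht|]. eapply Rle_trans; [exact B|].
  apply Rmult_le_compat_r; [left; apply Rpower_gt0 | apply Rmax_r].
Qed.

Lemma BigO_plus (m : R) (g h : R -> R) : BigO m g -> BigO m h -> BigO m (fun t => g t + h t).
Proof.
  intros [C HC] [D HD]; exists (C + D).
  apply (evt_imp _ _) with (2 := evt_and _ _ HC HD). intros t [H1 H2].
  rewrite Rmult_plus_distr_r. apply Rabs_plus_le; assumption.
Qed.

Lemma BigO_mult (m n : R) (g h : R -> R) :
  BigO m g -> BigO n h -> BigO (m + n) (fun t => g t * h t).
Proof.
  intros [C HC] [D HD]; exists (C * D).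
  apply (evt_imp _ _) with (2 := evt_and _ _ HC HD). intros t [H1 H2].
  rewrite Rpower_plus.
  replace (C * D * (Rpower t m * Rpower t n)) with (C * Rpower t m * (D * Rpower t n)) by ring.
  apply Rabs_mult_le; assumption.
Qed.

Lemma BigO_weak (m n : R) (h : R -> R) : m <= n -> BigO m h -> BigO n h.
Proof.
  intros Hmn H; destruct (BigO_evt _ _ H) as (C & HC & HE); exists C.
  apply (evt_imp _ _) with (2 := HE). intros t [Ht B].
  eapply Rle_trans; [exact B|]. apply Rmult_le_compat_l; [exact HC|]. apply Rle_Rpower; lra.
Qed.

Lemma BigO_exp (m n : R) (h : R -> R) : BigO m h -> m = n -> BigO n h.
Proof. intros H <-; exact H. Qed.

Lemma BigO_ext (m : R) (g h : R -> R) : evt (fun t => g t = h t) -> BigO m g -> BigO m h.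
Proof.
  intros He [C HC]; exists C. apply (evt_imp _ _) with (2 := evt_and _ _ He HC).
  intros t [<- B]; exact B.
Qed.

Lemma BigO_const (c : R) : BigO 0 (fun _ => c).
Proof.
  exists (Rabs c); exists 0; intros t Ht. rewrite Rpower_O by exact Ht. lra.
Qed.

Lemma BigO_zero (m : R) : BigO m (fun _ => 0).
Proof. exists 0; exists 0; intros t Ht. rewrite Rabs_R0. lra. Qed.

Lemma BigO_lim (h : R -> R) (l : R) : is_lim h p_infty l -> BigO 0 h.
Proof.
  intros H; apply is_lim_spec in H. specialize (H (mkposreal 1 Rlt_0_1)). simpl in H.
  exists (Rabs l + 1). apply (evt_imp _ _) with (2 := evt_and _ _ (evt_gt 0) H).
  intros t [Ht B]. rewrite Rpower_O, Rmult_1_r by exact Ht.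
  replace (h t) with (l + (h t - l)) by ring. apply Rabs_plus_le; lra.
Qed.

Lemma BigO_id : BigO 1 (fun t => t).
Proof.
  exists 1; exists 0; intros t Ht. rewrite Rpower_1, Rabs_pos_eq by lra. lra.
Qed.

Lemma BigO_inv : BigO (-1) (fun t => / t).
Proof.
  exists 1; exists 0; intros t Ht. replace (-1) with (Ropp 1) by lra. rewrite Rpower_Ropp, Rpower_1 by lra.
  rewrite Rabs_pos_eq; [lra | left; apply Rinv_0_lt_compat, Ht].
Qed.

Lemma BigO_ratio_lim (h : R -> R) (l : R) : is_lim (fun t => h t / t) p_infty l -> BigO 1 h.
Proof.
  intros H; apply BigO_ext with (fun t => h t / t * t).
  - apply (evt_imp _ _) with (2 := evt_gt 0); intros t Ht; field; lra.
  - apply (BigO_exp (0 + 1)); [|ring]. apply BigO_mult; [eapply BigO_lim, H | apply BigO_id].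
Qed.

Lemma is_lim_inv_finite (g : R -> R) (l : R) : l <> 0 ->
  is_lim g p_infty l -> is_lim (fun t => / g t) p_infty (/ l).
Proof. intros Hl H; apply (is_lim_inv g p_infty l H). intros E; injection E; auto. Qed.

Lemma BigO_inv_ratio_lim (h : R -> R) (l : R) : 0 < l ->
  evt (fun t => 0 < h t) -> is_lim (fun t => h t / t) p_infty l -> BigO (-1) (fun t => / h t).
Proof.
  intros Hl Hp H; apply BigO_ext with (fun t => / (h t / t) * / t).
  - apply (evt_imp _ _) with (2 := evt_and _ _ (evt_gt 0) Hp); intros t [Ht P]; field; lra.
  - apply (BigO_exp (0 + -1)); [|ring]. apply BigO_mult; [|apply BigO_inv].
    eapply BigO_lim, is_lim_inv_finite; [|exact H]. lra.
Qed.

(** For large t the point t + s lies between t / 2 and 2 t, so the power of exponent m changes by a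
    factor of at most 2^|m|, of either sign of m. *)
Lemma BigO_shift (m s : R) (h : R -> R) : BigO m h -> BigO m (fun t => h (t + s)).
Proof.
  intros H; destruct (BigO_evt _ _ H) as (C & HC & [T HT]).
  exists (C * exp (Rabs m * ln 2)).
  exists (Rmax (T - s) (2 * Rabs s + 1)); intros t Ht.
  assert (A1 := Rmax_l (T - s) (2 * Rabs s + 1)); assert (A2 := Rmax_r (T - s) (2 * Rabs s + 1)).
  assert (A3 := Rle_abs s); assert (A4 := Rabs_maj2 s).
  destruct (HT (t + s) ltac:(lra)) as [_ B].
  eapply Rle_trans; [exact B|]. rewrite Rmult_assoc. apply Rmult_le_compat_l; [exact HC|].
  unfold Rpower. rewrite <- exp_plus.
  assert (E : m * ln (t + s) <= Rabs m * ln 2 + m * ln t).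
  { assert (L1 : ln (t + s) <= ln 2 + ln t) by (rewrite <- ln_mult by lra; apply ln_le; lra).
    assert (L2 : ln t <= ln 2 + ln (t + s)) by (rewrite <- ln_mult by lra; apply ln_le; lra).
    assert (E : m * (ln (t + s) - ln t) <= Rabs m * ln 2); [|lra].
    eapply Rle_trans; [apply Rle_abs|]. rewrite Rabs_mult.
    apply Rmult_le_compat_l; [apply Rabs_pos|]. apply Rabs_le; lra. }
  destruct E as [E|E]; [left; apply exp_increasing, E | rewrite E; lra].
Qed.

Lemma BigO_neg_lim (q : R) (h : R -> R) : q < 0 -> BigO q h -> is_lim h p_infty 0.
Proof.
  intros Hq H; destruct (BigO_evt _ _ H) as (C & HC & HE).
  apply is_lim_spec; intros eps. assert (He := cond_pos eps).
  apply (evt_imp _ _) with (2 := evt_and _ _ HE (evt_gt (exp (ln (eps / (C + 1)) / q)))).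
  intros t [[Ht B] Ht']. rewrite Rminus_0_r.
  assert (L : ln (eps / (C + 1)) / q < ln t).
  { rewrite <- (ln_exp (ln (eps / (C + 1)) / q)). apply ln_increasing; [apply exp_pos | exact Ht']. }
  assert (L' : q * ln t < ln (eps / (C + 1))).
  { replace (ln (eps / (C + 1))) with (q * (ln (eps / (C + 1)) / q)) by (field; lra). nra. }
  assert (P : Rpower t q < eps / (C + 1)).
  { unfold Rpower. rewrite <- (exp_ln (eps / (C + 1))) by (apply Rdiv_lt_0_compat; lra).
    apply exp_increasing, L'. }
  apply Rlt_div_r in P; [|lra]. assert (P0 := Rpower_gt0 t q). nra.
Qed.

(** With P = (C / p) t^(-p), whose derivative is minus the bound on h', the function h - P increases
    and h + P decreases. The supremum of h - P is therefore squeezed between them and is the limit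
    L, at distance at most P. *)
Lemma BigO_primitive (p : R) (h dh : R -> R) : 0 < p ->
  evt (fun t => is_derive h t (dh t)) -> BigO (- p - 1) dh ->
  exists L, BigO (- p) (fun t => h t - L).
Proof.
  intros Hp Hd H; destruct (BigO_evt _ _ H) as (C & HC & HE).
  destruct (evt_and _ _ Hd HE) as [T HT].
  set (P := fun t => C / p * Rpower t (- p)).
  assert (HP : forall t, 0 < t -> is_derive P t (- (C * Rpower t (- p - 1)))).
  { intros t Ht; unfold P, Rpower. auto_derive; [exact Ht|].
    replace ((- p - 1) * ln t) with (- p * ln t + - ln t) by ring.
    rewrite exp_plus, (exp_Ropp (ln t)), exp_ln by exact Ht. field; lra. }
  assert (P0 : forall t, 0 <= P t).
  { intros t; apply Rmult_le_pos; [|left; apply Rpower_gt0].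
    apply Rmult_le_pos; [exact HC | left; apply Rinv_0_lt_compat, Hp]. }
  set (T1 := T + 1).
  assert (Hup : forall s t, T1 <= s -> s <= t -> h s - P s <= h t - P t /\ h t + P t <= h s + P s).
  { intros s t Hs Hst.
    assert (HD : forall x, s <= x <= t -> is_derive h x (dh x) /\ 0 < x /\ Rabs (dh x) <= C * Rpower x (- p - 1)).
    { intros x Hx; destruct (HT x) as [D [B1 B2]]; [unfold T1 in Hs; lra|].
      split; [exact D | split; [lra | exact B2]]. }
    split.
    - apply (derive_nonneg_le (fun x => h x - P x) (fun x => dh x - - (C * Rpower x (- p - 1)))); [exact Hst | |].
      + intros x Hx; destruct (HD x Hx) as (D & X & _). apply (is_derive_minus h P); auto.
      + intros x Hx; destruct (HD x Hx) as (_ & _ & B). apply Rabs_le_between in B; lra.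
    - apply Ropp_le_cancel.
      assert (A := derive_nonneg_le (fun x => - P x - h x) (fun x => - - (C * Rpower x (- p - 1)) - dh x) s t Hst).
      assert (- P s - h s <= - P t - h t); [|lra].
      apply A.
      + intros x Hx; destruct (HD x Hx) as (D & X & _).
        apply (is_derive_minus (fun x => - P x) h); [apply (is_derive_opp P), HP, X | exact D].
      + intros x Hx; destruct (HD x Hx) as (_ & _ & B). apply Rabs_le_between in B; lra. }
  destruct (completeness (fun y => exists t, T1 <= t /\ y = h t - P t)) as [L [HL1 HL2]].
  - exists (h T1 + P T1). intros y [t [Ht ->]].
    destruct (Hup T1 t (Rle_refl _) Ht). specialize (P0 t). lra.
  - exists (h T1 - P T1), T1; split; [lra | reflexivity].
  - exists L. exists (C / p). exists T1; intros t Ht.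
    fold (P t). apply Rabs_le; split.
    + assert (L <= h t + P t); [|lra]. apply HL2. intros y [s [Hs ->]].
      destruct (Rle_dec s t) as [A|A].
      * destruct (Hup s t Hs A). specialize (P0 t). lra.
      * destruct (Hup t s ltac:(lra) ltac:(lra)). specialize (P0 s). lra.
    + assert (h t - P t <= L); [|lra]. apply HL1. exists t; split; [lra | reflexivity].
Qed.

(** The first N derivatives are of orders m, m - 1, and so on. They are witnessed by functions valid
    for large t rather than by [Derive_n], so that sums and products follow by induction on N;
    [symbol_Derive_n] translates back. *)
Fixpoint symbol (N : nat) (m : R) (h : R -> R) : Prop :=
  match N with
  | O => BigO m h
  | S N' => BigO m h /\
      exists dh, evt (fun t => is_derive h t (dh t)) /\ symbol N' (m - 1) dh
  end.

Lemma symbol_S (N : nat) : forall m h, symbol (S N) m h -> symbol N m h.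
Proof.
  induction N as [|N IH]; intros m h [H1 (dh & Hd & H2)]; [exact H1|].
  split; [exact H1|]. exists dh; split; [exact Hd | apply IH, H2].
Qed.

Lemma symbol_weak (N : nat) : forall m n h, m <= n -> symbol N m h -> symbol N n h.
Proof.
  induction N as [|N IH]; intros m n h Hmn; [apply BigO_weak, Hmn|].
  intros [H1 (dh & Hd & H2)]; split; [eapply BigO_weak, H1; exact Hmn|].
  exists dh; split; [exact Hd|]. apply IH with (m - 1); [lra | exact H2].
Qed.

Lemma symbol_plus (N : nat) : forall m g h,
  symbol N m g -> symbol N m h -> symbol N m (fun t => g t + h t).
Proof.
  induction N as [|N IH]; intros m g h; [apply BigO_plus|].
  intros [G1 (dg & Gd & G2)] [H1 (dh & Hd & H2)]; split; [apply BigO_plus; assumption|].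
  exists (fun t => dg t + dh t); split; [|apply IH; assumption].
  apply (evt_imp _ _) with (2 := evt_and _ _ Gd Hd). intros t [D1 D2].
  apply (is_derive_plus g h); assumption.
Qed.

Lemma symbol_mult (N : nat) : forall m n g h,
  symbol N m g -> symbol N n h -> symbol N (m + n) (fun t => g t * h t).
Proof.
  induction N as [|N IH]; intros m n g h; [apply BigO_mult|].
  intros HG HH. assert (HG' := symbol_S _ _ _ HG); assert (HH' := symbol_S _ _ _ HH).
  destruct HG as [G1 (dg & Gd & G2)], HH as [H1 (dh & Hd & H2)].
  split; [apply BigO_mult; assumption|].
  exists (fun t => dg t * h t + g t * dh t); split.
  - apply (evt_imp _ _) with (2 := evt_and _ _ Gd Hd). intros t [D1 D2].
    apply is_derive_mult_R; assumption.
  - apply symbol_plus.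
    + replace (m + n - 1) with (m - 1 + n) by ring. apply IH; assumption.
    + replace (m + n - 1) with (m + (n - 1)) by ring. apply IH; assumption.
Qed.

Lemma symbol_zero (N : nat) : forall m, symbol N m (fun _ => 0).
Proof.
  induction N as [|N IH]; intros m; [apply BigO_zero|].
  split; [apply BigO_zero|]. exists (fun _ => 0); split; [|apply IH].
  exists 0; intros; apply is_derive_const_R.
Qed.

(** The order is taken from the hypothesis because the constants k_i are used at order 0 in general
    and at order -3 when they vanish. *)
Lemma symbol_const (N : nat) (m c : R) : BigO m (fun _ => c) -> symbol N m (fun _ => c).
Proof.
  intros H; destruct N; [exact H|]. split; [exact H|].
  exists (fun _ => 0); split; [|apply symbol_zero]. exists 0; intros; apply is_derive_const_R.
Qed.

Lemma symbol_id (N : nat) : symbol N 1 (fun t => t).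
Proof.
  destruct N; [exact BigO_id|]. split; [exact BigO_id|].
  exists (fun _ => 1); split.
  - exists 0; intros t _; exact (is_derive_id (K := R_AbsRing) t).
  - rewrite Rminus_diag_eq by reflexivity. apply symbol_const, BigO_const.
Qed.

Lemma symbol_exp (N : nat) (m n : R) (h : R -> R) : symbol N m h -> m = n -> symbol N n h.
Proof. intros H <-; exact H. Qed.

Lemma symbol_ext (N : nat) (m : R) (g h : R -> R) :
  (forall t, g t = h t) -> symbol N m g -> symbol N m h.
Proof. intros E; replace h with g; [auto|]. apply functional_extensionality, E. Qed.

Lemma evt_locally (P : R -> Prop) : evt P -> evt (fun t => locally t P).
Proof.
  intros [T HT]; exists T; intros t Ht.
  apply (filter_imp (fun s => T < s)); [exact HT | apply (open_gt T), Ht].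
Qed.

Lemma symbol_Derive_n (N n : nat) : forall m h, symbol (n + N) m h ->
  exists g, symbol N (m - INR n) g /\
    evt (fun t => ex_derive_n h n t /\ Derive_n h n t = g t).
Proof.
  revert N; induction n as [|n IH]; intros N m h H.
  - exists h; split; [apply symbol_exp with m; [exact H | simpl; ring]|].
    exists 0; intros; split; [exact I | reflexivity].
  - destruct (IH (S N) m h) as (g & [_ (dg & Hd & Hs)] & HE).
    { rewrite Nat.add_succ_r; exact H. }
    exists dg; split; [apply symbol_exp with (1 := Hs); rewrite S_INR; ring|].
    (* Differentiating [Derive_n] once more requires its equality with [g] in a neighbourhood of t,
       not just at t. *)
    apply (evt_imp _ _) with (2 := evt_and _ _ Hd (evt_locally _ HE)).
    intros t [D HL].
    assert (D' : is_derive (Derive_n h n) t (dg t)).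
    { apply is_derive_ext_loc with g; [|exact D]. apply (filter_imp _ _) with (2 := HL).
      intros s [_ E]; symmetry; exact E. }
    split; [exists (dg t); exact D' | apply is_derive_unique, D'].
Qed.

(** * Limit cone and rate *)

Lemma is_lim_inv_id : is_lim (fun t => / t) p_infty 0.
Proof. apply is_lim_inv_infty, is_lim_id. Qed.

Section Asymptotics.
Context {a : R} {k : idx -> R} {f : idx -> R -> R} {c : idx -> R}
  (Hs : sol (ray a) k f) (Hc : forall i, 0 < c i)
  (Hl : forall i, is_lim (fun t => f i t / t) p_infty (c i)).

Lemma end_pos : evt (fun t => 0 < t /\ forall i, 0 < f i t).
Proof. apply evt_and; [apply evt_gt|]. exists a; intros t Ht i; apply (Hs t Ht i). Qed.

Lemma end_inv_lim (i : idx) : is_lim (fun t => / f i t) p_infty 0.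
Proof.
  apply is_lim_ext_loc with (fun t => / (f i t / t) * / t).
  - apply (evt_imp _ _) with (2 := end_pos). intros t [Ht P]; specialize (P i); field; lra.
  - apply is_lim_val with (/ c i * 0); [|ring]. apply is_lim_prod; [|apply is_lim_inv_id].
    apply is_lim_inv_finite, Hl. apply Rgt_not_eq, Hc.
Qed.

Lemma end_ratio_lim (i j : idx) : is_lim (fun t => f i t / f j t) p_infty (c i / c j).
Proof.
  apply is_lim_ext_loc with (fun t => f i t / t * / (f j t / t)).
  - apply (evt_imp _ _) with (2 := end_pos). intros t [Ht P].
    assert (P1 := P i); assert (P2 := P j); field; lra.
  - apply is_lim_prod; [apply Hl|]. apply is_lim_inv_finite, Hl. apply Rgt_not_eq, Hc.
Qed.

(** The derivatives f_i' converge, so c_i equals the limit of f_i', the static field on the ratios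
    of the c_j. This reads 2 c_1 c_2 c_3 = c_j^2 + c_m^2 - c_i^2 for all three choices of i;
    subtracting two of them makes the c_i equal, and then 2 c^3 = c^2. *)
Lemma cone_half (i : idx) : c i = 1 / 2.
Proof.
  assert (E : forall i, c i = / 2 * (c (nx i) / c (nx (nx i)) + c (nx (nx i)) / c (nx i)
     + -1 * (c i / c (nx i) * (c i / c (nx (nx i)))))).
  { intros j.
    assert (A : is_lim (fun t => f j t / t) p_infty (/ 2 * (c (nx j) / c (nx (nx j)) + c (nx (nx j)) / c (nx j)
     + -1 * (c j / c (nx j) * (c j / c (nx (nx j))))))).
    { apply derive_lim_ratio with (fun t => vf (fun j => f j t) k j).
      - exists a; intros t Ht; apply (Hs t Ht j).
      - apply (vf_lim k f (fun i j => c i / c j)).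
        + apply (evt_imp _ _) with (2 := end_pos). tauto.
        + apply end_inv_lim.
        + apply end_ratio_lim. }
    apply is_lim_unique in A. rewrite (is_lim_unique _ _ _ (Hl j)) in A. injection A; auto. }
  assert (P1 := Hc i1); assert (P2 := Hc i2); assert (P3 := Hc i3).
  assert (E' : forall i, 2 * (c i1 * c i2 * c i3) =
     c (nx i) ^ 2 + c (nx (nx i)) ^ 2 - c i ^ 2).
  { intros j; specialize (E j).
    apply (f_equal (fun x => 2 * c (nx j) * c (nx (nx j)) * x)) in E.
    destruct j; simpl nx in *; field_simplify in E; try lra. }
  assert (E1 := E' i1); assert (E2 := E' i2); assert (E3 := E' i3); simpl nx in *.
  assert (H12 : (c i1 - c i2) * (c i1 + c i2) = 0) by lra.
  assert (H13 : (c i1 - c i3) * (c i1 + c i3) = 0) by lra.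
  apply Rmult_integral in H12; apply Rmult_integral in H13.
  assert (H12' : c i1 = c i2) by lra. assert (H13' : c i1 = c i3) by lra. clear H12 H13.
  rewrite <- H12', <- H13' in E1.
  assert (E0 : c i1 ^ 2 * (2 * c i1 - 1) = 0) by lra.
  apply Rmult_integral in E0. assert (0 < c i1 ^ 2) by (apply pow_lt, P1).
  destruct i; lra.
Qed.
End Asymptotics.

Ltac lim_tac := repeat first [ eassumption | apply is_lim_cst | apply is_lim_sum | apply is_lim_prod ].

Section HalfCone.
Context {a : R} {k : idx -> R} {f : idx -> R -> R} (Hs : sol (ray a) k f)
  (Hl : forall i, is_lim (fun t => f i t / t) p_infty (1 / 2)).

Let Hc : idx -> 0 < 1 / 2.
Proof. intros _; lra. Qed.

Lemma half_ratio_lim (i j : idx) : is_lim (fun t => f i t / f j t) p_infty 1.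
Proof. eapply is_lim_val; [apply (end_ratio_lim Hs Hc Hl)|]. field. Qed.

Lemma third_pos (i j : idx) : evt (fun t => 0 < t /\ 0 < f i t /\ 0 < f j t /\ 0 < f (third i j) t).
Proof. apply (evt_imp _ _) with (2 := end_pos Hs). intros t [Ht P]; repeat split; auto. Qed.

(** For l = 1 the cubic part of [dpsi] vanishes, so l'Hopital against t^3 gives the limit (k_j -
    k_i) / 12 for [psi 1] / t^3. Since [psi 1] is f_j - f_i times f_m^2 (f_i + f_j), which grows
    like t^3 / 4, division yields the claim. *)
Lemma diff_lim (i j : idx) : is_lim (fun t => f j t - f i t) p_infty ((k j - k i) / 3).
Proof.
  destruct (idx_eq_dec i j) as [<-|Hij].
  { apply (is_lim_ext (fun _ => 0)); [intros; ring|]. eapply is_lim_val; [apply is_lim_cst | field]. }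
  set (m := third i j).
  assert (R1 := half_ratio_lim j i). assert (R2 := half_ratio_lim m i).
  assert (R3 := half_ratio_lim i j). assert (R4 := half_ratio_lim i m).
  assert (L1 := Hl i). assert (L2 := Hl j). assert (L3 := Hl m).
  assert (HP : is_lim (fun t => psi 1 (f i t) (f j t) (f m t) / t ^ 3) p_infty ((k j - k i) / 12)).
  { apply lhopital_infty with (fun t => dpsi 1 (f i t) (f j t) (f m t) (k i) (k j) (k m)) (fun t => 3 * t ^ 2).
    - apply (evt_imp _ _) with (2 := evt_and _ _ (evt_gt a) (evt_gt 0)). intros t [Ha Ht].
      split; [|split].
      + apply psi_derive_idx; [exact Hij | exact (Hs t Ha)].
      + auto_derive; [exact I | ring].
      + assert (0 < t ^ 2) by (apply pow_lt, Ht). lra.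
    - apply is_lim_spec; intros M. exists (Rmax 1 M); intros t Ht.
      assert (A1 := Rmax_l 1 M); assert (A2 := Rmax_r 1 M).
      assert (1 <= t * t) by nra. simpl; nra.
    - apply is_lim_ext_loc with (fun t => - / 3 * (f j t / t * (f m t / t)) * (f j t / f i t * (f m t / f i t) *
        (- / 3 * ((k i + k j * (f i t / f j t * (f i t / f j t)) + k m * (f i t / f m t * (f i t / f m t)))
           * (1 + -1 * (f i t / f j t * (f i t / f j t))))
         + k i + -1 * ((f i t / f j t * (f i t / f j t)) * (f i t / f j t * (f i t / f j t)) * k j)))).
      + apply (evt_imp _ _) with (2 := third_pos i j). intros t (Ht & P1 & P2 & P3). fold m in P3.
        unfold dpsi. field. lra.
      + eapply is_lim_val; [lim_tac|]. field. }
  apply is_lim_ext_loc with (fun t => psi 1 (f i t) (f j t) (f m t) / t ^ 3 *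
     / (f m t / t * (f m t / t) * (f i t / t + f j t / t))).
  - apply (evt_imp _ _) with (2 := third_pos i j). intros t (Ht & P1 & P2 & P3). fold m in P3.
    unfold psi. field. repeat split; try lra.
  - eapply is_lim_val.
    + apply is_lim_prod; [exact HP|]. apply is_lim_inv_finite; [|lim_tac]. lra.
    + field.
Qed.

Lemma f_BigO (i : idx) : BigO 1 (f i).
Proof. eapply BigO_ratio_lim, Hl. Qed.

Lemma inv_f_BigO (i : idx) : BigO (-1) (fun t => / f i t).
Proof.
  apply BigO_inv_ratio_lim with (1 / 2); [lra | | apply Hl].
  apply (evt_imp _ _) with (2 := end_pos Hs). intros t [_ P]; apply P.
Qed.

Lemma static_psi_constant (i j : idx) : (forall i, k i = 0) -> i <> j ->
  exists C, forall t, a < t -> psi 1 (f i t) (f j t) (f (third i j) t) = C.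
Proof.
  intros Hk Hij. exists (psi 1 (f i (a + 1)) (f j (a + 1)) (f (third i j) (a + 1))).
  intros t Ht.
  apply (ray_constant a (fun t => psi 1 (f i t) (f j t) (f (third i j) t))); [|exact Ht | lra].
  clear t Ht; intros t Ht. eapply is_derive_val.
  - apply psi_derive_idx; [exact Hij | exact (Hs t Ht)].
  - unfold dpsi; rewrite !Hk. ring.
Qed.

Lemma static_diff_BigO (i j : idx) : (forall i, k i = 0) -> BigO (-3) (fun t => f j t - f i t).
Proof.
  intros Hk. destruct (idx_eq_dec i j) as [<-|Hij].
  { apply BigO_ext with (fun _ => 0); [|apply BigO_zero]. exists 0; intros; ring. }
  set (m := third i j). destruct (static_psi_constant i j Hk Hij) as [C HC]. fold m in HC.
  apply BigO_ext with (fun t => C * (/ f m t * / f m t * / (f i t + f j t))).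
  - apply (evt_imp _ _) with (2 := evt_and _ _ (evt_gt a) (third_pos i j)).
    intros t (Ha & Ht & P1 & P2 & P3). fold m in P3. rewrite <- (HC t Ha). unfold psi. field. lra.
  - apply (BigO_exp (0 + (-1 + -1 + -1))); [|ring].
    apply BigO_mult; [apply BigO_const|].
    apply BigO_mult; [apply BigO_mult; apply inv_f_BigO|].
    apply BigO_inv_ratio_lim with 1; [lra | |].
    + apply (evt_imp _ _) with (2 := third_pos i j). intros t (_ & P1 & P2 & _); lra.
    + apply (is_lim_ext (fun t => f i t / t + f j t / t)); [intros; unfold Rdiv; ring|].
      eapply is_lim_val; [apply is_lim_sum; apply Hl | field].
Qed.
End HalfCone.

(* [m = 0] for general ends and [m = -3] for static ones, where [k = 0]. *)
Lemma end_translation (m a : R) (k : idx -> R) (f : idx -> R -> R) :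
  m <= 0 -> sum3 k = 0 -> sol (ray a) k f ->
  (forall i, BigO 1 (f i)) -> (forall i, BigO (-1) (fun t => / f i t)) ->
  (forall i, BigO m (fun _ => k i)) -> (forall i j, BigO m (fun t => f j t - f i t)) ->
  exists L, forall i, BigO m (fun t => f i t - t / 2 - L).
Proof.
  intros Hm Hk Hs Hf Hg HkO Hd.
  assert (Hpos : evt (fun t => forall i, 0 < f i t)) by (exists a; intros t Ht i; apply (Hs t Ht i)).
  set (x := f i1). set (y := f i2). set (z := f i3).
  (* The derivative of f_1 + f_2 + f_3 - 3 t / 2, with k_1 eliminated through the zero sum. The
     terms linear in k and in the differences cancel: every summand contains two factors that are
     differences or k's, each of order m, and the remaining factors have total order -2. *)
  set (dh := fun t => / 2 * (/ x t * / y t * / z t *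
      (x t * ((y t - x t) * (z t - x t) + -1 * ((y t - x t) * (y t - x t)) + -1 * ((z t - x t) * (z t - x t)))
        + -1 * ((y t + z t + -1 * x t + -1 * x t) * ((z t - y t) * (z t - y t)))))
    + (- / 2 * (k i2 * (y t - x t) * (/ x t * / y t) + k i3 * (z t - x t) * (/ x t * / z t))
       + / 6 * (k i2 * (y t - x t) * (/ x t * / y t * (/ x t + / y t))
              + k i3 * (z t - x t) * (/ x t * / z t * (/ x t + / z t))) * (x t + y t + z t))).
  assert (Hdh : BigO (2 * m - 2) dh).
  { assert (F1 := Hf i1 : BigO 1 x). assert (F2 := Hf i2 : BigO 1 y). assert (F3 := Hf i3 : BigO 1 z).
    assert (G1 := Hg i1 : BigO (-1) (fun t => / x t)). assert (G2 := Hg i2 : BigO (-1) (fun t => / y t)).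
    assert (G3 := Hg i3 : BigO (-1) (fun t => / z t)).
    assert (D1 := Hd i1 i2 : BigO m (fun t => y t - x t)).
    assert (D2 := Hd i1 i3 : BigO m (fun t => z t - x t)).
    assert (D3 := Hd i2 i3 : BigO m (fun t => z t - y t)).
    assert (K2 := HkO i2). assert (K3 := HkO i3).
    assert (N : forall n g, BigO n g -> BigO n (fun t => -1 * g t)).
    { intros n g H; apply (BigO_exp (0 + n)); [|ring]. apply BigO_mult; [apply BigO_const | exact H]. }
    assert (S : forall n g (q : R), BigO n g -> BigO n (fun t => q * g t)).
    { intros n g q H; apply (BigO_exp (0 + n)); [|ring]. apply BigO_mult; [apply BigO_const | exact H]. }
    unfold dh. apply BigO_plus; [|apply BigO_plus].
    - apply S. apply (BigO_exp (-1 + -1 + -1 + (1 + (m + m)))); [|ring].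
      apply BigO_mult; [apply BigO_mult; [apply BigO_mult|]; assumption|].
      apply BigO_plus.
      + apply BigO_mult; [exact F1|].
        apply BigO_plus; [apply BigO_plus|]; [|apply N|apply N]; apply BigO_mult; assumption.
      + apply N, BigO_mult; [|apply BigO_mult; assumption].
        apply BigO_plus; [apply BigO_plus; [apply BigO_plus|]|]; try apply N; assumption.
    - apply S. apply (BigO_exp (m + m + (-1 + -1))); [|ring].
      apply BigO_plus; (apply BigO_mult; apply BigO_mult; assumption).
    - apply (BigO_exp (m + m + (-1 + -1 + -1) + 1)); [|ring].
      apply BigO_mult; [|apply BigO_plus; [apply BigO_plus|]; assumption].
      apply S.
      apply BigO_plus; (apply BigO_mult; [apply BigO_mult; assumption|]);
        (apply BigO_mult; [apply BigO_mult; assumption | apply BigO_plus; assumption]). }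
  (* The exponent p = 1 - 2 m is positive because m <= 0, so the derivative of order 2 m - 2 is
     integrable at infinity. *)
  destruct (BigO_primitive (1 - 2 * m) (fun t => f i1 t + f i2 t + f i3 t - 3 / 2 * t) dh) as [L HL].
  - lra.
  - apply (evt_imp _ _) with (2 := evt_and _ _ (evt_gt a) Hpos). intros t [Ht P].
    assert (Q1 := proj2 (Hs t Ht i1)); assert (Q2 := proj2 (Hs t Ht i2)); assert (Q3 := proj2 (Hs t Ht i3)).
    eapply is_derive_val.
    + apply (is_derive_minus (fun t => f i1 t + f i2 t + f i3 t) (fun t => 3 / 2 * t)).
      * apply (is_derive_plus (fun t => f i1 t + f i2 t) (f i3)); [|exact Q3].
        apply (is_derive_plus (f i1) (f i2)); [exact Q1 | exact Q2].
      * apply (is_derive_scal (fun t => t)), (is_derive_id (K := R_AbsRing)).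
    + unfold minus, plus, opp, one, vf, rhs, dh; simpl.
      fold x y z. assert (P1 := P i1); assert (P2 := P i2); assert (P3 := P i3).
      fold x in P1; fold y in P2; fold z in P3.
      replace (k i1) with (- k i2 - k i3) by (unfold sum3 in Hk; lra).
      field; lra.
  - apply (BigO_exp (2 * m - 2)); [exact Hdh | ring].
  (* Each f_i is the mean plus a third of its differences to the others; the error 2 m - 1 of the
     mean is at most m. *)
  - exists (L / 3). intros i.
    apply BigO_ext with (fun t => / 3 * ((f i1 t + f i2 t + f i3 t - 3 / 2 * t - L)
      + ((f i t - f i1 t) + (f i t - f i2 t) + (f i t - f i3 t)))).
    + exists 0; intros; field.
    + apply (BigO_exp (0 + m)); [|ring]. apply BigO_mult; [apply BigO_const|].
      apply BigO_plus; [|apply BigO_plus; [apply BigO_plus|]; apply Hd].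
      apply BigO_weak with (2 := HL). lra.
Qed.

(** Bootstrap through the equation: the derivative of f_i - t / 2 is a polynomial in f, 1 / f, k and
    the differences of the f's, so control of N derivatives of these gives control of N + 1. The
    reciprocals have to be carried along in the induction. *)
Lemma end_symbol (m a : R) (k : idx -> R) (f : idx -> R -> R) :
  m <= 0 -> sol (ray a) k f ->
  (forall i, BigO (-1) (fun t => / f i t)) ->
  (forall i, BigO m (fun _ => k i)) -> (forall i, BigO m (fun t => f i t - t / 2)) ->
  forall N i, symbol N m (fun t => f i t - t / 2).
Proof.
  intros Hm Hs Hg Hk He.
  assert (Hpos : evt (fun t => forall i, 0 < f i t)) by (exists a; intros t Ht i; apply (Hs t Ht i)).
  assert (H : forall N, (forall i, symbol N m (fun t => f i t - t / 2)) /\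
    (forall i, symbol N (-1) (fun t => / f i t))).
  { induction N as [|N [IHe IHg]]; [split; assumption|].
    set (e := fun i t => f i t - t / 2).
    assert (IHf : forall i, symbol N 1 (f i)).
    { intros i. apply symbol_ext with (fun t => e i t + / 2 * t); [intros; unfold e; field|].
      apply symbol_plus; [apply symbol_weak with m; [lra | apply IHe]|].
      apply (symbol_exp _ (0 + 1)); [|ring]. apply symbol_mult; [apply symbol_const, BigO_const | apply symbol_id]. }
    assert (HkN : forall i, symbol N m (fun _ => k i)) by (intros; apply symbol_const, Hk).
    assert (S : forall n g (q : R), symbol N n g -> symbol N n (fun t => q * g t)).
    { intros n g q H; apply (symbol_exp _ (0 + n)); [|ring].
      apply symbol_mult; [apply symbol_const, BigO_const | exact H]. }
    assert (HD : forall i j, symbol N m (fun t => e j t - e i t)).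
    { intros i j; apply symbol_ext with (fun t => e j t + -1 * e i t); [intros; ring|].
      apply symbol_plus; [|apply S]; apply IHe. }
    (* The quantity f_i' - 1/2, arranged so that each summand contains a factor of order m, either a
       difference [u], [v] or some k; the other factors have total order -1. *)
    set (de := fun i t => let x := f i t in let y := f (nx i) t in let z := f (nx (nx i)) t in
      let u := e (nx i) t - e i t in let v := e (nx (nx i)) t - e i t in
      / 2 * (/ y * / z * (x * (u + v) + (u * (y + -1 * x) + -1 * (u * (z + -1 * x)) + v * (z + -1 * x))))
      + (/ 3 * (k i * / x) + - / 6 * (x * (k (nx i) * (/ y * / y) + k (nx (nx i)) * (/ z * / z))))).
    assert (Hde : forall i, symbol N (m - 1) (de i)).
    { intros i; unfold de; cbv zeta.
      assert (HF : forall i j, symbol N 1 (fun t => f i t + -1 * f j t))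
        by (intros; apply symbol_plus; [|apply S]; apply IHf).
      apply symbol_plus; [|apply symbol_plus].
      - apply S. apply (symbol_exp _ (-1 + -1 + (1 + m))); [|ring].
        apply symbol_mult; [apply symbol_mult; apply IHg|].
        apply symbol_plus; [apply symbol_mult; [apply IHf | apply symbol_plus; apply HD]|].
        apply (symbol_exp _ (m + 1)); [|ring].
        apply symbol_plus; [apply symbol_plus|]; [|apply (S _ (fun t => _ * (_ + -1 * _)))|]; apply symbol_mult; auto.
      - apply S. replace (m - 1) with (m + -1) by ring. apply symbol_mult; auto.
      - apply S. apply (symbol_exp _ (1 + (m + (-1 + -1)))); [|ring].
        apply symbol_mult; [apply IHf|]. apply symbol_plus; apply symbol_mult; auto; apply symbol_mult; auto. }
    assert (Hdf : forall i, evt (fun t => is_derive (f i) t (de i t + / 2))).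
    { intros i. apply (evt_imp _ _) with (2 := evt_and _ _ (evt_gt a) Hpos). intros t [Ht P].
      apply is_derive_val with (1 := proj2 (Hs t Ht i)).
      unfold vf, rhs, de, e; cbv zeta.
      assert (P1 := P i); assert (P2 := P (nx i)); assert (P3 := P (nx (nx i))).
      field; lra. }
    split; intros i.
    - split; [apply He|]. exists (de i); split; [|apply Hde].
      apply (evt_imp _ _) with (2 := Hdf i). intros t D.
      apply is_derive_val with (de i t + / 2 - / 2); [|ring].
      apply (is_derive_minus (f i) (fun t => t / 2)); [exact D|]. auto_derive; [exact I | field].
    - split; [apply Hg|].
      exists (fun t => -1 * (/ f i t * / f i t * (de i t + / 2))); split.
      + apply (evt_imp _ _) with (2 := evt_and _ _ Hpos (Hdf i)). intros t [P D]. specialize (P i).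
        apply is_derive_val with (- (de i t + / 2) / f i t ^ 2); [|field; lra].
        apply is_derive_inv; [exact D | lra].
      + apply S. apply (symbol_exp _ (-1 + -1 + 0)); [|ring].
        apply symbol_mult; [apply symbol_mult; apply IHg|].
        apply symbol_plus; [apply symbol_weak with (m - 1); [lra | apply Hde]|].
        apply symbol_const, BigO_const. }
  intros N; apply H.
Qed.

Lemma end_has_rate (nu a : R) (k : idx -> R) (f : idx -> R -> R) (c : idx -> R) :
  nu <= -1 -> sum3 k = 0 -> sol (ray a) k f -> (forall i, c i = 1 / 2) ->
  (forall i, BigO 1 (f i)) -> (forall i, BigO (-1) (fun t => / f i t)) ->
  (forall i, BigO (1 + nu) (fun _ => k i)) -> (forall i j, BigO (1 + nu) (fun t => f j t - f i t)) ->
  has_rate f c nu.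
Proof.
  intros Hnu Hk Hs Hc Hf Hg HkO Hd. split; [lra|].
  destruct (end_translation (1 + nu) a k f) as [L HL]; try assumption; [lra|].
  (* The translation that absorbs L, because (t + s) / 2 + L = t / 2 for s = -2 L. *)
  exists (- 2 * L). set (s := - 2 * L).
  assert (HS := end_symbol (1 + nu) (a - s) k (fun i t => f i (t + s)) ltac:(lra) (sol_shift a s k f Hs)).
  assert (HE : forall i, BigO (1 + nu) (fun t => f i (t + s) - t / 2)).
  { intros i; apply BigO_ext with (fun t => f i (t + s) - (t + s) / 2 - L).
    - exists 0; intros; unfold s; field.
    - apply (BigO_shift (1 + nu) s (fun t => f i t - t / 2 - L)), HL. }
  specialize (HS (fun i => BigO_shift _ s _ (Hg i)) HkO HE).
  intros i n.
  destruct (symbol_Derive_n 0 n (1 + nu) (fun r => f i (r + s) - c i * r)) as (g & [C HC] & HD).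
  { apply symbol_ext with (2 := HS (n + 0)%nat i). intros t; rewrite Hc; field. }
  exists C. apply (evt_imp _ _) with (2 := evt_and _ _ HC HD).
  intros t (B & E1 & E2). split; [exact E1 | rewrite E2; exact B].
Qed.

(** Optimality has to exclude every translation at once. As all c_i are equal, the linear part
    cancels in differences of the f's, so a rate bounds these differences up to a mere shift of the
    argument. *)
Lemma has_rate_diff (f : idx -> R -> R) (c : idx -> R) (nu : R) :
  (forall i, c i = 1 / 2) -> has_rate f c nu ->
  exists s, forall i j, BigO (1 + nu) (fun t => f j (t + s) - f i (t + s)).
Proof.
  intros Hc (Hnu & s & H). exists s.
  assert (HB : forall i, BigO (1 + nu) (fun t => f i (t + s) - c i * t)).
  { intros i; destruct (H i 0%nat) as [C HC]; exists C.
    apply (evt_imp _ _) with (2 := HC). intros t [_ B]; simpl in B.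
    rewrite Rminus_0_r in B. exact B. }
  intros i j. apply BigO_ext with (fun t => (f j (t + s) - c j * t) + -1 * (f i (t + s) - c i * t)).
  - exists 0; intros; rewrite !Hc; ring.
  - apply BigO_plus; [apply HB|]. apply (BigO_exp (0 + (1 + nu))); [|ring].
    apply BigO_mult; [apply BigO_const | apply HB].
Qed.

Lemma is_lim_shift (g : R -> R) (l s : R) : is_lim g p_infty l -> is_lim (fun t => g (t + s)) p_infty l.
Proof.
  intros H; apply is_lim_spec in H; apply is_lim_spec; intros eps.
  destruct (H eps) as [M HM]. exists (M - s); intros t Ht. apply HM; lra.
Qed.

Lemma static_iff (a : R) (k : idx -> R) (f : idx -> R -> R) (u : R -> R) :
  (forall t, a < t -> u t = drift k f t /\ forall i, torsion f i t = u t * f i t ^ 2 + k i) ->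
  static (ray a) f u <-> forall i, k i = 0.
Proof.
  intros H; split.
  - intros S i. assert (Ha : a < a + 1) by lra.
    destruct (S _ Ha) as [U T], (H _ Ha) as [_ E]. specialize (T i); specialize (E i).
    rewrite U in E. lra.
  - intros Hk t Ht. destruct (H t Ht) as [U E].
    assert (U0 : u t = 0) by (rewrite U; unfold drift, sum3; rewrite !Hk; unfold Rdiv; ring).
    split; [exact U0|]. intros i; rewrite E, U0, Hk; ring.
Qed.

(** A rate below -1 forces f_j - f_i to tend to 0, so all k_i coincide, and their zero sum makes the
    end static. For a static end a rate below -4 forces the conserved differences of the A_i to
    vanish, so the f_i coincide and each has derivative 1/2: the end is an exact cone. *)
Lemma AC_end_rates (a : R) (f : idx -> R -> R) (u : R -> R) (c : idx -> R) :
  AC_end a f u c ->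
  (forall i, c i = 1 / 2) /\
  (~ static (ray a) f u -> optimal_rate f c (-1)) /\
  (static (ray a) f u -> has_rate f c (-4) /\ (~ exact_cone a f c -> optimal_rate f c (-4))).
Proof.
  intros [Hsol HcL].
  destruct (sol_of_soliton a f u Hsol) as (k & Hk & Hs & Hu).
  assert (Hc : forall i, c i = 1 / 2)
    by (intros i; apply (cone_half Hs (fun i => proj1 (HcL i)) (fun i => proj2 (HcL i)))).
  assert (Hl : forall i, is_lim (fun t => f i t / t) p_infty (1 / 2))
    by (intros i; rewrite <- (Hc i); apply HcL).
  assert (Hf := f_BigO Hl). assert (Hg := inv_f_BigO Hs Hl).
  assert (Hst := static_iff a k f u Hu).
  split; [exact Hc | split].
  - intros Hns; split.
    + apply (end_has_rate (-1) a k f c); try assumption; [lra | |].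
      * intros i; apply (BigO_exp 0); [apply BigO_const | ring].
      * intros i j; apply (BigO_exp 0); [|ring]. eapply BigO_lim, (diff_lim Hs Hl).
    + intros nu Hnu HR. apply Hns, Hst.
      destruct (has_rate_diff f c nu Hc HR) as [s HB].
      assert (E : forall i j, k j = k i).
      { intros i j.
        assert (L0 := BigO_neg_lim (1 + nu) _ ltac:(lra) (HB i j)).
        assert (L1 := is_lim_shift _ _ s (diff_lim Hs Hl i j)).
        apply is_lim_unique in L0; apply is_lim_unique in L1. rewrite L0 in L1. injection L1; lra. }
      unfold sum3 in Hk. intros i; assert (E1 := E i i1); assert (E2 := E i i2); assert (E3 := E i i3). lra.
  - intros HS; assert (HS0 := proj1 Hst HS); clear HS; rename HS0 into HS.
    assert (HR : has_rate f c (-4)).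
    { apply (end_has_rate (-4) a k f c); try assumption; [lra | |].
      - intros i; rewrite HS; apply BigO_zero.
      - intros i j; apply (BigO_exp (-3)); [|ring]. apply (static_diff_BigO Hs Hl), HS. }
    split; [exact HR|]. intros Hne; split; [exact HR|].
    intros nu Hnu HR'. apply Hne. clear HR.
    destruct (has_rate_diff f c nu Hc HR') as [s HB].
    assert (E : forall i j t, a < t -> f j t = f i t).
    { intros i j t Ht. destruct (idx_eq_dec i j) as [<-|Hij]; [reflexivity|].
      set (m := third i j). destruct (static_psi_constant Hs i j HS Hij) as [C HC]. fold m in HC.
      (* The factor f_m^2 (f_i + f_j) is of order 3 and f_j - f_i of order 1 + nu; since 4 + nu < 0,
         the constant [psi 1] must be 0. *)
      assert (B : BigO (4 + nu) (fun t => psi 1 (f i (t + s)) (f j (t + s)) (f m (t + s)))).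
      { apply BigO_ext with (fun t => f m (t + s) * f m (t + s) * (f i (t + s) + f j (t + s))
           * (f j (t + s) - f i (t + s))).
        - exists 0; intros; unfold psi; ring.
        - apply (BigO_exp (1 + 1 + 1 + (1 + nu))); [|ring].
          assert (S := fun i => BigO_shift _ s _ (Hf i)).
          apply BigO_mult; [apply BigO_mult; [apply BigO_mult; apply S | apply BigO_plus; apply S] | apply HB]. }
      apply BigO_neg_lim in B; [|lra].
      assert (L1 : is_lim (fun t => psi 1 (f i (t + s)) (f j (t + s)) (f m (t + s))) p_infty C).
      { apply is_lim_ext_loc with (fun _ => C); [|apply is_lim_cst].
        exists (a - s); intros r Hr; symmetry; apply HC; lra. }
      apply is_lim_unique in B; apply is_lim_unique in L1. rewrite B in L1.
      assert (C0 : C = 0) by (injection L1; auto).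
      assert (E := HC t Ht). rewrite C0 in E. unfold psi in E.
      assert (P1 := proj1 (Hs t Ht i)); assert (P2 := proj1 (Hs t Ht j)); assert (P3 := proj1 (Hs t Ht m)).
      apply Rmult_integral in E. destruct E as [E|E]; [|nra].
      assert (0 < f m t ^ 2) by (apply pow_lt, P3). lra. }
    set (q := fun t => f i1 t - t / 2).
    assert (Hq : forall t, a < t -> is_derive q t 0).
    { intros t Ht. apply is_derive_val with (vf (fun j => f j t) k i1 - / 2).
      - apply (is_derive_minus (f i1) (fun t => t / 2)); [apply (Hs t Ht)|]. auto_derive; [exact I | field].
      - unfold vf, rhs; simpl nx. rewrite (E i1 i2 t Ht), (E i1 i3 t Ht), !HS.
        assert (P := proj1 (Hs t Ht i1)). field; lra. }
    (* The constant value of f_i - t / 2 is half of the translation, as the slope is 1/2. *)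
    exists (2 * q (a + 1)). intros i t Ht. rewrite (E i1 i t Ht), Hc.
    assert (Eq := ray_constant a q Hq t (a + 1) Ht ltac:(lra)). unfold q in *. lra.
Qed.

(** * The three-parameter family *)

(** T = 0 serves the explicit family, which starts in the trapping region; a positive T serves
    perturbations, which first follow a given end until it has entered the region. *)
Lemma tflow_AC (N T : R) (k f0 : idx -> R) :
  2 <= N -> sum3 k = 0 -> (forall i, Rabs (k i) <= N) -> 0 <= T ->
  (forall i, / N < f0 i /\ forall j, f0 i < N * f0 j) ->
  (forall t, 0 <= t <= T -> in_range N (fun i => tflow N k f0 i t) k) ->
  trap (fun i => tflow N k f0 i T) k -> (forall i, / N < tflow N k f0 i T) ->
  exists a, a < 0 /\ sol (ray a) k (tflow N k f0) /\
    AC_end a (tflow N k f0) (drift k (tflow N k f0)) (fun _ => 1 / 2).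
Proof.
  intros HN Hk Hk' HT H0 HR Htr HtN.
  assert (HN1 : 1 <= N) by lra.
  assert (HN0 : 0 < / N) by (apply Rinv_0_lt_compat; lra).
  assert (HF := trap_forward N T k f0 HN Hk' Htr HtN).
  (* The initial time must lie inside an open ray. The strict inequalities at time 0 keep the
     cutoffs inactive for a short while before it. *)
  assert (HL : locally 0 (fun t => in_range N (fun i => tflow N k f0 i t) k)).
  { apply (filter_idx (fun i t => / N <= tflow N k f0 i t /\ Rabs (k i) <= N /\
       forall j, tflow N k f0 i t <= N * tflow N k f0 j t)).
    intros i; destruct (H0 i) as [H1 H2]. apply filter_and; [|apply filter_and].
    - apply (filter_imp (fun t => / N < tflow N k f0 i t)); [intros; lra|].
      apply (tflow_continuous N k f0 i 0 HN1 (fun y => / N < y)), (open_gt (/ N)).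
      rewrite tflow_init; assumption.
    - apply filter_forall; intros _; apply Hk'.
    - apply (filter_idx (fun j t => tflow N k f0 i t <= N * tflow N k f0 j t)). intros j.
      apply (filter_imp (fun t => 0 < N * tflow N k f0 j t + -1 * tflow N k f0 i t)); [intros; lra|].
      apply (continuous_pos_locally (fun t => N * tflow N k f0 j t + -1 * tflow N k f0 i t)).
      + apply continuous_lincomb; apply tflow_continuous, HN1.
      + rewrite !tflow_init by exact HN1. specialize (H2 j); lra. }
  destruct HL as [e He]. assert (He0 := cond_pos e).
  assert (HA : forall t, - (e / 2) < t -> in_range N (fun i => tflow N k f0 i t) k).
  { intros t Ht. destruct (Rlt_le_dec t 0) as [L|L]; [apply He, Rabs_lt_between'; lra|].
    destruct (Rle_dec t T) as [L'|L']; [apply HR; lra|].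
    destruct (HF t ltac:(lra)) as [A B].
    apply wtrap_in_range; [exact HN | exact Hk' | intros; left; apply B | apply trap_wtrap, A]. }
  assert (HS : sol (ray (- (e / 2))) k (tflow N k f0)).
  { intros t Ht i; split.
    - destruct (HA t Ht i); lra.
    - apply tflow_derive; [exact HN1 | apply HA, Ht]. }
  exists (- (e / 2)); split; [lra | split; [exact HS|]].
  split; [apply soliton_of_sol; assumption|].
  intros i; split; [lra|].
  apply (trap_AC T k (tflow N k f0)).
  intros t Ht; split; [apply trap_wtrap, HF, Ht|].
  intros j. assert (Hr : ray (- (e / 2)) t) by (unfold ray; lra). apply (HS t Hr j).
Qed.

(** Two constants giving the same field differ by f_i^2 W with a common W, and both sums being zero
    forces W = 0. Ends that agree for late times therefore have the same k. *)
Lemma vf_injective (f k k' : idx -> R) :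
  (forall i, 0 < f i) -> sum3 k = 0 -> sum3 k' = 0 ->
  (forall i, vf f k i = vf f k' i) -> forall i, k i = k' i.
Proof.
  intros Hf Hk Hk' H.
  set (W := sum3 (fun j => (k j - k' j) / f j ^ 2) / 3).
  assert (E : forall i, k i - k' i = f i ^ 2 * W).
  { assert (P1 := Hf i1); assert (P2 := Hf i2); assert (P3 := Hf i3).
    intros i. assert (V := H i).
    assert (V' : 2 * f i * (vf f k i - vf f k' i) = k i - k' i - f i ^ 2 * W).
    { unfold vf, rhs, W, sum3; destruct i; simpl nx; field; lra. }
    rewrite V in V'. lra. }
  assert (HW : W = 0).
  { unfold sum3 in Hk, Hk'. assert (E1 := E i1); assert (E2 := E i2); assert (E3 := E i3).
    assert (P1 := pow_lt _ 2 (Hf i1)); assert (P2 := pow_lt _ 2 (Hf i2)); assert (P3 := pow_lt _ 2 (Hf i3)).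
    assert (Z : (f i1 ^ 2 + f i2 ^ 2 + f i3 ^ 2) * W = 0) by lra.
    apply Rmult_integral in Z. lra. }
  intros i; specialize (E i). rewrite HW in E. lra.
Qed.

(** f_1 = 1 fixes the scale and f_2 = 21/20 selects the time slice, leaving f_3 and two of the k's
    free. The arctangent maps the whole line injectively to a bounded interval, and the divisors 100
    and 1000 keep all data inside the trapping region and the range of N = 2: f between 0.98 and
    1.05, |k| below 0.004. *)
Definition f0_of (p : R * R * R) (i : idx) : R :=
  match i with i1 => 1 | i2 => 21 / 20 | i3 => 1 + atan (fst (fst p)) / 100 end.

Definition k_of (p : R * R * R) (i : idx) : R :=
  match i with
  | i1 => atan (snd (fst p)) / 1000
  | i2 => atan (snd p) / 1000
  | i3 => - (atan (snd (fst p)) / 1000 + atan (snd p) / 1000)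
  end.

Definition end_of (p : R * R * R) : idx -> R -> R := tflow 2 (k_of p) (f0_of p).

Lemma atan_abs_lt2 (x : R) : - 2 < atan x < 2.
Proof. assert (A := atan_bound x). assert (B := PI_4). lra. Qed.

Lemma k_of_sum (p : R * R * R) : sum3 (k_of p) = 0.
Proof. unfold sum3; simpl; ring. Qed.

Lemma k_of_bound (p : R * R * R) (i : idx) : Rabs (k_of p i) < 4 / 1000.
Proof.
  assert (A := atan_abs_lt2 (snd (fst p))); assert (B := atan_abs_lt2 (snd p)).
  apply Rabs_lt_between; destruct i; simpl; lra.
Qed.

Lemma f0_of_bound (p : R * R * R) (i : idx) : 98 / 100 < f0_of p i <= 105 / 100.
Proof. assert (A := atan_abs_lt2 (fst (fst p))). destruct i; simpl; lra. Qed.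

Lemma f0_of_trap (p : R * R * R) : trap (f0_of p) (k_of p).
Proof.
  intros i; assert (A := f0_of_bound p i). repeat split; [lra | |]; intros j.
  - assert (B := f0_of_bound p j); lra.
  - assert (B := k_of_bound p j); lra.
Qed.

Lemma end_of_init (p : R * R * R) (i : idx) : end_of p i 0 = f0_of p i.
Proof. apply tflow_init; lra. Qed.

Lemma end_of_init_fun (p : R * R * R) : (fun i => end_of p i 0) = f0_of p.
Proof. apply functional_extensionality; intros; apply end_of_init. Qed.

Lemma end_of_trap (p : R * R * R) (t : R) : 0 <= t -> trap (fun i => end_of p i t) (k_of p).
Proof.
  intros Ht. apply (trap_forward 2 0 (k_of p) (f0_of p)); [lra | | | | exact Ht].
  - intros i; assert (B := k_of_bound p i); lra.
  - fold (end_of p). rewrite end_of_init_fun. apply f0_of_trap.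
  - intros i; fold (end_of p). rewrite end_of_init. assert (B := f0_of_bound p i); lra.
Qed.

Lemma end_of_AC (p : R * R * R) :
  exists a, a < 0 /\ sol (ray a) (k_of p) (end_of p) /\
    AC_end a (end_of p) (drift (k_of p) (end_of p)) (fun _ => 1 / 2).
Proof.
  apply (tflow_AC 2 0); [lra | apply k_of_sum | | lra | | | |].
  - intros i; assert (B := k_of_bound p i); lra.
  - intros i; assert (B := f0_of_bound p i); split; [lra|].
    intros j; assert (B' := f0_of_bound p j); lra.
  - intros t Ht; replace t with 0 by lra. fold (end_of p). rewrite end_of_init_fun.
    apply wtrap_in_range; [lra | | | apply trap_wtrap, f0_of_trap].
    + intros i; assert (B := k_of_bound p i); lra.
    + intros i; assert (B := f0_of_bound p i); lra.
  - fold (end_of p). rewrite end_of_init_fun. apply f0_of_trap.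
  - intros i; fold (end_of p). rewrite end_of_init. assert (B := f0_of_bound p i); lra.
Qed.

Lemma sol_restrict (a b : R) (k : idx -> R) (f : idx -> R -> R) : a <= b -> sol (ray a) k f -> sol (ray b) k f.
Proof. intros Hab H t Ht; apply H. unfold ray in *; lra. Qed.

Lemma atan_injective (x y : R) : atan x = atan y -> x = y.
Proof. intros H; rewrite <- (tan_atan x), <- (tan_atan y), H; reflexivity. Qed.

(* The data at time 0 lie on [psi (21/20) f1 f2 f3 = 0], and [psi] strictly
   decreases, so the orbit of an end never returns to this slice. *)
Lemma same_end_forward (p q : R * R * R) (mu s : R) :
  0 < mu -> 0 <= s ->
  evt (fun t => forall i, end_of q i (mu * t + s) = mu * end_of p i t) -> p = q.
Proof.
  intros Hmu Hs0 He.
  destruct (end_of_AC p) as (a & Ha & Hp & _). destruct (end_of_AC q) as (b & Hb & Hq & _).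
  set (h := fun i t => end_of q i (mu * t + s) / mu).
  set (kh := fun i => k_of q i / mu).
  (* The end of q, read in the scale and time of p, is a solution with the constants k / mu, so it
     can be compared with the end of p directly. *)
  assert (Hh := sol_scale b mu s (k_of q) (end_of q) Hmu Hq). fold h kh in Hh.
  assert (Hbs : (b - s) / mu < 0) by (apply Rlt_div_l; lra).
  set (c := Rmax a ((b - s) / mu)).
  assert (Hc1 : a <= c) by apply Rmax_l. assert (Hc2 : (b - s) / mu <= c) by apply Rmax_r.
  assert (Hc0 : c < 0) by (apply Rmax_lub_lt; assumption).
  assert (Hp' := sol_restrict a c _ _ Hc1 Hp). assert (Hh' := sol_restrict _ c _ _ Hc2 Hh).
  destruct He as [M HM].
  assert (Heq : forall i t, M < t -> h i t = end_of p i t).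
  { intros i t Ht; unfold h; rewrite (HM t Ht i). field; lra. }
  set (t1 := Rmax M 0 + 1).
  assert (Ht1 : M < t1) by (assert (A := Rmax_l M 0); unfold t1; lra).
  assert (Ht1' : 0 <= t1) by (assert (A := Rmax_r M 0); unfold t1; lra).
  assert (Hct1 : c < t1) by lra.
  assert (Hkk : forall i, k_of p i = kh i).
  { apply (vf_injective (fun i => end_of p i t1)).
    - intros i; apply (Hp' t1 Hct1).
    - apply k_of_sum.
    - assert (A := k_of_sum q). unfold sum3, kh in *.
      replace (k_of q i1 / mu + k_of q i2 / mu + k_of q i3 / mu)
        with ((k_of q i1 + k_of q i2 + k_of q i3) / mu) by (field; lra).
      rewrite A; unfold Rdiv; ring.
    - intros i.
      assert (D1 := proj2 (Hp' t1 Hct1 i)). assert (D2 := proj2 (Hh' t1 Hct1 i)).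
      replace (fun j => h j t1) with (fun j => end_of p j t1) in D2
        by (apply functional_extensionality; intros; symmetry; apply Heq, Ht1).
      assert (D3 : is_derive (end_of p i) t1 (vf (fun j => end_of p j t1) kh i)).
      { apply is_derive_ext_loc with (h i); [|exact D2].
        apply (filter_imp (fun t => M < t)); [intros; apply Heq; assumption | apply (open_gt M), Ht1]. }
      rewrite <- (is_derive_unique _ _ _ D1). apply is_derive_unique, D3. }
  assert (Hkf : k_of p = kh) by (apply functional_extensionality, Hkk).
  assert (H0 : forall i, end_of p i 0 = h i 0).
  (* Agreement at a late time is carried back to time 0: at its time s, the end of q has mu times
     the initial values of p. *)
  { apply (sol_unique c 0 t1 kh); try assumption.
    - rewrite <- Hkf; exact Hp'.
    - intros i; symmetry; apply Heq, Ht1. }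
  assert (Hfs : forall i, end_of q i s = mu * f0_of p i).
  { intros i; specialize (H0 i). rewrite end_of_init in H0. unfold h in H0.
    rewrite H0, Rmult_0_r, Rplus_0_l. field; lra. }
  assert (Hs : s = 0).
  { destruct Hs0 as [Hs0|Hs0]; [exfalso | auto].
    assert (L : psi (21 / 20) (end_of q i1 s) (end_of q i2 s) (end_of q i3 s) <
                psi (21 / 20) (end_of q i1 0) (end_of q i2 0) (end_of q i3 0)).
    { apply (derive_neg_lt (fun s => psi (21 / 20) (end_of q i1 s) (end_of q i2 s) (end_of q i3 s))
       (fun s => dpsi (21 / 20) (end_of q i1 s) (end_of q i2 s) (end_of q i3 s)
          (k_of q i1) (k_of q i2) (k_of q i3))); [exact Hs0 | |].
      - intros x Hx. apply (psi_derive_idx (21 / 20) x (k_of q) (end_of q) i1 i2); [discriminate|].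
        apply Hq. unfold ray; lra.
      - intros x Hx. apply (wtrap_psi_neg (21 / 20) (fun i => end_of q i x) (k_of q) i1 i2); [|lra].
        apply trap_wtrap, end_of_trap, Hx. }
    rewrite !Hfs, !end_of_init in L. unfold psi in L; simpl f0_of in L.
    (* Both sides are 0: the slice is invariant under scaling, so it contains mu times the data of p
       as well as the data of q. *)
    match type of L with ?l < ?r => replace l with r in L by field end. lra. }
  subst s.
  assert (Hf : forall i, f0_of q i = mu * f0_of p i) by (intros i; rewrite <- Hfs, end_of_init; reflexivity).
  assert (Hmu1 : mu = 1) by (assert (A := Hf i1); simpl in A; lra).
  subst mu.
  assert (A1 := Hf i3); assert (A2 := Hkk i1); assert (A3 := Hkk i2).
  unfold kh in A2, A3; simpl in A1, A2, A3.
  destruct p as [[x y] z], q as [[x' y'] z']; simpl in *.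
  assert (B1 : atan x = atan x') by lra. assert (B2 : atan y = atan y') by lra.
  assert (B3 : atan z = atan z') by lra.
  apply atan_injective in B1; apply atan_injective in B2; apply atan_injective in B3.
  congruence.
Qed.

(** The trapping region controls only forward times, hence a nonnegative shift. If s < 0, the
    inverse change of scale and time has the positive shift -s / mu, and p and q exchange roles. *)
Lemma end_of_injective (p q : R * R * R) : same_end (end_of p) (end_of q) -> p = q.
Proof.
  intros (mu & s & Hmu & [M HM]).
  destruct (Rle_dec 0 s) as [Hs|Hs].
  - apply (same_end_forward p q mu s Hmu Hs). exists M; exact HM.
  - symmetry. apply (same_end_forward q p (/ mu) (- (s / mu))).
    + apply Rinv_0_lt_compat, Hmu.
    + assert (s / mu < 0) by (apply Rlt_div_l; lra). lra.
    + exists (mu * M + s); intros t Ht i.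
      assert (Ht' : M < / mu * t + - (s / mu)).
      { replace (/ mu * t + - (s / mu)) with ((t - s) / mu) by (field; lra). apply Rlt_div_r; lra. }
      assert (A := HM _ Ht' i).
      replace (mu * (/ mu * t + - (s / mu)) + s) with t in A by (field; lra).
      rewrite A. field; lra.
Qed.

Lemma continuous_add {T : UniformSpace} (f g : T -> R) (x : T) :
  continuous f x -> continuous g x -> continuous (fun y => f y + g y) x.
Proof. apply (continuous_plus (K := R_AbsRing) (V := R_NormedModule) f g). Qed.

Lemma continuous_mul {T : UniformSpace} (f g : T -> R) (x : T) :
  continuous f x -> continuous g x -> continuous (fun y => f y * g y) x.
Proof. apply (continuous_mult (K := R_AbsRing) f g). Qed.

Lemma continuous_inverse {T : UniformSpace} (f : T -> R) (x : T) :
  continuous f x -> f x <> 0 -> continuous (fun y => / f y) x.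
Proof. intros H H0; apply (continuous_comp f Rinv); [exact H | apply continuous_Rinv, H0]. Qed.

(** Balls in the space of states are uniform over the indices; there are finitely many, so
    continuity may be checked coordinatewise. *)
Lemma continuous_state {T : UniformSpace} (g : T -> state) (x : T) :
  (forall i, continuous (fun y => fst (g y) i) x) ->
  (forall i, continuous (fun y => snd (g y) i) x) -> continuous g x.
Proof.
  intros H1 H2. apply filterlim_locally; intros eps.
  apply (filter_imp (fun y => (forall i, ball (fst (g x) i) eps (fst (g y) i)) /\
                              (forall i, ball (snd (g x) i) eps (snd (g y) i)))).
  - intros y [A B]; split; intros i; [apply A | apply B].
  - apply filter_and.
    + apply (filter_idx (fun i y => ball (fst (g x) i) eps (fst (g y) i))). intros i.
      apply (proj1 (filterlim_locally _ _) (H1 i) eps).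
    + apply (filter_idx (fun i y => ball (snd (g x) i) eps (snd (g y) i))). intros i.
      apply (proj1 (filterlim_locally _ _) (H2 i) eps).
Qed.

(** The torsion is defined through a derivative of the flow, but the equations express it by f and
    k, which at time 0 are explicit in the parameters. Continuity is then elementary. *)
Lemma end_of_state (p : R * R * R) :
  state_at (end_of p) 0 =
  (f0_of p, fun i => - ((k_of p i1 * / (f0_of p i1 * f0_of p i1) + k_of p i2 * / (f0_of p i2 * f0_of p i2)
      + k_of p i3 * / (f0_of p i3 * f0_of p i3)) * / 3) * (f0_of p i * f0_of p i) + k_of p i).
Proof.
  destruct (end_of_AC p) as (a & Ha & Hp & _).
  unfold state_at; f_equal; [apply end_of_init_fun|].
  apply functional_extensionality; intros i.
  rewrite (sol_torsion _ _ _ _ Hp Ha i). unfold drift, sum3. rewrite !end_of_init.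
  assert (P1 := f0_of_bound p i1); assert (P2 := f0_of_bound p i2); assert (P3 := f0_of_bound p i3).
  field. lra.
Qed.

Lemma end_of_continuous (p : R * R * R) : continuous (fun q => state_at (end_of q) 0) p.
Proof.
  apply (continuous_ext (fun p => (f0_of p, fun i => - ((k_of p i1 * / (f0_of p i1 * f0_of p i1)
     + k_of p i2 * / (f0_of p i2 * f0_of p i2)
     + k_of p i3 * / (f0_of p i3 * f0_of p i3)) * / 3) * (f0_of p i * f0_of p i) + k_of p i) : state)).
  { intros q; symmetry; apply end_of_state. }
  assert (HA : forall g : R * R * R -> R, continuous g p -> continuous (fun q => atan (g q)) p).
  { intros g Hg; apply (continuous_comp g atan); [exact Hg | apply continuous_atan]. }
  assert (X1 : continuous (fun q : R * R * R => fst (fst q)) p).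
  { apply (continuous_comp fst fst); destruct p as [[] ]; apply continuous_fst. }
  assert (X2 : continuous (fun q : R * R * R => snd (fst q)) p).
  { apply (continuous_comp fst snd); destruct p as [[] ]; [apply continuous_fst | apply continuous_snd]. }
  assert (X3 : continuous (fun q : R * R * R => snd q) p) by (destruct p as [[] ]; apply continuous_snd).
  assert (HC : forall c : R, continuous (fun _ : R * R * R => c) p) by (intros; apply continuous_const).
  assert (HF : forall i, continuous (fun q => f0_of q i) p).
  { intros []; simpl; [apply HC | apply HC|].
    apply continuous_add; [apply HC | apply continuous_mul; [apply HA, X1 | apply HC]]. }
  assert (HN : forall g : R * R * R -> R, continuous g p -> continuous (fun q => - g q) p).
  { intros g Hg; apply (continuous_opp (K := R_AbsRing) (V := R_NormedModule) g), Hg. }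
  assert (HK : forall i, continuous (fun q => k_of q i) p).
  { intros []; simpl; [| |apply HN, continuous_add];
      (apply continuous_mul; [apply HA; assumption | apply HC]). }
  apply continuous_state; intros i; cbn [fst snd]; [apply HF|].
  apply continuous_add; [|apply HK]. apply continuous_mul; [|apply continuous_mul; apply HF].
  apply HN, continuous_mul; [|apply HC].
  assert (HQ : forall j, continuous (fun q => k_of q j * / (f0_of q j * f0_of q j)) p).
  { intros j; apply continuous_mul; [apply HK|]. apply continuous_inverse.
    - apply continuous_mul; apply HF.
    - assert (B := f0_of_bound p j). nra. }
  apply continuous_add; [apply continuous_add|]; apply HQ.
Qed.

Lemma end_of_static (p : R * R * R) (a : R) : sol (ray a) (k_of p) (end_of p) ->
  static (ray a) (end_of p) (drift (k_of p) (end_of p)) <-> snd (fst p) = 0 /\ snd p = 0.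
Proof.
  intros Hp.
  assert (S := static_iff a (k_of p) (end_of p) (drift (k_of p) (end_of p))
    (fun t Ht => conj eq_refl (sol_torsion _ _ _ t Hp Ht))).
  assert (E : (forall i, k_of p i = 0) <-> snd (fst p) = 0 /\ snd p = 0).
  { split.
    - intros H; assert (A := H i1); assert (B := H i2); simpl in A, B.
      split; apply atan_injective; rewrite atan_0; lra.
    - intros [A B] []; simpl; rewrite ?A, ?B, atan_0; field. }
  tauto.
Qed.

(** * Openness *)

(** Recovers k_i = tau_i - u f_i^2 from a state, with u read off from the trace equation as the
    quotient of the sums of tau_i and f_i^2. *)
Definition constants_of (y : state) (i : idx) : R :=
  snd y i - sum3 (snd y) / sum3 (fun j => fst y j ^ 2) * fst y i ^ 2.

Lemma sum_sqr_pos (f : idx -> R) : (forall i, 0 < f i) -> 0 < sum3 (fun i => f i ^ 2).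
Proof.
  intros H. assert (P1 := pow_lt _ 2 (H i1)); assert (P2 := pow_lt _ 2 (H i2)); assert (P3 := pow_lt _ 2 (H i3)).
  unfold sum3; lra.
Qed.

Lemma constants_of_sum (y : state) : (forall i, 0 < fst y i) -> sum3 (constants_of y) = 0.
Proof.
  intros H; assert (P := sum_sqr_pos _ H). unfold constants_of, sum3 in *. field. lra.
Qed.

(** The two expressions for u must agree. The sum of k_j / f_j^2 is the sum of tau_j / f_j^2 minus 3
    u, and the equation defining the phase space makes the former sum vanish. *)
Lemma constants_of_torsion (y : state) (i : idx) : phase_space y ->
  - sum3 (fun j => constants_of y j / fst y j ^ 2) / 3 * fst y i ^ 2 + constants_of y i = snd y i.
Proof.
  intros [H H0]. assert (P := sum_sqr_pos _ H).
  assert (P1 := H i1); assert (P2 := H i2); assert (P3 := H i3).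
  set (W := sum3 (snd y) / sum3 (fun j => fst y j ^ 2)).
  assert (E : sum3 (fun j => constants_of y j / fst y j ^ 2) = sum3 (fun j => snd y j / fst y j ^ 2) - 3 * W).
  { unfold constants_of; fold W. unfold sum3. field. lra. }
  rewrite E, H0. unfold constants_of; fold W. field.
Qed.

Lemma constants_of_solution (a t : R) (k : idx -> R) (f : idx -> R -> R) :
  sol (ray a) k f -> a < t -> sum3 k = 0 -> forall i, constants_of (state_at f t) i = k i.
Proof.
  intros H Ht Hk i.
  assert (HP : forall i, 0 < f i t) by (intros; apply (H t Ht)).
  assert (P := sum_sqr_pos _ HP).
  assert (T := fun i => sol_torsion _ k f t H Ht i).
  unfold constants_of, state_at; cbn [fst snd]. rewrite T.
  set (S := sum3 (fun j => f j t ^ 2)) in *.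
  replace (sum3 (fun j => torsion f j t)) with (drift k f t * S).
  - field; lra.
  - unfold S, sum3 in *; rewrite !T. lra.
Qed.

Lemma continuous_fst_at (x : state) (i : idx) : continuous (fun y : state => fst y i) x.
Proof. apply filterlim_locally; intros eps. exists eps; intros y [H _]; apply H. Qed.

Lemma continuous_snd_at (x : state) (i : idx) : continuous (fun y : state => snd y i) x.
Proof. apply filterlim_locally; intros eps. exists eps; intros y [_ H]; apply H. Qed.

Lemma constants_of_continuous (x : state) (i : idx) : (forall i, 0 < fst x i) ->
  continuous (fun y => constants_of y i) x.
Proof.
  intros H. assert (P := sum_sqr_pos _ H).
  apply (continuous_ext (fun y : state => snd y i + -1 * ((snd y i1 + snd y i2 + snd y i3) *
     / (fst y i1 * fst y i1 + fst y i2 * fst y i2 + fst y i3 * fst y i3) * (fst y i * fst y i)))).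
  { intros y; unfold constants_of, sum3, Rdiv; simpl. rewrite !Rmult_1_r. ring. }
  assert (F := continuous_fst_at x). assert (S := continuous_snd_at x).
  assert (HC : forall c : R, continuous (fun _ : state => c) x) by (intros; apply continuous_const).
  apply continuous_add; [apply S|].
  apply continuous_mul; [apply HC|].
  apply continuous_mul; [|apply continuous_mul; apply F].
  apply continuous_mul.
  - apply continuous_add; [apply continuous_add|]; apply S.
  - apply continuous_inverse.
    + apply continuous_add; [apply continuous_add|]; apply continuous_mul; apply F.
    + unfold sum3 in P; simpl in P; lra.
Qed.

Definition close (d : R) (f k f' k' : idx -> R) : Prop :=
  forall i, Rabs (f' i - f i) <= d /\ Rabs (k' i - k i) <= d.

Lemma trap_robust (f k : idx -> R) : trap f k ->
  exists d, 0 < d /\ forall f' k', close d f k f' k' -> trap f' k'.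
Proof.
  intros H.
  (* Stated as a property of all small d > 0, so that a common d for the finitely many pairs of
     indices comes from intersecting filter sets. *)
  assert (HF : at_right 0 (fun d => forall i j, forall f' k', close d f k f' k' ->
     f' j < 11 / 10 * f' i /\ 100 * Rabs (k' j) < f' i)).
  { apply (filter_idx (F := at_right 0) (fun i d => forall j, forall f' k', close d f k f' k' ->
      f' j < 11 / 10 * f' i /\ 100 * Rabs (k' j) < f' i)). intros i.
    apply (filter_idx (F := at_right 0) (fun j d => forall f' k', close d f k f' k' ->
      f' j < 11 / 10 * f' i /\ 100 * Rabs (k' j) < f' i)). intros j.
    destruct (H i) as (_ & A & B). specialize (A j); specialize (B j).
    set (m := Rmin (11 / 10 * f i - f j) (f i - 100 * Rabs (k j))).
    assert (M1 : m <= 11 / 10 * f i - f j) by apply Rmin_l.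
    assert (M2 : m <= f i - 100 * Rabs (k j)) by apply Rmin_r.
    assert (M0 : 0 < m) by (apply Rmin_glb_lt; lra).
    (* Moving f and k by d changes (11/10) f_i - f_j by at most 2.1 d and lowers f_i - 100 |k_j| by
       at most 101 d, so d < m / 200 is safe. *)
    assert (M0' : 0 < m / 200) by lra.
    exists (mkposreal _ M0'). intros d Hd Hd0 f' k' HC.
    assert (Hdm : d < m / 200).
    { apply Rabs_lt_between' in Hd; simpl in Hd. lra. }
    destruct (HC i) as [C1 _]. destruct (HC j) as [C2 C3].
    apply Rabs_le_between in C1; apply Rabs_le_between in C2.
    assert (C4 : Rabs (k' j) <= Rabs (k j) + d).
    { replace (k' j) with (k j + (k' j - k j)) by ring. apply Rabs_plus_le; lra. }
    split; lra. }
  destruct HF as [e He]. assert (He0 := cond_pos e).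
  exists (e / 2); split; [lra|]. intros f' k' HC.
  assert (HE := He (e / 2) ltac:(apply Rabs_lt_between'; lra) ltac:(lra)).
  intros i. repeat split.
  (* Positivity of f' is contained in the bound 100 |k'_i| < f'_i. *)
  - destruct (HE i i f' k' HC) as [_ B]. assert (A := Rabs_pos (k' i)); lra.
  - intros j; apply (HE i j f' k' HC).
  - intros j; apply (HE i j f' k' HC).
Qed.

(** On any end the ratios tend to 1 and the f_i to infinity while k stays fixed. Openness then
    becomes a question about a finite time interval. *)
Lemma end_eventually_trap (a : R) (k : idx -> R) (f : idx -> R -> R) :
  sol (ray a) k f -> (forall i, is_lim (fun t => f i t / t) p_infty (1 / 2)) ->
  evt (fun t => trap (fun i => f i t) k).
Proof.
  intros Hs Hl.
  apply (filter_idx (F := Rbar_locally p_infty) (fun i t => 0 < f i t /\ (forall j, f j t < 11 / 10 * f i t) /\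
    (forall j, 100 * Rabs (k j) < f i t))). intros i.
  assert (Hp := end_pos Hs).
  apply filter_and; [|apply filter_and].
  - apply (evt_imp _ _) with (2 := Hp). intros t [_ P]; apply P.
  - apply (filter_idx (F := Rbar_locally p_infty) (fun j t => f j t < 11 / 10 * f i t)). intros j.
    assert (R1 := half_ratio_lim Hs Hl j i). apply is_lim_spec in R1.
    assert (E : 0 < 1 / 10) by lra. specialize (R1 (mkposreal _ E)). simpl in R1.
    apply (evt_imp _ _) with (2 := evt_and _ _ Hp R1). intros t [[_ P] B].
    apply Rabs_lt_between in B. assert (Q : f j t / f i t < 11 / 10) by lra.
    apply (proj1 (Rlt_div_l _ (11 / 10) _ (P i))) in Q. exact Q.
  - apply (filter_idx (F := Rbar_locally p_infty) (fun j t => 100 * Rabs (k j) < f i t)). intros j.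
    assert (A := Rabs_pos (k j)).
    assert (R1 := end_inv_lim Hs (fun _ => ltac:(lra) : 0 < 1 / 2) Hl i). apply is_lim_spec in R1.
    assert (E : 0 < / (100 * Rabs (k j) + 1)) by (apply Rinv_0_lt_compat; lra).
    specialize (R1 (mkposreal _ E)). simpl in R1.
    apply (evt_imp _ _) with (2 := evt_and _ _ Hp R1). intros t [[_ P] B]. specialize (P i).
    rewrite Rminus_0_r, Rabs_pos_eq in B by (left; apply Rinv_0_lt_compat, P).
    assert (Q : 100 * Rabs (k j) + 1 < f i t); [|lra].
    apply Rnot_le_lt; intros Hn. apply Rinv_le_contravar in Hn; lra.
Qed.

Lemma cosh2_le (K t T : R) : 0 <= t <= T -> cosh2 K t <= 2 * exp (Rabs K * T).
Proof.
  intros Ht. unfold cosh2.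
  assert (H : forall x, Rabs x <= Rabs K * T -> exp x <= exp (Rabs K * T)).
  { intros x Hx. assert (A := Rle_abs x). destruct (Req_dec x (Rabs K * T)) as [->|Hne]; [lra|].
    left; apply exp_increasing; lra. }
  assert (B : Rabs (K * t) <= Rabs K * T).
  { rewrite Rabs_mult, (Rabs_pos_eq t) by lra. apply Rmult_le_compat_l; [apply Rabs_pos | lra]. }
  assert (H1 := H _ B). rewrite <- Rabs_Ropp in B. assert (H2 := H _ B). lra.
Qed.

Lemma state_ext (x y : state) :
  (forall i, fst x i = fst y i) -> (forall i, snd x i = snd y i) -> x = y.
Proof.
  destruct x, y; simpl; intros H1 H2; f_equal; apply functional_extensionality; assumption.
Qed.

(** The end through x enters the trapping region at a time t1. A nearby state is evolved by the
    truncated flow, which on the finite interval of length T = t1 - t0 stays close to the given end,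
    hence in range, and arrives inside the open region. Both the f's and the recovered constants k
    depend continuously on the state. *)
Lemma AC_end_open (x : state) : phase_space x -> leads_to_AC_end x ->
  within phase_space (locally x) leads_to_AC_end.
Proof.
  intros Hx (a & t0 & f & u & c & Ha & HAC & Hst).
  destruct (AC_end_rates a f u c HAC) as (Hc & _ & _).
  destruct HAC as [Hsol HcL].
  destruct (sol_of_soliton a f u Hsol) as (k & Hk & Hs & _).
  assert (Hl : forall i, is_lim (fun t => f i t / t) p_infty (1 / 2))
    by (intros i; rewrite <- (Hc i); apply HcL).
  destruct (end_eventually_trap a k f Hs Hl) as [M HM].
  set (t1 := Rmax M t0 + 1).
  assert (Ht1 : M < t1) by (assert (A := Rmax_l M t0); unfold t1; lra).
  assert (Ht01 : t0 <= t1) by (assert (A := Rmax_r M t0); unfold t1; lra).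
  set (T := t1 - t0).
  destruct (trap_robust _ k (HM t1 Ht1)) as (d1 & Hd1 & Hrob).
  destruct (sol_in_range a t0 t1 k f Ha Ht01 Hs) as (N & HN & HR0).
  assert (HR := HR0 N (Rle_refl N)). clear HR0.
  assert (HN1 : 1 <= N) by lra.
  destruct (tflow_dependence N HN1) as [K HK].
  (* The bound d1 puts the perturbed state at time T into the trapping region. The bound 1 / (N + 2)
     spends the spare factor 2 in f >= 2 / N and f_i <= (N / 2) f_j, so the perturbed solution stays
     strictly in the range of N. *)
  set (eta := Rmin d1 (/ (N + 2))).
  assert (Heta : 0 < eta) by (apply Rmin_glb_lt; [exact Hd1 | apply Rinv_0_lt_compat; lra]).
  assert (Heta1 : eta <= d1) by apply Rmin_l.
  assert (Heta2 : (N + 2) * eta <= 1).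
  { assert (E : eta <= / (N + 2)) by apply Rmin_r.
    apply (Rmult_le_compat_l (N + 2)) in E; [|lra]. rewrite Rinv_r in E; lra. }
  set (C := 2 * exp (Rabs K * T)).
  assert (HC : 1 <= C).
  { assert (E : exp 0 <= exp (Rabs K * T)).
    { destruct (Req_dec 0 (Rabs K * T)) as [<-|Hne]; [lra|]. left; apply exp_increasing.
      assert (0 <= Rabs K * T) by (apply Rmult_le_pos; [apply Rabs_pos | unfold T; lra]). lra. }
    rewrite exp_0 in E. unfold C; lra. }
  set (d := eta / C).
  assert (Hd : 0 < d) by (apply Rdiv_lt_0_compat; lra).
  assert (HdC : d * C = eta) by (unfold d; field; lra).
  assert (Hde : d <= eta) by nra.
  assert (Hfx : forall i, fst x i = f i t0) by (intros; rewrite <- Hst; reflexivity).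
  assert (Hkx : forall i, constants_of x i = k i)
    by (intros; rewrite <- Hst; apply (constants_of_solution a t0 k f Hs Ha Hk)).
  assert (Hnear : locally x (fun y => forall i, Rabs (fst y i - fst x i) < d /\
     Rabs (constants_of y i - constants_of x i) < d)).
  { apply (filter_idx (fun i y => Rabs (fst y i - fst x i) < d /\
     Rabs (constants_of y i - constants_of x i) < d)). intros i.
    apply filter_and.
    - apply (proj1 (filterlim_locally _ _) (continuous_fst_at x i) (mkposreal d Hd)).
    - apply (proj1 (filterlim_locally _ _) (constants_of_continuous x i (proj1 Hx)) (mkposreal d Hd)). }
  unfold within. apply (filter_imp _ _) with (2 := Hnear).
  intros y Hy Hyp.
  set (k' := constants_of y). set (g := tflow N k' (fst y)).
  assert (Hk' : forall i, Rabs (k' i - k i) <= d) by (intros i; rewrite <- Hkx; left; apply Hy).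
  assert (Hdep : forall t, 0 <= t <= T -> forall i, Rabs (g i t - f i (t0 + t)) <= eta).
  { intros t Ht i.
    rewrite (sol_eq_tflow N a t0 (t0 + t) k f HN1 Ha ltac:(lra) Hs).
    - replace (t0 + t - t0) with t by ring.
      apply Rle_trans with (d * cosh2 K t).
      + apply HK; [intros j; rewrite <- Hfx; left; apply Hy | exact Hk'].
      + rewrite <- HdC. apply Rmult_le_compat_l; [lra|]. apply cosh2_le; exact Ht.
    - intros s Hss. apply in_range_of_margin; [exact HN|]. intros j; apply HR. unfold T in Ht; lra. }
  assert (HkN : forall i, Rabs (k' i) <= N).
  { intros i. replace (k' i) with (k i + (k' i - k i)) by ring.
    eapply Rle_trans; [apply Rabs_triang|]. destruct (HR i t0 ltac:(lra)) as (_ & A & _).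
    assert (B := Hk' i). assert (eta <= 1) by nra. lra. }
  assert (HN0 : 0 < / N) by (apply Rinv_0_lt_compat; lra).
  assert (Hrange : forall t, 0 <= t <= T -> forall i, / N < g i t /\ forall j, g i t < N * g j t).
  { intros t Ht i. assert (Hti : t0 <= t0 + t <= t1) by (unfold T in Ht; lra).
    assert (HeN : eta < / N).
    { apply Rle_lt_trans with (/ (N + 2)); [apply Rmin_r|]. apply Rinv_lt_contravar; nra. }
    assert (A := Hdep t Ht). destruct (HR i (t0 + t) Hti) as (B1 & _ & B3).
    assert (Ai := A i); apply Rabs_le_between in Ai.
    split; [unfold Rdiv in B1; lra|].
    intros j. assert (Aj := A j); apply Rabs_le_between in Aj. specialize (B3 j).
    destruct (HR j (t0 + t) Hti) as (Bj & _ & _).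
    assert (Bj' : 2 <= f j (t0 + t) * N) by (apply Rle_div_l in Bj; lra).
    assert (N * (f j (t0 + t) - eta) <= N * g j t) by (apply Rmult_le_compat_l; lra). nra. }
  destruct (tflow_AC N T k' (fst y)) as (b & Hb & Hg & HAC').
  - exact HN.
  - apply constants_of_sum, Hyp.
  - exact HkN.
  - unfold T; lra.
  - intros i. assert (A := Hrange 0 ltac:(unfold T; lra) i). unfold g in A.
    rewrite tflow_init in A by exact HN1. destruct A as [A B]; split; [exact A|].
    intros j; specialize (B j). rewrite tflow_init in B by exact HN1. exact B.
  - intros t Ht i. destruct (Hrange t Ht i) as [A B]. split; [left; exact A | split; [apply HkN|]].
    intros j; left; apply B.
  - apply Hrob. intros i; split; [|eapply Rle_trans; [apply Hk' | lra]].
    eapply Rle_trans; [|exact Heta1].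
    assert (A := Hdep T ltac:(unfold T; lra) i). replace (t0 + T) with t1 in A by (unfold T; ring). exact A.
  - intros i; apply Hrange; unfold T; lra.
  (* The system is autonomous, so the perturbed end may be started at time 0 instead of t0. *)
  - fold g in Hg. exists b, 0, g, (drift k' g), (fun _ => 1 / 2).
    split; [exact Hb | split; [exact HAC'|]].
    assert (G0 : forall i, g i 0 = fst y i) by (intros; apply tflow_init, HN1).
    apply state_ext; intros i; unfold state_at; cbn [fst snd].
    + apply G0.
    + rewrite (sol_torsion _ _ _ _ Hg Hb i). unfold drift.
      rewrite <- (constants_of_torsion y i Hyp). unfold sum3. rewrite !G0. reflexivity.
Qed.

Theorem theorem5 :
  (* (i) *)
  (forall (a : R) (f : idx -> R -> R) (u : R -> R) (c : idx -> R),
     AC_end a f u c ->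
     (forall i, c i = 1 / 2) /\
     (~ static (ray a) f u -> optimal_rate f c (-1)) /\
     (static (ray a) f u ->
        has_rate f c (-4) /\ (~ exact_cone a f c -> optimal_rate f c (-4)))) /\
  (* (ii) *)
  (exists (f : R * R * R -> idx -> R -> R) (u : R * R * R -> R -> R),
     (forall p, exists (a : R) (c : idx -> R),
        a < 0 /\ AC_end a (f p) (u p) c /\
        (static (ray a) (f p) (u p) <-> snd (fst p) = 0 /\ snd p = 0)) /\
     (forall p, continuous (fun q => state_at (f q) 0) p) /\
     (forall p q, same_end (f p) (f q) -> p = q)) /\
  (* (iii) *)
  (forall x : state, phase_space x -> leads_to_AC_end x ->
     within phase_space (locally x) leads_to_AC_end).
Proof.
  split; [exact AC_end_rates | split; [|exact AC_end_open]].
  exists end_of, (fun p => drift (k_of p) (end_of p)). split; [|split].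
  - intros p. destruct (end_of_AC p) as (a & Ha & Hp & HAC).
    exists a, (fun _ => 1 / 2). split; [exact Ha | split; [exact HAC | apply end_of_static, Hp]].
  - exact end_of_continuous.
  - exact end_of_injective.
Qed.
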